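(* For every integer $k>0$ and partition $\lambda$, \[ p_k\,\tilde s_\lambda=\sum_\nu\Big(\sum_{d\mid k}\sum_\alpha(-1)^{ht(\lambda/\!\!/\alpha)+ht(\nu/\!\!/\alpha)}\Big)\tilde s_\nu, \] where the inner sum is over all partitions $\alpha$ such that both $\lambda/\!\!/\alpha$ and $\nu/\!\!/\alpha$ are border strips of size $d$.
   Context: A $d$ border strip is a skew diagram of $d$ cells that is connected and contains no $2\times2$ square; its height $ht$ is its number of rows minus one. For partitions $\lambda,\alpha$ and a sufficiently large integer $r$, $\lambda/\!\!/\alpha$ denotes the skew diagram $(r-|\lambda|,\lambda)/(r-|\alpha|,\alpha)$; whether it is a border strip and its height do not depend on $r$ once $r$ is large. $Sym=\mathbb{Q}[p_1,p_2,\ldots]$. A multiset partition of a multiset $S$ is a multiset of nonempty multisets with multiset union $S$; $\tilde m(\pi)$ is the partition of multiplicities of the distinct multisets in $\pi$. $\{\tilde h_\lambda\}$ is determined recursively by $h_\lambda=\sum_\pi\tilde h_{\tilde m(\pi)}$ over multiset partitions $\pi$ of $\{\!\!\{1^{\lambda_1},\ldots,\ell(\lambda)^{\lambda_{\ell(\lambda)}}\}\!\!\}$, and $\tilde s_\lambda=\sum_{|\mu|\le|\lambda|}K^{-1}_{(N-|\lambda|,\lambda),(N-|\mu|,\mu)}\tilde h_\mu$ for any $N\ge2|\lambda|$, $K^{-1}$ the inverse Kostka matrix.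
   Formalization: For strips of size d, λ//α is taken as (r−|λ|,λ)/(r−d−|α|,α) rather than (r−|λ|,λ)/(r−|α|,α), whose two shapes have equal size so that no strip of size d>0 exists; K^{-1}_{a,b} is read as the coefficient of h_b in s_a. *)

(* Defs.v *)
(* Sym = Q[p_1,p_2,...] is modelled as the monoid algebra
   {malg rat[cmonom nat]} (commutative polynomials in variables indexed by
   nat), with p_k := the variable of index k-1 (k >= 1). *)
From HB Require Import structures.
From mathcomp Require Import all_boot all_order all_algebra.
From mathcomp.multinomials Require Import monalg.

Set Implicit Arguments.
Unset Strict Implicit.
Unset Printing Implicit Defensive.

Import Order.TTheory GRing.Theory Num.Theory.
Local Open Scope ring_scope.

Definition Sym := {malg rat[cmonom nat]}.

Definition psum (k : nat) : Sym := << ucm (k.-1) >>.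

Definition is_part (l : seq nat) : bool :=
  sorted geq l && all (fun x => 0 < x)%N l.

(* all partitions of n with largest part <= m (fuel f >= n) *)
Fixpoint parts_bnd (f n m : nat) : seq (seq nat) :=
  if n == 0%N then [:: [::]] else
  match f with
  | 0 => [::]
  | f'.+1 => flatten [seq [seq i :: p | p <- parts_bnd f' (n - i) i]
                      | i <- iota 1 (minn n m)]
  end.

Definition parts (n : nat) : seq (seq nat) := parts_bnd n n n.

Definition parts_upto (n : nat) : seq (seq nat) :=
  flatten [seq parts m | m <- iota 0 n.+1].

Definition mult (mu : seq nat) (i : nat) : nat := count_mem i mu.

Definition zee (mu : seq nat) : nat :=
  \prod_(i <- undup mu) (i ^ mult mu i * (mult mu i)`!)%N.

Definition pprod (mu : seq nat) : Sym := \prod_(i <- mu) psum i.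

Definition hcomp (n : nat) : Sym :=
  \sum_(mu <- parts n) ((zee mu)%:R^-1 : rat) *: pprod mu.
Definition hprod (lam : seq nat) : Sym := \prod_(i <- lam) hcomp i.

(* Multisets of positive integers are represented canonically by       *)
(* sorted (nondecreasing) sequences.                                   *)
Fixpoint bitseqs (n : nat) : seq bitseq :=
  if n is n'.+1 then [seq b :: s | b <- [:: false; true], s <- bitseqs n']
  else [:: [::]].

Definition submsets (S : seq nat) : seq (seq nat) :=
  undup [seq sort leq (mask m S) | m <- bitseqs (size S) & m != nseq (size S) false].

Fixpoint tuples_of (m : nat) (c : seq (seq nat)) : seq (seq (seq nat)) :=
  if m is m'.+1 then [seq x :: t | x <- c, t <- tuples_of m' c] else [:: [::]].

Definition dedup_perm (s : seq (seq (seq nat))) : seq (seq (seq nat)) :=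
  foldr (fun x acc => if has (perm_eq x) acc then acc else x :: acc) [::] s.

(* all multiset partitions of the multiset S: multisets (= sequences up to
   permutation) of nonempty multisets (sorted sequences) whose multiset
   union is S; one representative per multiset partition. *)
Definition mset_parts (S : seq nat) : seq (seq (seq nat)) :=
  dedup_perm
    [seq pi <- flatten [seq tuples_of m (submsets S) | m <- iota 0 (size S).+1]
       | perm_eq (flatten pi) S].

Definition mset_of (lam : seq nat) : seq nat :=
  flatten [seq nseq (nth 0%N lam i) i.+1 | i <- iota 0 (size lam)].

Definition mtilde (pi : seq (seq nat)) : seq nat :=
  sort geq [seq count_mem B pi | B <- undup pi].

(* h~_lambda, defined by the recursion h_lambda = sum_pi h~_{m~(pi)}.
   The unique multiset partition with |lambda| blocks is the one into
   singletons, whose m~ is lambda itself; all other pi have fewer blocks,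
   i.e. |m~(pi)| < |lambda|, so the recursion is well founded. *)
Fixpoint htil_aux (f : nat) (lam : seq nat) : Sym :=
  match f with
  | 0 => hprod lam
  | f'.+1 => hprod lam -
      \sum_(pi <- mset_parts (mset_of lam) | (size pi < sumn lam)%N)
         htil_aux f' (mtilde pi)
  end.
Definition htil (lam : seq nat) : Sym := htil_aux (sumn lam) lam.

(* Kostka numbers: number of semistandard Young tableaux of shape sh   *)
(* and content ct.  A filling is a function on the cells of the        *)
(* bounding box, taking value 0 outside the shape and values 1..l      *)
(* (l = number of parts of ct) inside.                                 *)
Definition cellT (sh : seq nat) := ('I_(size sh) * 'I_(head 0%N sh))%type.
Definition ssyt_set (sh ct : seq nat) :=
  [set f : {ffun 'I_(size sh) * 'I_(head 0%N sh) -> 'I_(size ct).+1} |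
    [&& [forall x : cellT sh, ((x.2 : nat) < nth 0%N sh x.1)%N == (0 < f x)%N],
        [forall x : cellT sh, forall y : cellT sh,
           ((x.1 == y.1) && ((x.2 : nat) <= y.2)%N && ((y.2 : nat) < nth 0%N sh y.1)%N)
             ==> ((f x : nat) <= f y)%N],
        [forall x : cellT sh, forall y : cellT sh,
           ((x.2 == y.2) && ((x.1 : nat) < y.1)%N && ((y.2 : nat) < nth 0%N sh y.1)%N)
             ==> ((f x : nat) < f y)%N] &
        [forall v : 'I_(size ct), #|[set x : cellT sh | (f x : nat) == v.+1]| == nth 0%N ct v]]].

Definition kostka (sh ct : seq nat) : nat := #|ssyt_set sh ct|.

Definition mxentry n (A : 'M[rat]_n) (a b : nat) : rat :=
  match @insub nat (fun i => (i < n)%N) 'I_n a, @insub nat (fun i => (i < n)%N) 'I_n b with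
  | Some i, Some j => A i j
  | _, _ => 0
  end.

(* Kostka matrix on the partitions of N, with row index the content and
   column index the shape, so that h_mu = sum_lam K_{mu,lam} s_lam, and
   its inverse; invkostka N lam mu = K^{-1}_{lam,mu}, so that
   s_lam = sum_mu K^{-1}_{lam,mu} h_mu. *)
Definition kostka_mx (N : nat) : 'M[rat]_(size (parts N)) :=
  \matrix_(i, j) (kostka (nth [::] (parts N) j) (nth [::] (parts N) i))%:R.

Definition invkostka (N : nat) (lam mu : seq nat) : rat :=
  mxentry (invmx (kostka_mx N)) (index lam (parts N)) (index mu (parts N)).

Definition pad (N : nat) (lam : seq nat) : seq nat := (N - sumn lam)%N :: lam.

(* s~_lambda, computed with N = 2|lambda| + 1 (any N >= 2|lambda| is allowed;
   the +1 avoids the degenerate padded "partition" (0) when lambda is empty) *)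
Definition stil (lam : seq nat) : Sym :=
  let N := (2 * sumn lam).+1 in
  \sum_(mu <- parts_upto (sumn lam))
     invkostka N (pad N lam) (pad N mu) *: htil mu.

Definition subshape (rho mu : seq nat) : bool :=
  (size rho <= size mu)%N && all (fun i => nth 0%N rho i <= nth 0%N mu i)%N (iota 0 (size rho)).

Definition skew_cells (mu rho : seq nat) : seq (nat * nat) :=
  [seq (i, j) | i <- iota 0 (size mu),
                j <- iota (nth 0%N rho i) (nth 0%N mu i - nth 0%N rho i)].

Definition adjc (a b : nat * nat) : bool :=
  ((a.1 == b.1) && ((a.2 == b.2.+1) || (b.2 == a.2.+1))) ||
  ((a.2 == b.2) && ((a.1 == b.1.+1) || (b.1 == a.1.+1))).

Definition cells_connected (S : seq (nat * nat)) : bool :=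
  [forall x : seq_sub S, forall y : seq_sub S,
     connect (fun a b : seq_sub S => adjc (ssval a) (ssval b)) x y].

Definition has_2x2 (S : seq (nat * nat)) : bool :=
  has (fun c => [&& (c.1.+1, c.2) \in S, (c.1, c.2.+1) \in S & (c.1.+1, c.2.+1) \in S]) S.

Definition border_strip (mu rho : seq nat) (d : nat) : bool :=
  [&& subshape rho mu, size (skew_cells mu rho) == d,
      cells_connected (skew_cells mu rho) & ~~ has_2x2 (skew_cells mu rho)].

Definition skew_ht (mu rho : seq nat) : nat :=
  (count (fun i => nth 0%N rho i < nth 0%N mu i)%N (iota 0 (size mu))).-1.

(* lam //_d alpha := (r - |lam|, lam) / (r - d - |alpha|, alpha) for r
   large; we take r = 2(|lam| + |alpha| + d) + 1, which is large enough
   (both padded sequences are partitions and the border-strip property and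
   the height no longer depend on r). *)
Definition rbig (d : nat) (lam al : seq nat) : nat := (2 * (sumn lam + sumn al + d)).+1.

Definition bstrip (d : nat) (lam al : seq nat) : bool :=
  let r := rbig d lam al in border_strip (pad r lam) (pad (r - d) al) d.

Definition bht (d : nat) (lam al : seq nat) : nat :=
  let r := rbig d lam al in skew_ht (pad r lam) (pad (r - d) al).

Definition mn_coef (B k : nat) (lam nu : seq nat) : rat :=
  \sum_(d <- divisors k)
    \sum_(al <- parts_upto B | bstrip d lam al && bstrip d nu al)
       (-1) ^+ (bht d lam al + bht d nu al).

(* Main.v *)
From HB Require Import structures.
From mathcomp Require Import all_boot all_order all_algebra fingroup perm.
From mathcomp Require Import finmap zify ring.
From mathcomp.multinomials Require Import monalg.
Require Import Defs.
Set Implicit Arguments.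
Unset Strict Implicit.
Unset Printing Implicit Defensive.
Import Order.TTheory GRing.Theory Num.Theory.
Local Open Scope ring_scope.

(** Evaluate symmetric functions at the eigenvalues of a permutation matrix of
    cycle type [rho]: [p_k] becomes the sum over [d | k] of [d m_d(rho)], where
    [m_d] is the number of [d]-cycles.  These evaluations, for [rho] of large
    size [n], separate the elements of [Sym].  Under them [h~_mu] counts the ways
    to fill boxes of sizes [mu_1, mu_2, ...] with some of the cycles, and
    [s~_lam] becomes the irreducible character of [S_n] indexed by
    [(n - |lam|, lam)], written here in Frobenius form as an alternating sum
    [chi] of coefficients of power-sum products; the identification rests on the
    Jacobi-Trudi description of the inverse Kostka matrix, obtained from the
    bialternant formula for Schur polynomials.  Finally, multiplication by
    [d m_d] is the composite of removing and of adding a [d]-cycle; on the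
    vectors [lam + delta] these operations subtract [d] from, respectively add
    [d] to, one coordinate, and sorting the result is the removal or addition of
    a border strip of size [d], with sign given by its height. *)

(** * Evaluation at cycle types *)

(** Evaluation turns multiplication by p_k into multiplication by a number, so each divisor d of k
    can be treated alone. If rho has a d-cycle, stripping it off writes the value at lam as a signed
    sum of values at smaller alpha; the factor d m_d(rho) is then exactly what is needed to put the
    cycle back, because removing and adding cycles satisfy the Heisenberg relation: they commute
    except for a term d when the two lengths agree. With finitely many coordinates this relation has
    boundary terms, and these are under control only when the number M of coordinates is at least
    |rho|; the final argument takes M = n+1 with n = |rho|. No representation theory enters: the
    character is just the coefficient formula [chi], and s~ is matched with it by calculation. The
    definition of s~ uses N = 2|lam|+1 whereas the evaluation needs n = |rho|; this does no harm
    because h~_mu counts only the cycles outside the first row, and only that row depends on N. *)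

Section MonomialEvaluation.
Variables (S : comRingType) (x : nat -> S).

Definition mon_eval (m : cmonom nat) : S := \prod_(i <- finsupp m) x i ^+ m i.

Lemma mon_evalEw (d : {fset nat}) (m : cmonom nat) :
  (finsupp m `<=` d)%fset -> mon_eval m = \prod_(i <- d) x i ^+ m i.
Proof.
move=> le; rewrite /mon_eval (big_fset_incl _ le) //= => i _ /fsfun_dflt ->.
by rewrite expr0.
Qed.

Lemma mon_evalM : {morph mon_eval : m1 m2 / (mmul m1 m2) >-> m1 * m2}.
Proof.
move=> m1 m2.
rewrite (@mon_evalEw (finsupp m1 `|` finsupp m2)%fset); last by rewrite mdomD.
rewrite (mon_evalEw (fsubsetUl _ (finsupp m2))).
rewrite (mon_evalEw (fsubsetUr (finsupp m1) _)).
by rewrite -big_split /=; apply: eq_bigr => i _; rewrite cmM exprD.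
Qed.

Lemma mon_eval_mmorphism : mmorphism mon_eval.
Proof.
split; first exact: mon_evalM.
by rewrite /mon_eval mdom1 big_seq_fset0.
Qed.

HB.instance Definition _ := isMultiplicative.Build _ _ mon_eval mon_eval_mmorphism.

Lemma mon_evalU i : mon_eval (ucm i) = x i.
Proof. by rewrite /mon_eval mdomU big_seq_fset1 cmUU expr1. Qed.

End MonomialEvaluation.

Definition psum_at (rho : seq nat) (k : nat) : nat := \sum_(r <- rho | (r %| k)%N) r.

Definition ev (rho : seq nat) : Sym -> rat :=
  mmap idfun (mon_eval (fun i => (psum_at rho i.+1)%:R)).

HB.instance Definition _ rho := GRing.RMorphism.on (ev rho).

Lemma evZ rho c f : ev rho (c *: f) = c * ev rho f.
Proof. exact: mmapZ. Qed.

Lemma ev_psum rho k : (0 < k)%N -> ev rho (psum k) = (psum_at rho k)%:R.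
Proof.
by move=> k0; rewrite /ev /psum mmapU /= mul1r mon_evalU prednK.
Qed.

(** Uniqueness of base-[B] digits separates monomials twice: here through [gwt], and later in the
    Kronecker substitution for Schur polynomials. *)
Lemma big_digits_inj (B K : nat) (f g : nat -> nat) :
  (forall i, f i < B)%N -> (forall i, g i < B)%N ->
  (\sum_(i < K) f i * B ^ i = \sum_(i < K) g i * B ^ i)%N ->
  forall i, (i < K)%N -> f i = g i.
Proof.
elim: K f g => // K IH f g ltf ltg.
have B0 : (0 < B)%N by apply: leq_ltn_trans (ltf 0%N).
have E (h : nat -> nat) : (\sum_(i < K.+1) h i * B ^ i = (\sum_(i < K) h i.+1 * B ^ i) * B + h 0)%N.
  rewrite big_ord_recl /= expn0 muln1 addnC big_distrl /=; congr (_ + _)%N.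
  by apply: eq_bigr => i _; rewrite /bump leq0n add1n expnS mulnCA mulnC.
rewrite !E => e.
have e0 : f 0%N = g 0%N.
  by move: (congr1 (modn^~ B) e); rewrite !modnMDl !modn_small.
move: e; rewrite e0 => /eqP; rewrite eqn_add2r eqn_pmul2r // => /eqP e.
case=> // i; rewrite ltnS.
exact: (IH (fun i => f i.+1) (fun i => g i.+1) (fun i => ltf i.+1)
           (fun i => ltg i.+1) e).
Qed.

(** * Separation of the elements of [Sym] by cycle types *)

Section EvaluationSeparates.
Variable B : nat.
Hypothesis B_gt1 : (1 < B)%N.

(* Value of p_(k+1) at the cycle type having t^(B^(d-1)) cycles of each length d,
   as a polynomial in t: the degrees of distinct monomials in the p_k then differ,
   being determined by their exponents as base-B digits. *)
Definition gpoly (k : nat) : {poly rat} :=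
  \sum_(d <- divisors k.+1) d%:R *: 'X^(B ^ d.-1).

(** The divisor d = k+1 carries the exponent B^k; all other divisors are smaller and give strictly
    lower powers. *)
Lemma size_gpoly k : size (gpoly k) = (B ^ k).+1.
Proof.
have Pk : k.+1 \in divisors k.+1 by rewrite -dvdn_divisors.
rewrite /gpoly (big_rem _ Pk) /= size_polyDl.
  by rewrite size_scale ?size_polyXn // pnatr_eq0.
rewrite size_scale ?size_polyXn ?pnatr_eq0 // ltnS.
rewrite big_seq; apply: (big_ind (fun p : {poly rat} => size p <= B ^ k)%N) => [|a b ha hb|d].
- by rewrite size_poly0.
- by apply: leq_trans (size_polyD _ _) _; rewrite geq_max ha.
rewrite mem_rem_uniq ?divisors_uniq // !inE -dvdn_divisors // => /andP[dk dv].
apply: (leq_trans (size_scale_leq _ _)); rewrite size_polyXn.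
rewrite ltn_exp2l //; have := dvdn_leq (ltn0Sn k) dv.
by move: dk => /eqP; case: d dv => [|d] dv /=; [rewrite dvd0n in dv | lia].
Qed.

Definition gwt (m : cmonom nat) : nat := (\sum_(i <- finsupp m) m i * B ^ i)%N.

Lemma size_mon_eval m : size (mon_eval gpoly m) = (gwt m).+1.
Proof.
have g0 i : gpoly i != 0 by rewrite -size_poly_eq0 size_gpoly.
rewrite /mon_eval /gwt.
elim: (enum_fset _) => [|i s IH]; first by rewrite !big_nil size_poly1.
rewrite !big_cons size_mul ?expf_neq0 //; last first.
  by rewrite -size_poly_eq0 IH.
rewrite IH addnS /=.
have : (0 < size (gpoly i ^+ m i))%N by rewrite lt0n size_poly_eq0 expf_neq0.
by move/prednK => <-; rewrite size_exp size_gpoly /= addSn mulnC.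
Qed.

(** The weights [gwt] are the degrees of the images of the monomials. When they are distinct,
    nothing can cancel the top coefficient coming from the monomial of largest weight. *)
Lemma mmap_gpoly_neq0 (f : Sym) :
  {in msupp f &, injective gwt} -> f != 0 -> mmap polyC (mon_eval gpoly) f != 0.
Proof.
move=> inj; rewrite -msupp_eq0 => /fset0Pn[m0 m0f].
have [m mf mmax] : exists2 m, m \in msupp f &
    forall m', m' \in msupp f -> (gwt m' <= gwt m)%N.
  have [i _ h] := @arg_maxnP _ [` m0f]%fset predT (fun m => gwt (val m)) isT.
  exists (val i); first exact: valP.
  by move=> m' m'f; apply: (h [` m'f]%fset).
have lc : (mon_eval gpoly m)`_(gwt m) != 0.
  have := lead_coef_eq0 (mon_eval gpoly m); rewrite /lead_coef size_mon_eval /=.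
  by move=> ->; rewrite -size_poly_eq0 size_mon_eval.
apply: contraTneq (mf) => /(congr1 (fun p : {poly rat} => p`_(gwt m))).
rewrite mmapE coef_sum coef0 (big_fsetD1 m) //= big1_fset => [|m' m'f _].
  rewrite addr0 coefCM => /eqP; rewrite mulf_eq0 (negPf lc) orbF.
  by rewrite mcoeff_eq0.
move: m'f; rewrite in_fsetD1 => /andP[m'm m'f].
rewrite coefCM nth_default ?mulr0 // size_mon_eval ltn_neqAle mmax // andbT.
by apply: contraNneq m'm => /inj -> //.
Qed.

(** The cycle type whose power sums are the polynomials [gpoly] at t. Lengths above [K] are dropped,
    which affects no p_k with k at most [K]. *)
Definition gseq (K t : nat) : seq nat :=
  flatten [seq nseq (t ^ (B ^ d.-1)) d | d <- iota 1 K].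

Lemma psum_at_gseq K t k : (k < K)%N ->
  (psum_at (gseq K t) k.+1)%:R = (gpoly k).[t%:R] :> rat.
Proof.
move=> kK; rewrite /psum_at /gseq big_mkcond big_flatten /= big_map.
rewrite /gpoly horner_sum /= [RHS](perm_big [seq d <- iota 1 K | (d %| k.+1)%N]) /=; last first.
  apply: uniq_perm; rewrite ?divisors_uniq ?filter_uniq ?iota_uniq // => d.
  rewrite mem_filter mem_iota -dvdn_divisors //; case dv: (d %| _)%N => //=.
  have := dvdn_leq (ltn0Sn k) dv; have := dvdn_gt0 (ltn0Sn k) dv; lia.
rewrite big_filter natr_sum [RHS]big_mkcond /=; apply: eq_bigr => d _.
rewrite hornerZ hornerXn big_nseq; case: ifP => _; last first.
  by elim: (t ^ _)%N => //= n ->.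
by rewrite iter_addn_0 natrM natrX.
Qed.

Lemma gseq_gt0 K t : all (ltn 0) (gseq K t).
Proof.
apply/allP => r /flatten_mapP[d]; rewrite mem_iota => /andP[d0 _].
by rewrite mem_nseq => /andP[_ /eqP->].
Qed.

Lemma sumn_gseq K t : (0 < K)%N -> (t <= sumn (gseq K t))%N.
Proof.
case: K => // K _; rewrite /gseq /= sumn_cat sumn_nseq mul1n.
by rewrite expn0 expn1; apply: leq_addr.
Qed.

End EvaluationSeparates.

Lemma poly_nat_roots (p : {poly rat}) (n0 : nat) :
  (forall t : nat, (n0 <= t)%N -> p.[t%:R] = 0) -> p = 0.
Proof.
move=> h; apply/eqP/negPn/negP => p0.
suff: false by []; move: (ltnn (size p)) => <-.
rewrite -[X in (X < _)%N](size_iota n0) -(size_map (fun t : nat => t%:R : rat)).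
apply: max_poly_roots => //.
  by apply/allP => _ /mapP[t + ->]; rewrite mem_iota => /andP[nt _]; apply/rootP/h.
by rewrite map_inj_uniq ?iota_uniq // => a b /eqP; rewrite eqr_nat => /eqP.
Qed.

Lemma leq_bigmax_fset (I : choiceType) (A : {fset I}) (F : I -> nat) i :
  i \in A -> (F i <= \max_(j <- A) F j)%N.
Proof. by move=> iA; rewrite (big_fsetD1 i) //= leq_maxl. Qed.

(** A nonzero f would give a nonzero polynomial in t whose values at all large integers t are
    evaluations of f at [gseq B K t], hence zero. *)
Lemma ev_separates (f : Sym) (n0 : nat) :
  (forall rho, all (ltn 0) rho -> (n0 <= sumn rho)%N -> ev rho f = 0) -> f = 0.
Proof.
move=> h; apply/eqP/negPn/negP => f0.
(* [K] exceeds every variable index in f, and [B] every exponent, so that exponents are base-[B]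
   digits; the [.+2] also ensures B > 1. *)
pose K := (\max_(m <- msupp f) \max_(i <- finsupp m) i.+1).+1.
pose B := (\max_(m <- msupp f) \max_(i <- finsupp m) m i).+2.
have ltK m i : m \in msupp f -> i \in finsupp m -> (i < K)%N.
  move=> mf im; rewrite /K ltnS.
  apply: leq_trans (leq_bigmax_fset (fun m : cmonom nat => \max_(i <- finsupp m) i.+1)%N mf).
  exact: ltnW (leq_bigmax_fset succn im).
have ltB m i : m \in msupp f -> (m i < B)%N.
  move=> mf; case: (boolP (i \in finsupp m)) => im; last by rewrite fsfun_dflt.
  rewrite /B ltnS; apply: leqW.
  apply: leq_trans (leq_bigmax_fset (fun m : cmonom nat => \max_(i <- finsupp m) m i)%N mf).
  exact: (leq_bigmax_fset (fun i => m i) im).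
have B1 : (1 < B)%N by [].
have inj : {in msupp f &, injective (gwt B)}.
  have E m : m \in msupp f -> gwt B m = (\sum_(i < K) m i * B ^ i)%N.
    move=> mf; rewrite -(big_mkord predT (fun i => m i * B ^ i)%N) /gwt.
    rewrite [RHS](bigID (mem (finsupp m))) /= [X in _ = (_ + X)%N]big1 ?addn0; last first.
      by move=> i /fsfun_dflt ->.
    rewrite -[RHS]big_filter; apply: perm_big; apply: uniq_perm.
    - exact: fset_uniq.
    - by rewrite filter_uniq ?iota_uniq.
    move=> i; rewrite mem_filter mem_index_iota /=.
    by case im: (i \in finsupp m) => //=; rewrite (ltK m).
  move=> m1 m2 m1f m2f; rewrite !E // => e.
  apply/eqP/cmP => i; case: (ltnP i K) => iK.
    exact: (big_digits_inj (fun i => ltB _ i m1f) (fun i => ltB _ i m2f) e).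
  by rewrite !fsfun_dflt //; apply/negP => /(ltK _ _ _); rewrite ltnNge iK => /(_ _)/negP h'; apply: h'.
have := mmap_gpoly_neq0 B1 inj f0; case/negP; apply/eqP.
apply: (@poly_nat_roots _ n0) => t n0t.
rewrite -[RHS](h (gseq B K t)) ?gseq_gt0 //; last exact: leq_trans n0t (sumn_gseq _ _ _).
rewrite /ev !mmapE horner_sum !big_seq; apply: eq_bigr => m mf.
rewrite hornerM hornerC; congr (_ * _).
rewrite -horner_evalE rmorph_prod /mon_eval !big_seq; apply: eq_bigr => i im.
by rewrite rmorphXn /= horner_evalE psum_at_gseq // (ltK m).
Qed.

(** * Partitions and complete symmetric functions *)

Lemma is_part_cons i p :
  is_part (i :: p) = [&& (0 < i)%N, (head 0%N p <= i)%N & is_part p].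
Proof.
rewrite /is_part /=; case: p => [|j p] /=; first by rewrite !andbT.
by case: (0 < i)%N; rewrite /= ?andbF //= -!andbA.
Qed.

Lemma sumn_head (l : seq nat) : (head 0%N l <= sumn l)%N.
Proof. by case: l => //= a l; rewrite leq_addr. Qed.

Lemma mem_parts_bnd f n m l : (n <= f)%N ->
  (l \in parts_bnd f n m) = [&& is_part l, sumn l == n & (head 0%N l <= m)%N].
Proof.
elim: f n m l => [|f IH] n m l.
  rewrite leqn0 => /eqP ->; rewrite /= inE.
  by case: l => [|[|a] l] //=; rewrite is_part_cons //= andbF.
move=> nf /=; case: eqVneq => [->|n0].
  by rewrite inE; case: l => [|[|a] l] //=; rewrite is_part_cons //= andbF.
case: l => [|a l].
  rewrite /= eq_sym (negPf n0); apply/negP => /flatten_mapP[i _ /mapP[]] //.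
rewrite is_part_cons /=.
apply/flatten_mapP/idP => [[i]|].
  rewrite mem_iota => /andP[i0 im] /mapP[p + [-> ->]].
  rewrite IH; last by lia.
  by move=> /and3P[-> /eqP-> ->] /=; rewrite i0 /=; lia.
move=> /andP[/and3P[a0 ha pl] /andP[/eqP sl am]].
exists a; first by rewrite mem_iota; lia.
by apply/mapP; exists l => //; rewrite IH ?pl ?ha; lia.
Qed.

Lemma uniq_parts_bnd f n m : uniq (parts_bnd f n m).
Proof.
elim: f n m => [|f IH] n m /=; case: eqP => // _.
elim: (iota 1 (minn n m)) (iota_uniq 1 (minn n m)) => //= i s IHs /andP[i_s us].
rewrite cat_uniq IHs // andbT map_inj_uniq ?IH /=; last by move=> ? ? [].
apply/hasPn => l /flatten_mapP[j js /mapP[p _ ->]].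
by apply/mapP => -[q _ [ij _]]; rewrite -ij js in i_s.
Qed.

Lemma mem_parts n l : (l \in parts n) = is_part l && (sumn l == n).
Proof.
rewrite /parts mem_parts_bnd //; case: (is_part l) => //=.
by case: eqP => //= <-; exact: sumn_head.
Qed.

Lemma uniq_parts n : uniq (parts n).
Proof. exact: uniq_parts_bnd. Qed.

Lemma mem_parts_upto n l : (l \in parts_upto n) = is_part l && (sumn l <= n)%N.
Proof.
apply/flatten_mapP/andP => [[m]|[pl ln]].
  by rewrite mem_iota mem_parts => /andP[_ mn] /andP[-> /eqP->].
by exists (sumn l); rewrite ?mem_parts ?pl ?eqxx // mem_iota.
Qed.

Lemma uniq_parts_upto n : uniq (parts_upto n).
Proof.
rewrite /parts_upto; elim: (iota 0 n.+1) (iota_uniq 0 n.+1) => //= i s IHs /andP[i_s us].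
rewrite cat_uniq uniq_parts IHs // andbT /=.
apply/hasPn => l /flatten_mapP[j js]; rewrite !mem_parts => /andP[_ /eqP lj].
by apply/negP => /andP[_ /eqP li]; rewrite -li lj js in i_s.
Qed.

Lemma geq_trans : transitive geq. Proof. by move=> a b c /= h1 h2; apply: leq_trans h2 h1. Qed.
Lemma geq_total : total geq. Proof. by move=> a b /=; rewrite leq_total. Qed.
Lemma geq_anti : antisymmetric geq.
Proof. by move=> a b /andP[] /= h1 h2; apply/eqP; rewrite eqn_leq h1 h2. Qed.

(** A common larger index set lets the z-values of two partitions be compared factor by factor. *)
Lemma zee_wide (mu s : seq nat) : uniq s -> {subset mu <= s} ->
  zee mu = (\prod_(i <- s) (i ^ mult mu i * (mult mu i)`!))%N.
Proof.
move=> us sub; rewrite [RHS](bigID (mem mu)) /= [X in _ = (_ * X)%N]big1 ?muln1; last first.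
  by move=> i /count_memPn; rewrite /mult => ->.
rewrite -[RHS]big_filter; apply: perm_big; apply: uniq_perm; rewrite ?undup_uniq ?filter_uniq //.
by move=> i; rewrite mem_undup mem_filter; case im: (i \in mu) => //=; rewrite sub.
Qed.

Lemma zee_perm mu nu : perm_eq mu nu -> zee mu = zee nu.
Proof.
move=> p; rewrite (@zee_wide mu (undup nu)) ?undup_uniq //; last first.
  by move=> i; rewrite mem_undup (perm_mem p).
by apply: eq_bigr => i _; rewrite /mult (seq.permP p).
Qed.

Lemma zee_cons k mu : zee (k :: mu) = (zee mu * (k * (mult mu k).+1))%N.
Proof.
have u := undup_uniq (k :: mu).
have kin : k \in undup (k :: mu) by rewrite mem_undup mem_head.
rewrite (@zee_wide (k :: mu) (undup (k :: mu))) //; last by move=> i; rewrite mem_undup.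
rewrite (@zee_wide mu (undup (k :: mu))) //; last first.
  by move=> i im; rewrite mem_undup inE im orbT.
have Ek : mult (k :: mu) k = (mult mu k).+1 by rewrite /mult /= eqxx.
rewrite !(bigD1_seq k) // Ek factS expnS.
rewrite (eq_bigr (fun i => (i ^ mult mu i * (mult mu i)`!)%N)) => [|i ik].
  move: (\prod_(i <- _ | _) _)%N (_ ^ _)%N => P X /=; ring.
by rewrite /mult /= eq_sym (negPf ik).
Qed.

(** Adjoining a part k is the bijection, from partitions of n-k to partitions of n having a part k,
    behind Newton's identity. *)
Definition insp (k : nat) (l : seq nat) : seq nat := sort geq (k :: l).

Lemma is_part_insp k l : (0 < k)%N -> is_part l -> is_part (insp k l).
Proof.
move=> k0 /andP[_ pl]; rewrite /is_part (sort_sorted geq_total) all_sort /=.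
by rewrite k0.
Qed.

Lemma sumn_perm s t : perm_eq s t -> sumn s = sumn t.
Proof. by move=> p; rewrite !sumnE (perm_big _ p). Qed.

Lemma sum_mult_undup (mu : seq nat) :
  (\sum_(k <- undup mu) k * mult mu k = sumn mu)%N.
Proof.
rewrite sumnE -[RHS]big_undup_iterop_count; apply: eq_bigr => i _.
by rewrite /mult Monoid.iteropE iter_addn_0.
Qed.

Section Newton.
Variable x : nat -> rat.

Definition hval (n : nat) : rat :=
  \sum_(mu <- parts n) (zee mu)%:R^-1 * \prod_(i <- mu) x i.

(** Distribute the factor n as the sum of k m_k(mu) inside the term of mu. Removing one part k
    divides z_mu by k m_k(mu), which cancels this weight. *)
Lemma hval_newton n :
  n%:R * hval n = \sum_(k <- iota 1 n) x k * hval (n - k).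
Proof.
pose G k mu := (k * mult mu k)%:R * ((zee mu)%:R^-1 * \prod_(i <- mu) x i).
transitivity (\sum_(k <- iota 1 n) \sum_(mu <- parts n | k \in mu) G k mu).
  rewrite (exchange_big_dep predT) //= /hval mulr_sumr big_seq [RHS]big_seq.
  apply: eq_bigr => mu; rewrite mem_parts => /andP[pmu /eqP smu].
  rewrite /G -mulr_suml -natr_sum; congr (_%:R * _).
  rewrite -{1}smu -sum_mult_undup -[RHS]big_filter; apply: perm_big.
  apply: uniq_perm; rewrite ?undup_uniq ?filter_uniq ?iota_uniq // => i.
  rewrite mem_undup mem_filter mem_iota; case imu: (i \in mu) => //=.
  have i0 : (0 < i)%N by case/andP: pmu => _ /allP/(_ _ imu).
  have : (i <= sumn mu)%N.
    by rewrite sumnE (big_rem i) //= leq_addr.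
  by rewrite smu; lia.
rewrite big_seq [RHS]big_seq; apply: eq_bigr => k.
rewrite mem_iota => /andP[k0 kn]; rewrite add1n ltnS in kn.
rewrite /hval mulr_sumr -[LHS]big_filter.
have PP : perm_eq [seq mu <- parts n | k \in mu] [seq insp k l | l <- parts (n - k)].
  apply: uniq_perm; first by rewrite filter_uniq ?uniq_parts.
    rewrite map_inj_in_uniq ?uniq_parts // => l1 l2.
    rewrite !mem_parts => /andP[/andP[s1 _] _] /andP[/andP[s2 _] _] e.
    apply: (sorted_eq geq_trans geq_anti) => //.
    have := perm_sort geq (k :: l1) => p1; have := perm_sort geq (k :: l2) => p2.
    rewrite -(perm_cons k) -(perm_sort geq) perm_sym -(perm_sort geq).
    by rewrite perm_sym -/(insp k l1) e /insp.
  move=> mu; rewrite mem_filter mem_parts; apply/idP/mapP => [/and3P[km pm /eqP sm]|[l]].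
    have p1 := perm_to_rem km.
    exists (rem k mu); last first.
      apply: (sorted_eq geq_trans geq_anti).
      - by case/andP: pm.
      - exact: (sort_sorted geq_total).
      - by rewrite perm_sym perm_sort perm_sym.
    rewrite mem_parts; apply/andP; split; last by rewrite -sm (sumn_perm p1) /= addKn.
    case/andP: pm => s a; apply/andP; split; first exact: (subseq_sorted geq_trans (rem_subseq _ _) s).
    by apply/allP => i /mem_rem; apply/allP.
  rewrite mem_parts => /andP[pl /eqP sl] ->.
  rewrite mem_sort mem_head is_part_insp //=.
  by rewrite (sumn_perm (permEl (perm_sort _ _))) /= sl subnKC.
rewrite (perm_big _ PP) big_map big_seq [RHS]big_seq; apply: eq_bigr => l.
rewrite mem_parts => /andP[/andP[_ al] _].
have pi : perm_eq (insp k l) (k :: l) by rewrite /insp perm_sort.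
rewrite /G (zee_perm pi) (perm_big _ pi) big_cons /= /mult (seq.permP pi) /= eqxx add1n.
rewrite -/(mult l k).
have z0 : (k * (mult l k).+1)%:R != 0 :> rat by rewrite pnatr_eq0 muln_eq0 negb_or -lt0n k0.
rewrite zee_cons [(zee l * _)%:R]natrM; move: z0; set c := (_ * _)%:R => z0.
by rewrite invfM [_^-1 * c^-1]mulrC !mulrA mulfV // mul1r [_^-1 * x k]mulrC.
Qed.

End Newton.

(** Coefficient of t^n in the product of 1/(1-t^r) over r in [rho], that is, h_n at the eigenvalues
    of a permutation matrix of cycle type [rho]. *)
Fixpoint ncomb (rho : seq nat) (n : nat) : nat :=
  if rho is r :: rho' then \sum_(c < n.+1 | (c * r <= n)%N) ncomb rho' (n - c * r)
  else (n == 0)%N.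

Lemma ncomb0 rho : ncomb rho 0 = 1%N.
Proof.
elim: rho => //= r rho IH.
by rewrite big_mkcond big_ord_recl big_ord0 /= mul0n subn0 IH.
Qed.

Lemma ncomb_cons r rho n : (0 < r)%N ->
  ncomb (r :: rho) n =
  (ncomb rho n + if (r <= n)%N then ncomb (r :: rho) (n - r) else 0)%N.
Proof.
move=> r0 /=; rewrite big_mkcond big_ord_recl /= mul0n subn0; congr (_ + _)%N.
case: leqP => rn; last first.
  by rewrite big1 // => i _; rewrite /bump /= leqNgt mulnC; case: ifP => //; nia.
have nr : (n - r <= n)%N by rewrite leq_subr.
rewrite [RHS]big_mkcond /=.
rewrite (big_ord_widen n (fun i => if (i * r <= n - r)%N then ncomb rho (n - r - i * r) else 0%N)); last by lia.
rewrite [RHS]big_mkcond; apply: eq_bigr => i _; rewrite /bump /= add1n mulSn.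
have -> : (r + i * r <= n)%N = (i * r <= n - r)%N by lia.
rewrite subnDA; case: ifP => h; last by rewrite if_same.
by rewrite ifT //; nia.
Qed.

Lemma psum_at_cons r rho k :
  psum_at (r :: rho) k = ((if (r %| k)%N then r else 0) + psum_at rho k)%N.
Proof. by rewrite /psum_at big_cons; case: ifP. Qed.

(** This is the logarithmic derivative of the product of the 1/(1-t^r), compared coefficientwise;
    the induction peels off one factor. *)
Lemma ncomb_newton rho n : all (ltn 0) rho ->
  (n * ncomb rho n = \sum_(k < n) psum_at rho k.+1 * ncomb rho (n - k.+1))%N.
Proof.
elim: rho n => [|r rho IH] n.
  by move=> _; rewrite big1 => [|i _]; [case: n => //= n; rewrite muln0 | rewrite /psum_at big_nil].
case/andP=> r0; rewrite -/(all _ _) => a; have {}r0 : (0 < r)%N by []; have {}IH n' := IH n' a.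
elim/ltn_ind: n => n IHn.
set G := ncomb (r :: rho); set F := ncomb rho.
have rec m : G m = (F m + if (r <= m)%N then G (m - r) else 0)%N by exact: ncomb_cons.
case: (ltnP n r) => rn.
  rewrite [LHS](_ : _ = n * F n)%N; last by rewrite rec leqNgt rn addn0.
  rewrite IH; apply: eq_bigr => i _; rewrite psum_at_cons gtnNdvd //; last by have := ltn_ord i; lia.
  by rewrite rec leqNgt (_ : (_ < r)%N) ?addn0 //; lia.
have [n' En] : exists n', n = (r + n')%N by exists (n - r)%N; lia.
have Gn : G n = (F n + G n')%N by rewrite rec rn En addKn.
have IH' : (n' * G n' = \sum_(k < n') psum_at (r :: rho) k.+1 * G (n' - k.+1))%N.
  by apply: IHn; lia.
have E2 : (n * G n' = r * G n' + n' * G n')%N by rewrite En mulnDl.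
rewrite Gn mulnDr IH E2 IH'.
under [RHS]eq_bigr => k _ do rewrite psum_at_cons mulnDl.
rewrite big_split /=.
under [X in (_ + (_ + X))%N = _]eq_bigr => k _ do rewrite psum_at_cons mulnDl.
rewrite big_split /=.
have -> : (\sum_(k < n) psum_at rho k.+1 * G (n - k.+1) =
  \sum_(k < n) psum_at rho k.+1 * F (n - k.+1) +
  \sum_(k < n') psum_at rho k.+1 * G (n' - k.+1))%N.
  rewrite (big_ord_widen n (fun k => psum_at rho k.+1 * G (n' - k.+1))%N); last by lia.
  rewrite [X in (_ + X)%N]big_mkcond -big_split; apply: eq_bigr => k _ /=.
  rewrite rec mulnDr; congr (_ + _)%N; have kn := ltn_ord k.
  case: ifP => h; case: ifP => h'; rewrite ?muln0 //; try lia.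
  by congr (_ * G _)%N; lia.
(* Among 1, ..., r only r itself is a multiple of r and yields r * G n'; the later indices are
   shifted down by r. *)
have -> : (\sum_(k < n) (if (r %| k.+1)%N then r else 0) * G (n - k.+1) =
  r * G n' + \sum_(k < n') (if (r %| k.+1)%N then r else 0) * G (n' - k.+1))%N.
  rewrite En big_split_ord /=; congr (_ + _)%N.
    rewrite (bigD1 (Ordinal (ltac:(lia) : (r.-1 < r)%N))) //= big1 ?addn0.
      by rewrite prednK // dvdnn addKn.
    move=> i /eqP ir; rewrite gtnNdvd //.
    have := ltn_ord i; suff : (i : nat) <> r.-1 by lia.
    by move=> e; apply: ir; apply: val_inj.
  apply: eq_bigr => i _; rewrite -addnS dvdn_addr // subnDl //.
by move: (r * _)%N (\sum_(i < n') _)%N (\sum_(i < n') _)%N (\sum_(i < n) _)%N => b1 b2 b3 b4 /=; lia.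
Qed.

Lemma ev_pprod rho mu : all (ltn 0) mu ->
  ev rho (pprod mu) = \prod_(i <- mu) (psum_at rho i)%:R.
Proof.
move=> a; rewrite rmorph_prod /= !big_seq; apply: eq_bigr => i im.
by rewrite ev_psum //; apply: (allP a).
Qed.

(** Both sides are 1 at n = 0 and obey the same Newton recurrence, which determines them because n
    is invertible in the rationals. *)
Lemma ev_hcomp rho n : all (ltn 0) rho -> ev rho (hcomp n) = (ncomb rho n)%:R.
Proof.
move=> a.
have -> : ev rho (hcomp n) = hval (fun k => (psum_at rho k)%:R) n.
  rewrite /hcomp rmorph_sum /= /hval !big_seq; apply: eq_bigr => mu.
  by rewrite mem_parts => /andP[/andP[_ p] _]; rewrite evZ ev_pprod.
elim/ltn_ind: n => n IH; case: n IH => [|n] IH.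
  by rewrite /hval /= big_seq1 big_nil ncomb0 /zee big_nil invr1 mulr1.
have n0 : n.+1%:R != 0 :> rat by rewrite pnatr_eq0.
apply: (mulfI n0); rewrite hval_newton -natrM ncomb_newton // natr_sum.
rewrite -[iota 1 n.+1]/(index_iota 1 n.+2) big_add1 big_mkord /=; apply: eq_bigr => k _.
by rewrite IH ?natrM //; lia.
Qed.

(** * Multiset partitions *)

Section Placements.
Variable T : eqType.
Implicit Types (keys : seq T) (g h : T -> nat) (rho : seq nat).

(* Number of ways to send each part of rho either nowhere or to a key, so
   that the parts sent to each key B add up to g B. *)
Fixpoint nplace keys rho g : nat :=
  if rho is r :: rho' then
    nplace keys rho' g +
    \sum_(B <- keys | (r <= g B)%N) nplace keys rho' (fun x => g x - (x == B) * r)%N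
  else all (fun B => g B == 0)%N keys.

Lemma eq_nplace keys rho g h : {in keys, g =1 h} -> nplace keys rho g = nplace keys rho h.
Proof.
elim: rho g h => [|r rho IH] g h e /=.
  by congr (nat_of_bool _); apply: eq_in_all => B /e ->.
congr (_ + _)%N; first exact: IH.
rewrite big_seq_cond [RHS]big_seq_cond; apply: eq_big => [B|B /andP[Bk _]].
  by case Bk: (B \in keys) => //=; rewrite e.
by apply: IH => x xk; rewrite e.
Qed.

Lemma nplace_perm keys keys' rho g :
  perm_eq keys keys' -> nplace keys rho g = nplace keys' rho g.
Proof.
move=> p; elim: rho g => [|r rho IH] g /=.
  by rewrite (perm_all _ p).
by rewrite IH (perm_big _ p); congr (_ + _)%N; apply: eq_bigr => B _; rewrite IH.
Qed.

(** Parts are positive, so a box of capacity 0 never receives one and may be discarded. *)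
Lemma nplace_filter (P : pred T) keys rho g : all (ltn 0) rho ->
  {in keys, forall B, ~~ P B -> g B = 0%N} ->
  nplace [seq B <- keys | P B] rho g = nplace keys rho g.
Proof.
elim: rho g => [|r rho IH] g /=.
  move=> _ h; congr (nat_of_bool _); rewrite all_filter; apply: eq_in_all => B Bk /=.
  by case PB: (P B) => //=; rewrite h ?PB.
move=> /andP[r0 a] h; rewrite IH //; congr (_ + _)%N.
rewrite big_filter_cond big_seq_cond [RHS]big_seq_cond; apply: eq_big => [B|B /and3P[Bk PB _]].
  case Bk: (B \in keys) => //=; case PB: (P B) => //=.
  by rewrite h ?PB //; case: (r) r0.
by apply: IH => // x xk nx; rewrite h.
Qed.

Lemma nplace0 keys rho g : all (ltn 0) rho -> {in keys, forall B, g B = 0%N} ->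
  nplace keys rho g = 1%N.
Proof.
move=> a h; rewrite -(@nplace_filter pred0) // => [|B Bk _]; last exact: h.
rewrite filter_pred0; elim: rho {a} g {h} => //= r rho IH g.
by rewrite IH big_nil.
Qed.

End Placements.

Lemma nplace_map (T U : eqType) (f : U -> T) keys rho g :
  {in keys &, injective f} -> nplace (map f keys) rho g = nplace keys rho (g \o f).
Proof.
move=> inj; elim: rho g => [|r rho IH] g /=.
  by rewrite all_map.
rewrite IH; congr (_ + _)%N; rewrite big_map big_seq_cond [RHS]big_seq_cond.
apply: eq_bigr => B /andP[Bk _]; rewrite IH; apply: eq_nplace => x xk /=.
by rewrite (inj_in_eq inj).
Qed.

(** For n = |rho| at least |mu|, this is the permutation character of S_n on the cosets of the Young
    subgroup of (n-|mu|, mu), at cycle type [rho]; the unplaced cycles fill the first box. *)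
Definition npart (mu rho : seq nat) : nat :=
  nplace (iota 0 (size mu)) rho (nth 0%N mu).

Lemma npart_map (T : eqType) (keys : seq T) (h : T -> nat) rho : uniq keys ->
  npart (map h keys) rho = nplace keys rho h.
Proof.
case: keys => [|x0 s]; first by move=> _; elim: rho => //= r rho; rewrite /npart /= !big_nil => ->.
set keys := x0 :: s => u; rewrite /npart size_map.
have e : keys = map (nth x0 keys) (iota 0 (size keys)).
  by rewrite -[LHS](mkseq_nth x0).
rewrite [in RHS]e nplace_map; last first.
  move=> i j; rewrite !mem_iota /= !add0n => ik jk /eqP.
  by rewrite nth_uniq // => /eqP.
by apply: eq_nplace => i; rewrite mem_iota add0n => ik; rewrite [LHS](nth_map x0).
Qed.

Lemma npart_perm mu mu' rho : perm_eq mu mu' -> npart mu rho = npart mu' rho.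
Proof.
move=> /(perm_iotaP 0%N)[Is p ->].
rewrite npart_map; last by rewrite (perm_uniq p) iota_uniq.
exact: nplace_perm.
Qed.

Section CountPlacements.
Variable T : eqType.
Implicit Types p q : seq T.

(** The boxes are the distinct entries of [p] with their multiplicities as capacities; for a
    multiset partition this is [npart] of its [mtilde], without any sorting of multiplicities. *)
Definition nmult p rho : nat := nplace (undup p) rho (fun x => count_mem x p).

Lemma nmult_wide keys p rho : all (ltn 0) rho -> uniq keys -> {subset p <= keys} ->
  nplace keys rho (fun x => count_mem x p) = nmult p rho.
Proof.
move=> a u sub; rewrite -(@nplace_filter _ (mem p)) //; last first.
  by move=> B _ /count_memPn.
apply: nplace_perm; apply: uniq_perm; rewrite ?undup_uniq ?filter_uniq // => x.
by rewrite mem_undup mem_filter /=; case xp: (x \in p) => //=; rewrite sub.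
Qed.

Lemma nmult_perm p q rho : perm_eq p q -> nmult p rho = nmult q rho.
Proof.
move=> pq; rewrite /nmult (@nplace_perm _ _ (undup q)); last first.
  by apply: uniq_perm; rewrite ?undup_uniq // => x; rewrite !mem_undup (perm_mem pq).
by apply: eq_nplace => x _; rewrite (seq.permP pq).
Qed.

Lemma nplace_nseq_cat r B q p rho : all (ltn 0) rho -> perm_eq p (nseq r B ++ q) ->
  nplace (undup p) rho (fun x => count_mem x p - (x == B) * r)%N = nmult q rho.
Proof.
move=> a pq; rewrite -(@nmult_wide (undup p)) ?undup_uniq //; last first.
  by move=> x xq; rewrite mem_undup (perm_mem pq) mem_cat xq orbT.
apply: eq_nplace => x _; rewrite (seq.permP pq) count_cat count_nseq /= eq_sym.
by rewrite addKn.
Qed.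

Lemma perm_nseq_cat r B p : (r <= count_mem B p)%N ->
  perm_eq p (nseq r B ++ (nseq (count_mem B p - r) B ++ [seq x <- p | x != B])).
Proof.
move=> h; rewrite catA -nseqD subnKC //.
have -> : nseq (count_mem B p) B = [seq x <- p | pred1 B x].
  by apply/esym; rewrite -size_filter; apply/all_pred1P; exact: filter_all.
by rewrite perm_sym perm_filterC.
Qed.

End CountPlacements.

Lemma npart_mtilde pi rho : npart (mtilde pi) rho = nmult pi rho.
Proof.
rewrite /mtilde (@npart_perm _ [seq count_mem B pi | B <- undup pi]) ?perm_sort //.
by rewrite npart_map ?undup_uniq.
Qed.

(** An arbitrary total order on blocks, which lets sorting choose one representative of each
    multiset of blocks. *)
Definition ple (a b : seq nat) : bool := (choice.pickle a <= choice.pickle b)%N.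
Definition csort (p : seq (seq nat)) := sort ple p.

Lemma ple_total : total ple. Proof. by move=> a b; exact: leq_total. Qed.
Lemma ple_trans : transitive ple. Proof. by move=> a b c; exact: leq_trans. Qed.
Lemma ple_anti : antisymmetric ple.
Proof. by move=> a b; rewrite /ple -eqn_leq => /eqP /(pcan_inj choice.pickleK). Qed.

Lemma csortP p q : reflect (csort p = csort q) (perm_eq p q).
Proof. exact: perm_sortP ple_total ple_trans ple_anti p q. Qed.

Lemma perm_csort p : perm_eq (csort p) p. Proof. by rewrite perm_sort. Qed.

Lemma dedup_perm_sub s : {subset dedup_perm s <= s}.
Proof.
elim: s => //= x s IH y; case: ifP => _; rewrite !inE.
  by move=> /IH ->; rewrite orbT.
by move=> /orP[->//|/IH ->]; rewrite orbT.
Qed.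

Lemma dedup_perm_has s x : x \in s -> has (perm_eq x) (dedup_perm s).
Proof.
elim: s => //= y s IH; rewrite inE => /predU1P[->|/IH h]; first by case: ifP => //= _; rewrite perm_refl.
by case: ifP => //= _; rewrite h orbT.
Qed.

Lemma uniq_csort_dedup s : uniq (map csort (dedup_perm s)).
Proof.
elim: s => //= x s IH; case: ifP => //= /negP hx; rewrite IH andbT.
apply/negP => /mapP[y ys /csortP xy]; apply: hx; apply/hasP; by exists y.
Qed.

Definition is_block (b : seq nat) : bool := sorted leq b && (b != [::]).

Lemma mem_bitseqs n m : (m \in bitseqs n) = (size m == n).
Proof.
elim: n m => [|n IH] m; first by rewrite inE size_eq0.
apply/allpairsP/idP => [[[b s] /= [_ + ->]]|]; first by rewrite IH.
by case: m => //= b m; rewrite eqSS -IH => h; exists (b, m); split => //; case: (b).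
Qed.

Lemma mem_submsets S b : (b \in submsets S) =
  is_block b && all (fun v => count_mem v b <= count_mem v S)%N b.
Proof.
rewrite /submsets mem_undup; apply/mapP/andP => [[m]|[/andP[sb b0] /allP cb]].
  rewrite mem_filter mem_bitseqs => /andP[m0 /eqP sm] ->; split.
    rewrite /is_block (sort_sorted leq_total) /= -size_eq0 size_sort size_mask //.
    apply: contraNneq m0 => c0; apply/eqP; rewrite -sm; apply/all_pred1P.
    rewrite all_count -(count_predC id m) c0 add0n; apply/eqP; apply: eq_count.
    by case.
  apply/allP => v _; rewrite (seq.permP (permEl (perm_sort _ _))).
  by rewrite -{2}(mask_true (s := S) (leqnn _)) leq_count_subseq ?mask_subseq //; rewrite mask_true ?mask_subseq.
have [s ss bs] : exists2 s, subseq s S & perm_eq b s.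
  apply/count_subseqP => v; case vb: (v \in b); first exact: cb.
  by rewrite (count_memPn _) ?vb.
have [m sm em] := subseqP ss; exists m.
  rewrite mem_filter mem_bitseqs sm eqxx andbT.
  apply: contraNneq b0 => m0; rewrite -size_eq0 (perm_size bs) em m0 mask_false //.
by rewrite -em; apply: (sorted_eq leq_trans anti_leq) => //;
   rewrite ?(sort_sorted leq_total) // perm_sym perm_sort perm_sym.
Qed.

Lemma mem_tuples_of m c t : (t \in tuples_of m c) = (size t == m) && all (mem c) t.
Proof.
elim: m t => [|m IH] t; first by rewrite inE; case: t.
apply/allpairsP/idP => [[[x s] /= [xc + ->]]|]; first by rewrite IH /= eqSS xc.
case: t => //= x t; rewrite eqSS => /and3P[st xc tc].
by exists (x, t); rewrite /= xc IH st.
Qed.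

Lemma size_leq_flatten (p : seq (seq nat)) : all is_block p -> (size p <= size (flatten p))%N.
Proof.
elim: p => //= b p IH /andP[/andP[_ b0] /IH h]; rewrite size_cat.
by rewrite -add1n leq_add // lt0n size_eq0.
Qed.

(* Multiset partitions, each represented by its sorted sequence of blocks. *)
Definition mpc (S : seq nat) := map csort (mset_parts S).

Lemma uniq_mpc S : uniq (mpc S). Proof. exact: uniq_csort_dedup. Qed.

Lemma mem_mpc S q :
  (q \in mpc S) = [&& csort q == q, all is_block q & perm_eq (flatten q) S].
Proof.
have W p : (p \in [seq pi <- flatten [seq tuples_of m (submsets S) | m <- iota 0 (size S).+1]
    | perm_eq (flatten pi) S]) = all is_block p && perm_eq (flatten p) S.
  rewrite mem_filter andbC; case pS: (perm_eq (flatten p) S); rewrite ?andbF ?andbT //.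
  apply/flatten_mapP/idP => [[m _]|ap].
    rewrite mem_tuples_of => /andP[_ /allP h]; apply/allP => b /h /=.
    by rewrite mem_submsets => /andP[].
  exists (size p); first by rewrite mem_iota add0n ltnS -(perm_size pS) size_leq_flatten.
  rewrite mem_tuples_of eqxx; apply/allP => b bp /=; rewrite mem_submsets (allP ap) //=.
  apply/allP => v _; rewrite -(seq.permP pS) count_flatten.
  by rewrite sumnE big_map (big_rem b) //= leq_addr.
have fl p p' : perm_eq p p' -> perm_eq (flatten p) (flatten p') by exact: perm_flatten.
apply/mapP/and3P => [[p /dedup_perm_sub]|[/eqP cq aq fq]].
  rewrite W => /andP[ap fp] ->; split.
  - by apply/eqP/csortP; exact: perm_csort.
  - by rewrite all_sort.
  - by apply: perm_trans fp; apply: fl; exact: perm_csort.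
have /dedup_perm_has/hasP[p pin pq] : q \in [seq pi <- flatten [seq tuples_of m (submsets S) | m <- iota 0 (size S).+1]
    | perm_eq (flatten pi) S] by rewrite W aq.
by exists p => //; rewrite -cq; apply/csortP.
Qed.

Lemma sum_mset_parts S rho :
  (\sum_(pi <- mset_parts S) npart (mtilde pi) rho = \sum_(q <- mpc S) nmult q rho)%N.
Proof.
rewrite /mpc big_map; apply: eq_bigr => p _; rewrite npart_mtilde.
by apply: nmult_perm; rewrite perm_sym perm_csort.
Qed.

Lemma perm_mpc S S' : perm_eq S S' -> perm_eq (mpc S) (mpc S').
Proof.
move=> p; apply: uniq_perm; rewrite ?uniq_mpc // => q; rewrite !mem_mpc.
by congr [&& _, _ & _]; apply/idP/idP => h; apply: perm_trans h _; rewrite // perm_sym.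
Qed.

(** Deleting r copies of [B] is a bijection from the multiset partitions of S containing [B] at
    least r times onto those of S'. *)
Lemma mpc_strip (Phi : seq (seq nat) -> nat) S S' r B : is_block B ->
  perm_eq S (flatten (nseq r B) ++ S') ->
  (\sum_(q <- mpc S | (r <= count_mem B q)%N) Phi q =
   \sum_(q <- mpc S') Phi (csort (nseq r B ++ q)))%N.
Proof.
move=> Bb pS; rewrite -big_filter -[RHS](big_map (fun q => csort (nseq r B ++ q)) predT Phi).
apply: perm_big; apply: uniq_perm; first by rewrite filter_uniq ?uniq_mpc.
  rewrite map_inj_in_uniq ?uniq_mpc // => q1 q2; rewrite !mem_mpc.
  move=> /and3P[/eqP c1 _ _] /and3P[/eqP c2 _ _] /csortP; rewrite perm_cat2l => /csortP.
  by rewrite c1 c2.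
move=> q; rewrite mem_filter; apply/idP/mapP => [/andP[rB]|[q']].
  rewrite mem_mpc => /and3P[/eqP cq aq fq]; have pq := perm_nseq_cat rB.
  set q'' := (X in nseq r B ++ X) in pq.
  exists (csort q''); last first.
    by rewrite -{1}cq; apply/csortP; rewrite (perm_trans pq) // perm_cat2l perm_sym perm_csort.
  rewrite mem_mpc; apply/and3P; split.
  - by apply/eqP/csortP; exact: perm_csort.
  - rewrite all_sort; move: aq; rewrite (perm_all _ pq) all_cat => /andP[_ //].
  - rewrite (perm_trans (perm_flatten (perm_csort _))) //.
    rewrite -(perm_cat2l (flatten (nseq r B))) -flatten_cat.
    by rewrite (perm_trans _ pS) // (perm_trans _ fq) // perm_flatten // perm_sym.
rewrite !mem_mpc => /and3P[/eqP cq aq fq] ->; have pc := perm_csort (nseq r B ++ q').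
rewrite (seq.permP pc) count_cat count_nseq /= eqxx mul1n leq_addr /=.
apply/and3P; split.
- by apply/eqP/csortP; exact: perm_csort.
- by rewrite all_sort all_cat aq all_nseq Bb orbT.
- rewrite (perm_trans (perm_flatten pc)) // flatten_cat perm_sym (perm_trans pS) //.
  by rewrite perm_cat2l perm_sym.
Qed.

(** A choice of one multiplicity at most [n v] for each key v, recorded as a sorted multiset; the
    empty multiset is included. *)
Fixpoint blocks (keys : seq nat) (n : nat -> nat) : seq (seq nat) :=
  if keys is v :: ks then [seq nseq c v ++ b | c <- iota 0 (n v).+1, b <- blocks ks n]
  else [:: [::]].

Lemma mem_blocks keys n b : sorted ltn keys ->
  (b \in blocks keys n) = [&& sorted leq b, all (mem keys) b & all (fun v => count_mem v b <= n v)%N keys].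
Proof.
elim: keys b => [|v ks IH] b sk.
  by rewrite inE; case: b => //= a b; rewrite andbF.
have sks : sorted ltn ks := path_sorted sk.
have ltv : all (ltn v) ks by exact: order_path_min ltn_trans sk.
have vks : v \notin ks by apply/negP => /(allP ltv) /=; rewrite ltnn.
apply/allpairsP/and3P => [[[c b'] []]|[sb ab cb]].
  rewrite /fst /snd mem_iota leq0n add0n ltnS => cn + ->; rewrite IH // => /and3P[sb' ab' cb'].
  have vb' : v \notin b' by apply/negP => /(allP ab') /=; rewrite (negPf vks).
  split.
  - elim: (c) => //= {cn}c IHc; case: c IHc => /=.
      case: b' sb' ab' {cb' vb'} => //= a b' -> /andP[aks _] _; rewrite andbT.
      by apply: ltnW; apply: (allP ltv).
    by move=> c ->; rewrite leqnn.
  - rewrite all_cat all_nseq /= inE eqxx orbT /=; apply: sub_all ab' => x /= xk.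
    by rewrite inE xk orbT.
  - rewrite /= count_cat count_nseq /= eqxx mul1n (count_memPn vb') addn0.
    rewrite /= in cn; rewrite cn /=.
    apply/allP => u uk; rewrite count_cat count_nseq /=.
    rewrite (_ : (v == u) = false) ?add0n; first exact: (allP cb').
    by apply: contraNF vks => /eqP ->.
exists (count_mem v b, [seq x <- b | x != v]); split; rewrite ?/fst ?/snd.
- by rewrite mem_iota add0n ltnS; case/andP: cb.
- rewrite IH // sorted_filter //=; last exact: leq_trans.
  apply/andP; split.
    rewrite all_filter; apply: sub_all ab => x /=; rewrite inE => /orP[/eqP->|->]; rewrite ?eqxx //.
    by rewrite implybT.
  case/andP: cb => _ cb; apply/allP => u uk; apply: leq_trans (allP cb _ uk).
  by rewrite count_filter; apply: sub_count => x /andP[].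
- have e : nseq (count_mem v b) v = [seq x <- b | x == v].
    by apply/esym; rewrite -size_filter; apply/all_pred1P; exact: filter_all.
  rewrite e; apply: (sorted_eq leq_trans anti_leq) => //; last by rewrite perm_sym perm_filterC.
  rewrite -e; have : all (leq v) [seq x <- b | x != v].
    rewrite all_filter; apply: sub_all ab => x; rewrite /= inE => /orP[/eqP->|xk]; rewrite ?eqxx //.
    by rewrite (ltnW (allP ltv _ xk)) implybT.
  have : sorted leq [seq x <- b | x != v] by apply: sorted_filter => //; exact: leq_trans.
  elim: (count_mem v b) => //= c IHc sf af; rewrite path_sortedE; last exact: leq_trans.
  by rewrite all_cat all_nseq leqnn orbT af IHc.
Qed.

Lemma uniq_blocks keys n : uniq keys -> uniq (blocks keys n) /\
   (forall b, b \in blocks keys n -> all (mem keys) b).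
Proof.
elim: keys => [|v ks IH]; first by split=> // b; rewrite inE => /eqP->.
rewrite cons_uniq => /andP[vks uks]; have [ub ab] := IH uks; split; last first.
  move=> b /allpairsP[[c b'] /= [_ b'in ->]]; rewrite all_cat all_nseq /= inE eqxx orbT /=.
  by apply: sub_all (ab _ b'in) => x /= xk; rewrite inE xk orbT.
apply: allpairs_uniq; rewrite ?iota_uniq //.
have cv b : b \in blocks ks n -> count_mem v b = 0%N.
  by move=> bin; apply/count_memPn/negP => /(allP (ab _ bin)) /=; rewrite (negPf vks).
move=> [c1 b1] [c2 b2] /allpairsP[[? ?] [_ h1 [-> ->]]] /allpairsP[[? ?] [_ h2 [-> ->]]] e.
move: h1 h2 e => /= h1 h2 e.
have ec := congr1 (count_mem v) e; move: ec; rewrite !count_cat (cv _ h1) (cv _ h2) !count_nseq /= eqxx !mul1n !addn0.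
move=> ec; move: e; rewrite ec => /eqP; rewrite eqseq_cat // => /andP[_ /eqP ->] //.
Qed.

Lemma prod_sum_blocks keys (n : nat -> nat) (F : nat -> nat -> nat) : uniq keys ->
  (\prod_(v <- keys) \sum_(c < (n v).+1) F v c =
   \sum_(b <- blocks keys n) \prod_(v <- keys) F v (count_mem v b))%N.
Proof.
elim: keys => [|v ks IH]; first by rewrite big_nil big_seq1 big_nil.
rewrite cons_uniq => /andP[vks uks]; have [_ ab] := uniq_blocks n uks.
rewrite big_cons IH // big_allpairs_dep -(big_mkord predT (F v)) big_distrl /=.
rewrite /index_iota subn0; apply: eq_bigr => c _; rewrite big_distrr /= big_seq [RHS]big_seq.
apply: eq_bigr => b bin; rewrite big_cons count_cat count_nseq /= eqxx mul1n.
have -> : count_mem v b = 0%N.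
  by apply/count_memPn/negP => /(allP (ab _ bin)) /=; rewrite (negPf vks).
rewrite addn0; congr (_ * _)%N; rewrite !big_seq; apply: eq_bigr => u uk.
rewrite count_cat count_nseq /= (_ : (v == u) = false) ?mul0n //.
by apply: contraNF vks => /eqP ->.
Qed.

Lemma count_flatten_nseq (keys : seq nat) (f : nat -> nat) v : uniq keys ->
  count_mem v (flatten [seq nseq (f u) u | u <- keys]) = (if v \in keys then f v else 0%N).
Proof.
elim: keys => //= u ks IH /andP[uk /IH h]; rewrite count_cat h count_nseq /= inE [u == v]eq_sym.
case: eqVneq => [->|] /=; last by rewrite mul0n.
by rewrite (negPf uk) mul1n addn0.
Qed.

Definition msub (S b : seq nat) (r : nat) : seq nat :=
  flatten [seq nseq (count_mem v S - count_mem v b * r) v | v <- undup S].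

Lemma count_msub S b r v : count_mem v (msub S b r) = (count_mem v S - count_mem v b * r)%N.
Proof.
rewrite /msub (count_flatten_nseq (fun v => count_mem v S - count_mem v b * r)%N) ?undup_uniq //.
by rewrite mem_undup; case: ifP => // /negbT/count_memPn ->.
Qed.

Lemma perm_msub S b r : (forall v, count_mem v b * r <= count_mem v S)%N ->
  perm_eq S (flatten (nseq r b) ++ msub S b r).
Proof.
move=> h; apply/allP => v _; apply/eqP.
rewrite /= count_cat count_flatten map_nseq sumn_nseq count_msub.
by rewrite subnKC.
Qed.

Lemma sumn_map_leq (T : eqType) (f : T -> nat) (s : seq T) x r :
  (r <= count_mem x s)%N -> (f x * r <= sumn (map f s))%N.
Proof.
move=> h; have p := perm_nseq_cat h.
rewrite (sumn_perm (perm_map f p)) map_cat map_nseq sumn_cat sumn_nseq.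
by rewrite leq_addr.
Qed.

Lemma ncomb_trunc r rho m : (0 < r)%N ->
  ncomb (r :: rho) m = (\sum_(c < (m %/ r).+1) ncomb rho (m - c * r))%N.
Proof.
move=> r0 /=; rewrite [RHS](big_ord_widen m.+1 (fun c => ncomb rho (m - c * r))); last first.
  by rewrite ltnS leq_div.
by apply: eq_bigl => c; rewrite ltnS leq_divRL.
Qed.

(** Both sides count the ways to attach to each cycle r a possibly empty multiset b so that S is the
    union of r copies of each b. On the right the multiplicities in b are chosen separately for each
    v. On the left the cycles with a given nonempty b are those placed in the box of the block b,
    and an empty b leaves its cycle unplaced. *)
Lemma sum_mpc rho S keys : all (ltn 0) rho -> sorted ltn keys -> {subset S <= keys} ->
  (\sum_(q <- mpc S) nmult q rho = \prod_(v <- keys) ncomb rho (count_mem v S))%N.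
Proof.
move=> + sk; have uk : uniq keys by apply: sorted_uniq sk; [exact: ltn_trans | exact: ltnn].
elim: rho S => [|r rho IH] S.
  move=> _ Sk.
  have E q : nmult q [::] = (q == [::]).
    case: q => // b q.
    rewrite [LHS](_ : _ = nat_of_bool (all (fun x => count_mem x (b :: q) == 0)%N (undup (b :: q)))) //.
    rewrite (_ : all _ _ = false) //; apply/negbTE/allPn.
    by exists b; [rewrite mem_undup mem_head | rewrite /= eqxx].
  under eq_bigr do rewrite E.
  have -> : (\sum_(i <- mpc S) (i == [::]) = ([::] \in mpc S))%N.
    by rewrite -(count_uniq_mem _ (uniq_mpc S)) -sum1_count [RHS]big_mkcond.
  rewrite mem_mpc /=; case: S Sk => [|v S] Sk.
    by rewrite perm_refl /= big1.
  have -> : perm_eq [::] (v :: S) = false by rewrite perm_sym; apply/negP => /perm_size.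
  by rewrite (bigD1_seq v) ?Sk ?mem_head //= eqxx.
move=> /= /andP[r0 a] Sk; rewrite -/(all _ _) in a; have {}r0 : (0 < r)%N by [].
have {}IH S' := IH S' a.
under [RHS]eq_bigr => v _ do rewrite -/(ncomb (r :: rho) _) ncomb_trunc //.
(* The multiset attached to the first cycle r uses up r copies of each of its elements, whence this
   bound. *)
pose n v := (count_mem v S %/ r)%N; pose bl := blocks keys n.
rewrite (prod_sum_blocks n (fun v c => ncomb rho (count_mem v S - c * r)%N)) // -/bl.
have [ubl _] := uniq_blocks n uk.
have inbl b : (b \in bl) = [&& sorted leq b, all (mem keys) b & all (fun v => count_mem v b <= n v)%N keys].
  exact: mem_blocks.
have nilbl : [::] \in bl by rewrite inbl /=; apply/allP.
have term b : b \in bl -> (\prod_(v <- keys) ncomb rho (count_mem v S - count_mem v b * r) =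
    \sum_(q <- mpc (msub S b r)) nmult q rho)%N.
  move=> _; rewrite IH; last first.
    move=> v; rewrite -has_pred1 has_count count_msub => h; apply: Sk.
    by rewrite -has_pred1 has_count; lia.
  by apply: eq_bigr => v _; rewrite count_msub.
(* The empty multiset gives the term in which r stays unplaced. *)
rewrite [RHS]big_seq [RHS](eq_bigr _ term) -[RHS]big_seq [RHS](bigD1_seq [::]) //=.
have -> : (\sum_(q <- mpc (msub S [::] r)) nmult q rho = \sum_(q <- mpc S) nmult q rho)%N.
  apply: perm_big; apply: perm_mpc; apply/allP => v _; apply/eqP.
  by rewrite count_msub /= mul0n subn0.
rewrite /nmult big_split; congr (_ + _)%N.
pose X (q : seq (seq nat)) (b : seq nat) := nplace (undup q) rho (fun x => count_mem x q - (x == b) * r)%N.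
(* Every block of q with room for r already lies in [bl], an index set independent of q, so the two
   sums can be exchanged. *)
transitivity (\sum_(q <- mpc S) \sum_(b <- bl | (b != [::]) && (r <= count_mem b q)%N) X q b)%N.
  rewrite big_seq [RHS]big_seq; apply: eq_bigr => q; rewrite mem_mpc => /and3P[_ bq fq].
  rewrite -big_filter -[RHS]big_filter; apply: perm_big.
  apply: uniq_perm; rewrite ?filter_uniq ?undup_uniq // => b.
  rewrite !mem_filter mem_undup; case rb: (r <= count_mem b q)%N; rewrite ?andbF //=.
  have bin : b \in q by rewrite -has_pred1 has_count; apply: leq_trans rb.
  have /andP[sb b0] := allP bq _ bin; rewrite bin b0 inbl sb /=; apply/esym/andP; split.
    apply/allP => v vb; apply: Sk; rewrite -(perm_mem fq); apply/flattenP; by exists b.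
  apply/allP => v _; rewrite /n leq_divRL // -(seq.permP fq) count_flatten.
  exact: (sumn_map_leq (fun b => count_mem v b)).
rewrite (exchange_big_dep (fun b => b != [::])) /=; last by move=> ? ? _ /andP[].
rewrite big_seq_cond [RHS]big_seq_cond; apply: eq_bigr => b /andP[bbl b0].
move: bbl; rewrite inbl => /and3P[sb ab cb].
have Bb : is_block b by rewrite /is_block sb.
have le v : (count_mem v b * r <= count_mem v S)%N.
  case vk: (v \in keys); first by rewrite -leq_divRL //; apply: (allP cb).
  rewrite (count_memPn _) //; apply/negP => /(allP ab) /=; by rewrite vk.
have pS := perm_msub le.
rewrite (eq_bigl (fun q => r <= count_mem b q)%N); last by move=> q; rewrite b0.
rewrite (mpc_strip (X^~ b) Bb pS); apply: eq_bigr => q _.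
by rewrite /X (@nplace_nseq_cat _ r b q) // perm_csort.
Qed.

Lemma iota1 n : iota 1 n = map succn (iota 0 n).
Proof. by rewrite -[1%N]addn0 iotaDl. Qed.

Lemma mset_ofE lam :
  mset_of lam = flatten [seq nseq (nth 0%N lam v.-1) v | v <- iota 1 (size lam)].
Proof. by rewrite /mset_of iota1 -map_comp. Qed.

Lemma count_mset_of lam v :
  count_mem v (mset_of lam) = if v \in iota 1 (size lam) then nth 0%N lam v.-1 else 0%N.
Proof. by rewrite mset_ofE (count_flatten_nseq (fun v => nth 0%N lam v.-1)) ?iota_uniq. Qed.

Lemma size_mset_of lam : size (mset_of lam) = sumn lam.
Proof.
rewrite size_flatten /shape -map_comp; congr sumn.
rewrite (eq_map (g := nth 0%N lam)) => [|i]; last by rewrite /= size_nseq.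
by rewrite map_nth_iota0 // take_size.
Qed.

Lemma mset_of_sub lam : {subset mset_of lam <= iota 1 (size lam)}.
Proof.
move=> v; apply: contraLR => h; apply/count_memPn.
by rewrite count_mset_of (negPf h).
Qed.

Lemma ev_hprod rho lam : all (ltn 0) rho ->
  ev rho (hprod lam) = (\sum_(pi <- mset_parts (mset_of lam)) npart (mtilde pi) rho)%N%:R.
Proof.
move=> a; rewrite sum_mset_parts (@sum_mpc _ _ (iota 1 (size lam))) //; last first.
- exact: mset_of_sub.
- exact: iota_ltn_sorted.
rewrite /hprod rmorph_prod /= natr_prod iota1 big_map.
rewrite (big_nth 0%N) /index_iota subn0 !big_seq; apply: eq_bigr => i; rewrite mem_iota => /andP[_ il].
by rewrite ev_hcomp // count_mset_of mem_iota add1n /= ltnS il.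
Qed.

Lemma npart_mset_of lam rho : all (ltn 0) rho -> nmult (mset_of lam) rho = npart lam rho.
Proof.
move=> a; rewrite -(@nmult_wide _ (iota 1 (size lam))) ?iota_uniq //; last exact: mset_of_sub.
rewrite iota1 nplace_map; last by move=> ? ? _ _ [].
by apply: eq_nplace => i; rewrite mem_iota add0n => /= il; rewrite count_mset_of mem_iota /= add1n ltnS il.
Qed.

Definition singletons (S : seq nat) : seq (seq nat) := csort [seq [:: v] | v <- S].

Lemma flatten_singletons (S : seq nat) : flatten [seq [:: v] | v <- S] = S.
Proof. by elim: S => //= v S ->. Qed.

Lemma mem_singletons S : singletons S \in mpc S.
Proof.
have p := perm_csort [seq [:: v] | v <- S].
rewrite mem_mpc; apply/and3P; split.
- by apply/eqP/csortP; exact: perm_csort.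
- by rewrite all_sort; apply/allP => _ /mapP[v _ ->].
- by rewrite (perm_trans (perm_flatten p)) // flatten_singletons.
Qed.

(** Blocks are nonempty, so as many blocks as elements leaves one element for each. *)
Lemma mpc_large S q : q \in mpc S -> (size S <= size q)%N -> q = singletons S.
Proof.
rewrite mem_mpc => /and3P[/eqP cq aq fq] Sq; rewrite -cq; apply/csortP.
suff -> : q = [seq [:: v] | v <- flatten q] by apply: perm_map.
rewrite -(perm_size fq) in Sq; elim: q aq Sq {cq fq} => //= b q IH /andP[/andP[_ b0] aq].
have := size_leq_flatten aq; rewrite size_cat => h1 h2.
case: b b0 h2 => // v [|w b] _ /= h2; last by lia.
by rewrite {1}IH //; lia.
Qed.

Lemma nmult_singletons S rho : nmult (singletons S) rho = nmult S rho.
Proof.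
rewrite (nmult_perm _ (perm_csort _)) /nmult undup_map_inj; last by move=> ? ? [].
rewrite nplace_map; last by move=> ? ? _ _ [].
apply: eq_nplace => v _ /=; rewrite count_map; apply: eq_count => u /=.
by rewrite eqseq_cons andbT.
Qed.

Lemma sumn_mtilde pi : sumn (mtilde pi) = size pi.
Proof.
rewrite (sumn_perm (permEl (perm_sort _ _))) sumnE big_map -[RHS]sum1_size.
rewrite -[RHS]big_undup_iterop_count; apply: eq_bigr => B _.
by rewrite Monoid.iteropE iter_addn_0 mul1n.
Qed.

(** By [ev_hprod] the numbers [npart] obey the recursion that defines h~. By induction the multiset
    partitions with fewer than |lam| blocks cancel, and the one into singletons remains. *)
Lemma ev_htil_aux rho f lam : all (ltn 0) rho -> (sumn lam <= f)%N ->
  ev rho (htil_aux f lam) = (npart lam rho)%:R.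
Proof.
move=> a; elim: f lam => [|f IH] lam /=.
  rewrite leqn0 => /eqP s0.
  (* [lam] is an arbitrary sequence here, so sum 0 means that all entries are zero, not that it is
     empty. *)
  have z i : nth 0%N lam i = 0%N.
    have := s0; rewrite -[lam in sumn lam](mkseq_nth 0%N) sumnE big_map => /eqP.
    case: (ltnP i (size lam)) => il; last by rewrite nth_default.
    by rewrite sum_nat_seq_eq0 => /allP/(_ i); rewrite mem_iota il => /(_ isT)/eqP.
  rewrite /npart nplace0 //.
  rewrite /hprod rmorph_prod (big_nth 0%N) big1 // => i _.
  by rewrite z /= ev_hcomp // ncomb0.
move=> lf; rewrite rmorphB /= ev_hprod // [ev _ _]rmorph_sum /=.
rewrite [X in X%:R - _](bigID (fun pi : seq (seq nat) => size pi < sumn lam)%N) /= natrD natr_sum.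
rewrite [X in _ - X](eq_bigr (fun pi => (npart (mtilde pi) rho)%:R)); last first.
  by move=> pi lt; rewrite IH // sumn_mtilde; lia.
rewrite addrAC subrr add0r; congr (_%:R).
transitivity (\sum_(q <- mpc (mset_of lam) | ~~ (size q < sumn lam)%N) nmult q rho)%N.
  rewrite /mpc big_map; apply: eq_big => p; first by rewrite size_sort.
  by move=> _; rewrite npart_mtilde; apply: nmult_perm; rewrite perm_sym perm_csort.
set S := mset_of lam; have sS : size S = sumn lam by exact: size_mset_of.
rewrite big_seq_cond (eq_bigl (pred1 (singletons S))) => [|q]; last first.
  rewrite /=; apply/andP/eqP => [[qS]|->].
    by rewrite -leqNgt -sS => /(mpc_large qS).
  split; first exact: mem_singletons.
  by rewrite -leqNgt size_sort size_map sS.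
rewrite -big_filter (_ : [seq _ <- _ | _] = [:: singletons S]); last first.
  by apply: filter_pred1_uniq; [exact: uniq_mpc | exact: mem_singletons].
by rewrite big_seq1 nmult_singletons npart_mset_of.
Qed.

Lemma ev_htil rho lam : all (ltn 0) rho -> ev rho (htil lam) = (npart lam rho)%:R.
Proof. by move=> a; apply: ev_htil_aux. Qed.

(** * Frobenius characters *)

(** Inverse of lam -> lam + delta on strictly decreasing lists; zero parts are kept. *)
Fixpoint unbeta (t : seq nat) : seq nat :=
  if t is a :: t' then (a - size t')%N :: unbeta t' else [::].

Lemma size_unbeta t : size (unbeta t) = size t.
Proof. by elim: t => //= a t ->. Qed.

Lemma unbeta_sorted t : sorted gtn t ->
  sorted geq (unbeta t) /\ (forall i, (i < size t)%N ->
     nth 0%N t i = nth 0%N (unbeta t) i + (size t - i.+1))%N.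
Proof.
elim: t => // a t IH /= pt; have [st nt] := IH (path_sorted pt).
have sa : (size t <= a)%N.
  case: t {IH st} nt pt => //= b t /(_ 0%N isT) /= ->; rewrite subn1 /= => /andP[+ _]; lia.
split; last first.
  case=> [|i] /= it; last by rewrite nt //; lia.
  by rewrite subn1 /=; lia.
case: t {IH} st nt pt sa => //= b t -> /(_ 0%N isT) /= -> /andP[+ _] _; rewrite andbT; lia.
Qed.

Lemma filter_pos_sorted l : sorted geq l ->
  l = [seq x <- l | (0 < x)%N] ++ nseq (count_mem 0%N l) 0%N.
Proof.
elim: l => // a l IH /= pl; have {}IH := IH (path_sorted pl).
case: a pl => [|a] pl /=; last by rewrite {1}IH.
have z : all (pred1 0%N) l.
  have := order_path_min geq_trans pl; apply: sub_all => x /=; lia.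
have -> : [seq x <- l | (0 < x)%N] = [::].
  by rewrite -(filter_pred0 l); apply: eq_in_filter => x /(allP z) /= /eqP ->.
have -> : count_mem 0%N l = size l by apply/eqP; rewrite -all_count.
by rewrite /=; congr (_ :: _); apply/all_pred1P.
Qed.

Section Vectors.
Variable M : nat.
Notation vec := {ffun 'I_M -> int}.
Implicit Types (a b : vec) (s : {perm 'I_M}) (rho : seq nat).

Definition evec (i : 'I_M) (t : int) : vec := [ffun k => if k == i then t else 0].
Definition vperm b s : vec := [ffun i => b (s i)].
Definition beta (lam : seq nat) : vec := [ffun i : 'I_M => (nth 0%N lam i + (M - i.+1))%:Z].
Notation delta := (beta [::]).
Definition vsum b : int := \sum_i b i.

Lemma vpermE b s i : vperm b s i = b (s i). Proof. by rewrite ffunE. Qed.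
Lemma addvE a b i : (a + b) i = a i + b i. Proof. by rewrite ffunE. Qed.
Lemma oppvE a i : (- a) i = - a i. Proof. by rewrite ffunE. Qed.
Lemma evecE i t k : evec i t k = if k == i then t else 0. Proof. by rewrite ffunE. Qed.
Lemma betaE lam (i : 'I_M) : beta lam i = (nth 0%N lam i + (M - i.+1))%:Z.
Proof. by rewrite ffunE. Qed.
Definition vE := (addvE, oppvE, evecE, vpermE, betaE).

Lemma vpermM b s t : vperm (vperm b s) t = vperm b (t * s)%g.
Proof. by apply/ffunP => i; rewrite !ffunE permM. Qed.

Lemma vperm1 b : vperm b 1%g = b.
Proof. by apply/ffunP => i; rewrite ffunE perm1. Qed.

Lemma vpermD a b s : vperm (a + b) s = vperm a s + vperm b s.
Proof. by apply/ffunP => i; rewrite !ffunE. Qed.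

Lemma vpermN a s : vperm (- a) s = - vperm a s.
Proof. by apply/ffunP => i; rewrite !ffunE. Qed.

Lemma vperm_evec i t s : vperm (evec (s i) t) s = evec i t.
Proof. by apply/ffunP => k; rewrite !ffunE (inj_eq perm_inj). Qed.

Lemma vperm0 s : vperm 0 s = 0.
Proof. by apply/ffunP => k; rewrite !ffunE. Qed.

Lemma vperm_inj s : injective (vperm^~ s).
Proof. by move=> a b e; rewrite -[a]vperm1 -[b]vperm1 -(mulVg s) -!vpermM e. Qed.

Lemma vsumD a b : vsum (a + b) = vsum a + vsum b.
Proof. by rewrite /vsum -big_split; apply: eq_bigr => i _; rewrite ffunE. Qed.

Lemma vsumN a : vsum (- a) = - vsum a.
Proof. by rewrite /vsum -sumrN; apply: eq_bigr => i _; rewrite ffunE. Qed.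

Lemma vsum_evec i t : vsum (evec i t) = t.
Proof.
rewrite /vsum (bigD1 i) //= big1 ?addr0; first by rewrite ffunE eqxx.
by move=> k ki; rewrite ffunE (negPf ki).
Qed.

Lemma vsum_perm b s : vsum (vperm b s) = vsum b.
Proof.
by rewrite /vsum [RHS](reindex_inj (@perm_inj _ s)); apply: eq_bigr => i _; rewrite ffunE.
Qed.

Lemma sum_nth_widen (lam : seq nat) : (size lam <= M)%N -> \sum_(i < M) (nth 0%N lam i)%:Z = (sumn lam)%:Z.
Proof.
move=> sM; rewrite -(big_mkord predT (fun i => (nth 0%N lam i)%:Z)).
rewrite (big_cat_nat (n := size lam)) //= [X in _ + X]big_nat_cond [X in _ + X]big1 ?addr0.
  by rewrite sumnE [in RHS](big_nth 0%N) (big_morph Posz PoszD (erefl _)).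
by move=> i /andP[/andP[li _] _]; rewrite nth_default.
Qed.

Lemma vsum_beta lam : (size lam <= M)%N -> vsum (beta lam) = (sumn lam)%:Z + vsum delta.
Proof.
move=> sM; rewrite -sum_nth_widen // /vsum -big_split; apply: eq_bigr => i _.
by rewrite !ffunE nth_nil add0n PoszD.
Qed.

(** Sorting gives a strictly decreasing list; subtracting delta and dropping zeros leaves a
    partition. *)
Lemma beta_repr b : injective b -> (forall i, 0 <= b i) ->
  exists s, exists lam, [/\ is_part lam, (size lam <= M)%N & b = vperm (beta lam) s].
Proof.
move=> inj b0; pose f := [seq `|b i|%N | i <- enum 'I_M].
have sf : size (sort geq f) == M by rewrite size_sort size_map size_enum_ord.
have /tuple_permP[s es] : perm_eq f (Tuple sf) by rewrite /= perm_sym perm_sort.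
have uf : uniq f.
  rewrite map_inj_uniq ?enum_uniq // => i j ij; apply: inj.
  by rewrite -[b i]gez0_abs // -[b j]gez0_abs // ij.
have st : sorted gtn (sort geq f).
  have := sort_sorted geq_total f; have : uniq (sort geq f) by rewrite sort_uniq.
  elim: (sort geq f) => // x [|y t] // IH /= /andP[]; rewrite inE negb_or => /andP[xy _] u /andP[yx p].
  by rewrite [path _ _ _]IH // ltn_neqAle eq_sym xy yx.
have [su nu] := unbeta_sorted st.
pose lam := [seq x <- unbeta (sort geq f) | (0 < x)%N].
have nl i : nth 0%N lam i = nth 0%N (unbeta (sort geq f)) i.
  rewrite [in RHS](filter_pos_sorted su) nth_cat -/lam; case: ltnP => // h.
  by rewrite nth_nseq if_same nth_default.
exists s, lam; split.
- by rewrite /is_part filter_all andbT sorted_filter //; exact: geq_trans.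
- by rewrite size_filter (leq_trans (count_size _ _)) // size_unbeta (eqP sf).
apply/ffunP => i; rewrite !ffunE nl.
have := nu (s i); rewrite (eqP sf) => <- //.
have := congr1 (fun t => nth 0%N t i) es.
rewrite /f (nth_map i) ?size_enum_ord // nth_ord_enum.
rewrite (nth_map i) ?size_enum_ord // nth_ord_enum (tnth_nth 0%N) /= => <-.
by rewrite gez0_abs.
Qed.

(** Up to order b is lam + delta with |lam| = D. As lam has at most D rows, the remaining
    coordinates are those of delta and supply every value below M - D. This is where M has to be
    large. *)
Lemma beta_contains b (D v : nat) : injective b -> (forall i, 0 <= b i) ->
  vsum b = vsum delta + D%:Z -> (v + D < M)%N -> exists i, b i = v%:Z.
Proof.
move=> inj b0 vs vD; have [s [lam [/andP[_ pl] sl e]]] := beta_repr inj b0.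
have sD : sumn lam = D.
  move: vs; rewrite e vsum_perm vsum_beta // addrC => /addrI [] //.
have szD : (size lam <= D)%N.
  rewrite -sD; elim: (lam) pl => //= x l IH /andP[x0 /IH]; lia.
have iM : (M - v.+1 < M)%N by lia.
exists ((s^-1)%g (Ordinal iM)); rewrite e !ffunE permKV /= nth_default; last by lia.
by rewrite add0n; congr Posz; lia.
Qed.

Lemma vsum_inj_ge b : injective b -> (forall i, 0 <= b i) -> vsum delta <= vsum b.
Proof.
move=> inj b0; have [s [lam [_ sl ->]]] := beta_repr inj b0.
by rewrite vsum_perm [X in _ <= X]vsum_beta // lerDr.
Qed.

Definition alternating (R : zmodType) (F : vec -> R) :=
  forall b s, F (vperm b s) = if odd_perm s then - F b else F b.

Lemma alternating_eq0 (F : vec -> rat) b : alternating F -> ~ injective b -> F b = 0.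
Proof.
move=> alt /injectiveP/injectivePn[i [j ij bij]].
have e : vperm b (tperm i j) = b.
  by apply/ffunP => k; rewrite ffunE; case: tpermP => // ->.
have := alt b (tperm i j); rewrite e odd_tperm ij => h.
have /eqP : F b *+ 2 = 0 by rewrite mulr2n {1}h addNr.
by rewrite mulrn_eq0 => /eqP.
Qed.

(** The condition looks only at the value of the coordinate being changed, so the operation commutes
    with permuting coordinates. *)
Lemma alternating_sum (F : vec -> rat) (P : pred int) (t : int) :
  alternating F -> alternating (fun b => \sum_(j | P (b j)) F (b + evec j t)).
Proof.
move=> alt b s /=.
rewrite (reindex_inj (@perm_inj _ (s^-1)%g)) /=.
rewrite -[- _]mulN1r mulr_sumr.
transitivity (\sum_(j | P (b j)) (if odd_perm s then - F (b + evec j t) else F (b + evec j t))).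
  apply: eq_big => [j|j _]; first by rewrite ffunE permKV.
  rewrite -[in evec _ t](permKV s j) -{1}(vperm_evec _ t s) permKV -vpermD.
  by rewrite permKV alt.
by case: ifP => _ //; apply: eq_bigr => j _; rewrite mulN1r.
Qed.

(* Coefficient of x^a in the product of power sums p_rho(x_1, ..., x_M). *)
Fixpoint pcoef rho a : nat :=
  if rho is d :: rho' then (\sum_i pcoef rho' (a - evec i d%:Z)%R)%N else (a == 0).

Lemma pcoef_perm rho a s : pcoef rho (vperm a s) = pcoef rho a.
Proof.
elim: rho a => [|d rho IH] a /=.
  by rewrite -(inj_eq (@vperm_inj s) a 0) vperm0.
rewrite [RHS](reindex_inj (@perm_inj _ s)); apply: eq_bigr => i _ /=.
by rewrite -[RHS]IH vpermD vpermN vperm_evec.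
Qed.

Lemma pcoef_neg rho a i : all (ltn 0) rho -> a i < 0 -> pcoef rho a = 0%N.
Proof.
elim: rho a => [|d rho IH] a /=.
  by move=> _ ai; case: eqP => // a0; rewrite a0 ffunE ltxx in ai.
move=> /andP[d0 pr] ai; rewrite big1 // => j _; apply: IH => //.
by rewrite !vE; case: ifP => _; lia.
Qed.

Lemma pcoef_vsum rho a : pcoef rho a != 0%N -> vsum a = (sumn rho)%:Z.
Proof.
elim: rho a => [|d rho IH] a /=.
  case: (a =P 0) => [-> _|//]; rewrite /vsum big1 // => i _; by rewrite ffunE.
rewrite sum_nat_eq0 negb_forall => /existsP[i /= /IH].
by rewrite vsumD vsumN vsum_evec; lia.
Qed.

Lemma pcoef_rem rho d a : d \in rho -> pcoef rho a = pcoef (d :: rem d rho) a.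
Proof.
elim: rho a => // r rho IH a; rewrite inE eq_sym /=; case: eqVneq => [->//|rd /= dr].
transitivity (\sum_i \sum_j pcoef (rem d rho) (a - evec i r%:Z - evec j d%:Z)%R)%N.
  by apply: eq_bigr => i _; rewrite IH.
rewrite exchange_big; apply: eq_bigr => j _; apply: eq_bigr => i _.
by rewrite addrAC.
Qed.

(** Coefficient of x^b in the Vandermonde alternant of delta times p_rho. Leaving b arbitrary,
    instead of only lam + delta, makes removing and adding cycles plain shifts of one coordinate. *)
Definition chi rho b : rat :=
  \sum_(s : {perm 'I_M}) (-1) ^+ s * (pcoef rho (b - vperm delta s))%:R.

Lemma chi_cons d rho b : chi (d :: rho) b = \sum_i chi rho (b - evec i d%:Z).
Proof.
rewrite exchange_big; apply: eq_bigr => s _; rewrite /= natr_sum mulr_sumr.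
by apply: eq_bigr => i _; rewrite addrAC.
Qed.

Lemma chi_alternating rho : alternating (chi rho).
Proof.
move=> b s; rewrite /chi (reindex_inj (mulgI s)) /=.
transitivity ((-1) ^+ s * chi rho b); last first.
  by case: (odd_perm s); rewrite ?expr1 ?expr0 ?mulN1r ?mul1r.
rewrite mulr_sumr; apply: eq_bigr => t _.
rewrite odd_permM signr_addb -mulrA; congr (_ * (_ * _%:R)).
by rewrite -vpermM -vpermN -vpermD pcoef_perm.
Qed.

Lemma chi_neg rho b i : all (ltn 0) rho -> b i < 0 -> chi rho b = 0.
Proof.
move=> pr bi; rewrite /chi big1 // => s _; rewrite (@pcoef_neg _ _ i) ?mulr0 //.
by rewrite !vE; lia.
Qed.

Lemma chi_vsum rho b : chi rho b != 0 -> vsum b = vsum delta + (sumn rho)%:Z.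
Proof.
move=> h; apply/eqP; apply: contraNT h => ne; rewrite /chi big1 // => s _.
case: (eqVneq (pcoef rho (b - vperm delta s)) 0%N) => [->|/pcoef_vsum]; first by rewrite mulr0.
rewrite vsumD vsumN vsum_perm => e; case/eqP: ne; rewrite -e; lia.
Qed.

Lemma chi_injective rho b : chi rho b != 0 -> injective b.
Proof.
move=> h; apply/injectiveP; apply: contraNT h => /injectiveP ni; apply/eqP.
by apply: alternating_eq0 ni; exact: chi_alternating.
Qed.

Lemma chi_ge0 rho b i : all (ltn 0) rho -> chi rho b != 0 -> 0 <= b i.
Proof. by move=> pr; apply: contraNT; rewrite -ltNge => /(chi_neg pr) ->. Qed.

Lemma chi_rem rho d b : d \in rho -> chi rho b = chi (d :: rem d rho) b.
Proof. by move=> dr; apply: eq_bigr => s _; rewrite (pcoef_rem _ dr). Qed.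

(* Boundary terms of the commutator of the two operators "remove k" and
   "add d": they cancel in pairs unless k = d. *)
Lemma chi_boundary_neq rho (k d : nat) b : all (ltn 0) rho -> k != d ->
  (forall i, 0 <= b i) -> (sumn rho + k <= M)%N ->
  \sum_(j | b j < k%:Z) chi rho (b + evec j (d%:Z - k%:Z)) = 0.
Proof.
move=> pr kd b0 leM; case: (boolP (injectiveb b)) => /injectiveP inj; last first.
  exact: (alternating_eq0 (alternating_sum (fun x => x < k%:Z) (d%:Z - k%:Z) (@chi_alternating rho)) inj).
apply: big1 => j bjk; apply/eqP/negPn/negP => h.
set b' := b + _ in h.
(* The value b_j still occurs in b' although coordinate j has changed, so b takes it at a second
   coordinate, contradicting injectivity. *)
have [|i bi] := @beta_contains b' (sumn rho) `|b j|%N (chi_injective h) (fun i => chi_ge0 i pr h) (chi_vsum h).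
  have := b0 j; lia.
have ij : i != j by apply/eqP => e; move: bi; rewrite e !vE eqxx; have := b0 j; lia.
case/eqP: ij; apply: inj; move: bi; rewrite !vE; case: ifP => [/eqP e|_]; last by have := b0 j; lia.
by rewrite e.
Qed.

(** If [chi rho b] is nonzero, the coordinates of b are distinct and include 0, ..., d-1 by
    [beta_contains], so exactly d of them are below d. *)
Lemma chi_boundary_eq rho (d : nat) b : all (ltn 0) rho ->
  (sumn rho + d <= M)%N -> \sum_(j | b j < d%:Z) chi rho b = d%:R * chi rho b.
Proof.
move=> pr leM; case: (eqVneq (chi rho b) 0) => [->|h].
  by rewrite big1 // mulr0.
have inj := chi_injective h; have b0 i := chi_ge0 i pr h.
rewrite big_const iter_addr addr0 mulr_natl; congr (_ *+ _).
rewrite -(size_image b) -[RHS](size_iota 0) -(size_map Posz (iota 0 d)).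
apply: perm_size; apply: uniq_perm.
- by rewrite map_inj_uniq ?enum_uniq.
- by rewrite map_inj_uniq ?iota_uniq // => ? ? [].
move=> x; apply/imageP/mapP => [[j bj ->]|[v]].
  exists `|b j|%N; last by have := b0 j; lia.
  by rewrite mem_iota; have := b0 j; move: bj; rewrite unfold_in; lia.
rewrite mem_iota => vd ->.
have [|i bi] := beta_contains (v := v) inj b0 (chi_vsum h); first by lia.
by exists i; rewrite ?bi // unfold_in bi; lia.
Qed.

(** Adding d plays the role of d times the derivative in p_d. Moving it past the parts of [rho] one
    at a time yields a factor d for each part equal to d, and on the empty [rho] it gives 0. *)
Lemma chi_up rho (d : nat) b : all (ltn 0) rho -> (0 < d)%N ->
  (forall i, 0 <= b i) -> (sumn rho <= M)%N ->
  \sum_j chi rho (b + evec j d%:Z) = (d * count_mem d rho)%:R * chi (rem d rho) b.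
Proof.
move=> + d0; elim: rho b => [|k rho IH] b.
  move=> _ b0 _; rewrite muln0 mul0r.
  case: (boolP (injectiveb b)) => /injectiveP inj; last first.
    exact: (alternating_eq0 (alternating_sum predT d%:Z (@chi_alternating [::])) inj).
  (* Distinct nonnegative coordinates already have sum at least that of delta, so adding d
     overshoots. *)
  apply: big1 => j _; apply/eqP/negPn/negP => /chi_vsum.
  rewrite vsumD vsum_evec /= addr0; have := vsum_inj_ge inj b0; lia.
move=> /= /andP[k0 pr] b0 leM; have leM' : (sumn rho <= M)%N by lia.
(* The two orders differ only at coordinates b_i < k: removing k first leaves a negative coordinate
   and gives 0, but adding d at i beforehand may compensate. *)
have E : \sum_j chi (k :: rho) (b + evec j d%:Z) =
  (d * count_mem d rho)%:R * (\sum_i chi (rem d rho) (b - evec i k%:Z))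
  + \sum_(i | b i < k%:Z) chi rho (b + evec i (d%:Z - k%:Z)).
  under eq_bigr do rewrite chi_cons.
  rewrite exchange_big /= [X in _ + X]big_mkcond mulr_sumr -big_split /=.
  apply: eq_bigr => i _; case: ltP => bik.
    rewrite [X in _ * X](@chi_neg _ _ i) ?mulr0 ?add0r; last first.
    - by rewrite !vE eqxx; lia.
    - by apply/allP => x /mem_rem; apply/allP.
    rewrite (bigD1 i) //= big1 ?addr0.
      by congr chi; apply/ffunP => l; rewrite !vE; case: ifP; lia.
    move=> j ji; apply: (@chi_neg _ _ i) => //.
    by rewrite !vE eqxx eq_sym (negPf ji); lia.
  rewrite addr0 -IH //; first by apply: eq_bigr => j _; rewrite addrAC.
  by move=> l; rewrite !vE; case: ifP => [/eqP->|_]; [lia | rewrite subr0].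
rewrite E; case: (eqVneq k d) => [kd|kd].
  rewrite kd subrr [X in _ + X](eq_bigr (fun=> chi rho b)); last first.
    by move=> i _; congr (chi rho _); apply/ffunP => l; rewrite !vE; case: ifP; rewrite addr0.
  rewrite chi_boundary_eq //; last by rewrite -kd addnC.
  rewrite -chi_cons add1n mulnS natrD mulrDl addrC; congr (_ + _).
  case dr: (d \in rho); first by rewrite -chi_rem.
  by rewrite (count_memPn _) ?dr // muln0 !mul0r.
rewrite chi_boundary_neq // ?addr0; last by rewrite addnC.
by rewrite add0n chi_cons.
Qed.

End Vectors.

(** * Straightening *)

Lemma incr_ord_id n (f : 'I_n -> 'I_n) :
  {homo f : i j / (i < j)%N} -> f =1 id.
Proof.
move=> hf i.
have inj : injective f.
  move=> x y e; apply/val_inj; rewrite /=.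
  by case: (ltngtP x y) => // /hf; rewrite e ltnn.
have e : map f (enum 'I_n) = enum 'I_n.
  apply: (@sorted_eq _ (fun x y : 'I_n => x <= y)%N).
  - by move=> x y z; exact: leq_trans.
  - by move=> x y /anti_leq /val_inj.
  - rewrite sorted_map; apply: (@sub_sorted _ (fun x y : 'I_n => x < y)%N).
      by move=> x y /hf /ltnW.
    by have := iota_ltn_sorted 0 n; rewrite -val_enum_ord sorted_map.
  - by have := iota_sorted 0 n; rewrite -val_enum_ord sorted_map.
  - have um : uniq (map f (enum 'I_n)) by rewrite (map_inj_uniq inj) enum_uniq.
    apply: (uniq_perm um (enum_uniq _)) => x; rewrite mem_enum.
    by have := injF_onto inj x.
have := congr1 (fun s => nth i s i) e.
by rewrite (nth_map i) ?size_enum_ord // nth_ord_enum.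
Qed.

Lemma part_eq (l l' : seq nat) : is_part l -> is_part l' ->
  (forall i, nth 0%N l i = nth 0%N l' i) -> l = l'.
Proof.
move=> /andP[_ pl] /andP[_ pl'] e.
have le l1 l2 : all (fun x => 0 < x)%N l1 -> (forall i, nth 0%N l1 i = nth 0%N l2 i) ->
    (size l1 <= size l2)%N.
  move=> p1 e12; case: (leqP (size l1) (size l2)) => // lt.
  by have := allP p1 _ (mem_nth 0%N lt); rewrite e12 nth_default.
by apply: (@eq_from_nth _ 0%N) => //; apply/eqP; rewrite eqn_leq !le.
Qed.

Lemma part_size (l : seq nat) : is_part l -> (size l <= sumn l)%N.
Proof. by case/andP => _; elim: l => //= x l IH /andP[x0 /IH]; lia. Qed.

Lemma part_nth_mono (l : seq nat) i j : is_part l -> (i <= j)%N -> (nth 0%N l j <= nth 0%N l i)%N.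
Proof.
case/andP => sl _ ij; case: (ltnP j (size l)) => jl; last by rewrite nth_default.
have := sorted_leq_nth geq_trans leqnn 0%N sl; apply => //.
exact: leq_ltn_trans jl.
Qed.

Section Straightening.
Variable M : nat.
Notation vec := {ffun 'I_M -> int}.
Notation delta := (beta M [::]).
Implicit Types (b : vec) (lam al : seq nat).

Lemma beta_decr lam (i j : 'I_M) : is_part lam -> (i < j)%N -> beta M lam j < beta M lam i.
Proof.
move=> pl ij; rewrite !vE ltz_nat; have := part_nth_mono pl (ltnW ij); have := ltn_ord j; lia.
Qed.

Lemma beta_inj lam : is_part lam -> injective (beta M lam).
Proof.
move=> pl i j e; apply/val_inj => /=.
by case: (ltngtP i j) => // /(beta_decr pl); rewrite e ltxx.
Qed.

Lemma beta_ge0 lam i : 0 <= beta M lam i.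
Proof. by rewrite !vE. Qed.

Lemma decr_vperm_id (f g : vec) s :
  (forall i j : 'I_M, (i < j)%N -> f j < f i) ->
  (forall i j : 'I_M, (i < j)%N -> g j < g i) -> f = vperm g s -> s = 1%g.
Proof.
move=> df dg e; apply/permP => i; rewrite perm1; apply: (@incr_ord_id _ s) => j k jk.
have := df _ _ jk; rewrite e !ffunE => lt.
case: (ltngtP (s j) (s k)) => // [/dg gt|/val_inj eq].
  by have := lt_trans lt gt; rewrite ltxx.
by rewrite eq ltxx in lt.
Qed.

Lemma vperm_beta_uniq lam lam' s s' : is_part lam -> is_part lam' ->
  (size lam <= M)%N -> (size lam' <= M)%N ->
  vperm (beta M lam) s = vperm (beta M lam') s' -> lam = lam' /\ s = s'.
Proof.
move=> pl pl' sl sl' e.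
have e1 : beta M lam = vperm (beta M lam') (s^-1 * s')%g.
  by rewrite -vpermM -e vpermM mulVg vperm1.
have s1 := decr_vperm_id (fun i j => @beta_decr lam i j pl) (fun i j => @beta_decr lam' i j pl') e1.
split; last by rewrite -[s']mul1g -(mulgV s) -mulgA s1 mulg1.
apply: part_eq => // i; case: (ltnP i M) => iM; last by rewrite !nth_default //; lia.
have := congr1 (fun f : vec => f (Ordinal iM)) e1; rewrite s1 vperm1 !vE => -[] /=; lia.
Qed.

(** At most one pair (lam, s) satisfies the test. Summing over all pairs allows exchange with outer
    sums, and a general target group serves both [chi] and polynomial alternants. *)
Lemma straighten (R : zmodType) (F : vec -> R) b (n : nat) : alternating F ->
  (F b != 0 -> injective b) -> (F b != 0 -> forall i, 0 <= b i) ->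
  vsum b = vsum delta + n%:Z -> (n <= M)%N ->
  F b = \sum_(lam <- parts n) \sum_s
     (if b == vperm (beta M lam) s then F (beta M lam) *~ (-1) ^+ s else 0).
Proof.
move=> alt finj fpos vs nM.
have szM lam : lam \in parts n -> is_part lam /\ (size lam <= M)%N.
  by rewrite mem_parts => /andP[pl /eqP sl]; split=> //; have := part_size pl; lia.
case: (boolP (injectiveb b && [forall i, 0 <= b i])) => [/andP[/injectiveP inj /forallP b0]|nb].
  have [s0 [lam0 [pl0 sl0 eb]]] := beta_repr inj b0.
  have l0 : lam0 \in parts n.
    rewrite mem_parts pl0 /=; move: vs; rewrite eb vsum_perm [LHS]vsum_beta // addrC.
    by move/addrI => [->].
  have u lam s : lam \in parts n -> b = vperm (beta M lam) s -> lam = lam0 /\ s = s0.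
    move=> /szM[pl sl] e; apply: vperm_beta_uniq => //; by rewrite -e.
  rewrite (bigD1_seq lam0) ?uniq_parts //= [X in _ + X]big_seq_cond [X in _ + X]big1 ?addr0; last first.
    move=> lam /andP[/u ul ne]; rewrite big1 // => s _; case: eqP => // /ul[e _].
    by rewrite e eqxx in ne.
  rewrite (bigD1 s0) //= [X in _ + X]big1 ?addr0; last first.
    move=> s ne; case: eqP => // /(u _ _ l0)[_ e]; by rewrite e eqxx in ne.
  rewrite {1 2}eb eqxx alt; case: (odd_perm s0); by rewrite ?expr1 ?mulrN1z ?expr0 ?mulr1z.
have -> : F b = 0.
  apply/eqP; apply: contraNT nb => h; apply/andP; split; first exact/injectiveP/finj.
  by apply/forallP; exact: fpos.
rewrite big_seq big1 // => lam /szM[pl sl]; rewrite big1 // => s _; case: eqP => // e.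
case/negP: nb; rewrite e; apply/andP; split; last by apply/forallP => i; rewrite vpermE beta_ge0.
by apply/injectiveP => i j; rewrite !vpermE => /(beta_inj pl)/perm_inj.
Qed.

Definition strip_sum lam al (d : nat) : rat :=
  \sum_s \sum_i (if beta M lam - evec i d%:Z == vperm (beta M al) s then (-1) ^+ odd_perm s else 0).

Lemma sum_down rho lam (d n : nat) : all (ltn 0) rho -> (size lam <= M)%N ->
  sumn lam = (n + d)%N -> (n <= M)%N ->
  \sum_i chi rho (beta M lam - evec i d%:Z) =
  \sum_(al <- parts n) strip_sum lam al d * chi rho (beta M al).
Proof.
move=> pr sl sm nM.
transitivity (\sum_i \sum_(al <- parts n) \sum_s
   (if beta M lam - evec i d%:Z == vperm (beta M al) s then (-1) ^+ odd_perm s else 0) * chi rho (beta M al)).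
  apply: eq_bigr => i _; rewrite (@straighten _ (chi rho) _ n) //.
  - apply: eq_bigr => al _; apply: eq_bigr => s _; case: ifP => _; rewrite ?mul0r //.
    by case: (odd_perm s); rewrite ?expr1 ?mulrN1z ?mulN1r ?expr0 ?mulr1z ?mul1r.
  - exact: chi_alternating.
  - exact: chi_injective.
  - by move=> h j; apply: chi_ge0 h.
  - by rewrite vsumD vsumN vsum_evec vsum_beta // sm; lia.
rewrite exchange_big; apply: eq_bigr => al _; rewrite /strip_sum exchange_big mulr_suml.
by apply: eq_bigr => i _; rewrite mulr_suml.
Qed.

Lemma sum_up rho al (d n : nat) : all (ltn 0) rho -> (size al <= M)%N ->
  (sumn al + d)%N = n -> (n <= M)%N ->
  \sum_j chi rho (beta M al + evec j d%:Z) =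
  \sum_(nu <- parts n) strip_sum nu al d * chi rho (beta M nu).
Proof.
move=> pr sl sm nM.
transitivity (\sum_j \sum_(nu <- parts n) \sum_s
   (if beta M al + evec j d%:Z == vperm (beta M nu) s then (-1) ^+ odd_perm s else 0) * chi rho (beta M nu)).
  apply: eq_bigr => i _; rewrite (@straighten _ (chi rho) _ n) //.
  - apply: eq_bigr => nu _; apply: eq_bigr => s _; case: ifP => _; rewrite ?mul0r //.
    by case: (odd_perm s); rewrite ?expr1 ?mulrN1z ?mulN1r ?expr0 ?mulr1z ?mul1r.
  - exact: chi_alternating.
  - exact: chi_injective.
  - by move=> h j; apply: chi_ge0 h.
  - by rewrite vsumD vsum_evec vsum_beta // -sm; lia.
rewrite exchange_big; apply: eq_bigr => nu _; rewrite /strip_sum mulr_suml exchange_big /=.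
(* Inverting the permutation and relabelling the coordinate turns adding d to al + delta into
   subtracting d from nu + delta, with the same sign. *)
rewrite (reindex_inj invg_inj) /=; apply: eq_bigr => s _; rewrite mulr_suml odd_permV.
rewrite [RHS](reindex_inj (@perm_inj _ (s^-1)%g)); apply: eq_bigr => j _ /=; congr (_ * _).
congr (if _ then _ else _).
rewrite -(inj_eq (@vperm_inj _ s)) vpermD vpermM mulgV vperm1 eq_sym.
rewrite -{1}(permKV s j) vperm_evec subr_eq addrC //.
Qed.

End Straightening.

(** * Border strips *)

Section Strips.
Implicit Types (mu rho : seq nat) (a b d i : nat).

(* mu/rho is a border strip of size d occupying the rows a, ..., b. *)
Definition strip mu rho d a b : bool :=
  [&& (a <= b)%N, (nth 0 mu a + b == nth 0 rho b + a + d)%N,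
      all (fun i => nth 0 mu i == nth 0 rho i)%N (iota 0 a),
      all (fun i => nth 0 mu i.+1 == (nth 0 rho i).+1)%N (iota a (b - a)) &
      all (fun i => nth 0 mu i == nth 0 rho i)%N (iota b.+1 (size mu + size rho))].

Lemma stripP mu rho d a b : reflect
  [/\ (a <= b)%N, (nth 0 mu a + b = nth 0 rho b + a + d)%N,
      forall i, (i < a)%N -> nth 0%N mu i = nth 0%N rho i,
      forall i, (a <= i < b)%N -> nth 0%N mu i.+1 = (nth 0 rho i).+1%N &
      forall i, (b < i)%N -> nth 0%N mu i = nth 0%N rho i] (strip mu rho d a b).
Proof.
apply: (iffP and5P) => [[ab /eqP e /allP h1 /allP h2 /allP h3]|[ab e h1 h2 h3]].
  split=> // i ih.
  - by apply/eqP/h1; rewrite mem_iota.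
  - by apply/eqP/h2; rewrite mem_iota; lia.
  - case: (ltnP i (b.+1 + (size mu + size rho))) => ib.
      by apply/eqP/h3; rewrite mem_iota ih.
    by rewrite !nth_default //; lia.
split=> //; first by rewrite e.
- by apply/allP => i; rewrite mem_iota => ih; rewrite h1.
- by apply/allP => i; rewrite mem_iota => ih; rewrite h2 //; lia.
- by apply/allP => i; rewrite mem_iota => /andP[ih _]; rewrite h3.
Qed.

Lemma strip_lt mu rho d a b : is_part mu -> is_part rho -> (0 < d)%N -> strip mu rho d a b ->
  forall i, (nth 0 rho i < nth 0 mu i)%N = (a <= i <= b)%N.
Proof.
move=> pm pr d0 /stripP[ab e h1 h2 h3] i.
case: (ltnP i a) => ia /=; first by rewrite h1 // ltnn.
case: (leqP i b) => ib; last by rewrite h3 // ltnn.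
case: (ltngtP i a) ia => // [ai _|-> _]; last first.
  case: (ltngtP a b) ab => // [ab _|eab _]; last by rewrite eab in e *; lia.
  have := h2 a; rewrite leqnn ab => /(_ isT).
  have := part_nth_mono pm (leqnSn a); lia.
have := h2 i.-1; rewrite (_ : (a <= i.-1 < b)%N) => [/(_ isT)|]; last by lia.
by rewrite prednK //; [have := part_nth_mono pr (leq_pred i); lia | lia].
Qed.

Lemma strip_uniq mu rho d a b a' b' : is_part mu -> is_part rho -> (0 < d)%N ->
  strip mu rho d a b -> strip mu rho d a' b' -> a = a' /\ b = b'.
Proof.
move=> pm pr d0 s s'; have l := strip_lt pm pr d0 s; have l' := strip_lt pm pr d0 s'.
have [ab _ _ _ _] := stripP _ _ _ _ _ s; have [ab' _ _ _ _] := stripP _ _ _ _ _ s'.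
have ea := l a; have eb := l b; have ea' := l' a'; have eb' := l' b'.
move: ea eb ea' eb'; rewrite !leqnn ab ab' /= => ea eb ea' eb'.
by move: ea eb ea' eb'; rewrite l' l' l l; lia.
Qed.

Lemma strip_size mu rho d a b : is_part mu -> is_part rho -> (0 < d)%N -> strip mu rho d a b -> (b < size mu)%N.
Proof.
move=> pm pr d0 s; have [ab _ _ _ _] := stripP _ _ _ _ _ s.
have := strip_lt pm pr d0 s b; rewrite ab leqnn; case: (ltnP b (size mu)) => // h.
by rewrite [nth 0%N mu b]nth_default.
Qed.

(** The relation mu_(i+1) = rho_i + 1 makes the row lengths telescope. *)
Lemma strip_cells mu rho a b L : (b < L)%N -> (a <= b)%N ->
  (forall i, (nth 0 rho i <= nth 0 mu i)%N) ->
  (forall i, (i < a)%N -> nth 0%N mu i = nth 0%N rho i) ->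
  (forall i, (a <= i < b)%N -> nth 0%N mu i.+1 = (nth 0 rho i).+1%N) ->
  (forall i, (b < i)%N -> nth 0%N mu i = nth 0%N rho i) ->
  (\sum_(0 <= i < L) (nth 0 mu i - nth 0 rho i) + nth 0 rho b + a = nth 0 mu a + b)%N.
Proof.
move=> bL ab le h1 h2 h3.
rewrite (big_cat_nat (n := b.+1)) //= [X in (_ + X + _ + _)%N]big_nat_cond [X in (_ + X + _ + _)%N]big1 ?addn0; last first.
  by move=> i /andP[/andP[bi _] _]; rewrite h3 // subnn.
have S k : (a <= k <= b)%N ->
    (\sum_(0 <= i < k.+1) (nth 0 mu i - nth 0 rho i) + nth 0 rho k + a = nth 0 mu a + k)%N.
  elim: k => [|k IH] akb.
    rewrite big_nat1; have -> : a = 0%N by lia.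
    by have := le 0%N; lia.
  rewrite big_nat_recr //=; case: (ltngtP a k.+1) => // [ak| |ak]; last first.
  - rewrite big_nat_cond big1 ?add0n; first by have := le k.+1; rewrite ak; lia.
    by move=> i /andP[/andP[_ ik] _]; rewrite h1 ?subnn //; lia.
  - by lia.
  have := IH; have := h2 k; have := le k.+1; lia.
by apply: S; rewrite ab leqnn.
Qed.

Lemma mem_skew_cells mu rho i j :
  ((i, j) \in skew_cells mu rho) = (nth 0 rho i <= j < nth 0 mu i)%N.
Proof.
apply/allpairsPdep/idP => [[i' [j' [_ + [-> ->]]]]|h].
  by rewrite mem_iota; lia.
exists i, j; rewrite !mem_iota; split=> //; last by lia.
by case: (ltnP i (size mu)) => //= s; move: h; rewrite [nth 0%N mu i]nth_default //; lia.
Qed.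

Lemma size_skew_cells mu rho :
  size (skew_cells mu rho) = (\sum_(0 <= i < size mu) (nth 0 mu i - nth 0 rho i))%N.
Proof.
rewrite size_allpairs_dep sumnE big_map /index_iota subn0.
by apply: eq_bigr => i _; rewrite size_iota.
Qed.

Lemma adjc_sym : symmetric adjc.
Proof. by move=> [i j] [i' j']; rewrite /adjc /= ![i == _]eq_sym ![j == _]eq_sym orbC [X in _ && X || _]orbC [X in _ || _ && X]orbC orbC. Qed.

(** From any cell, walking left to the start of its row and then down leads to the first cell of row
    b. Consecutive rows share only one column, so no 2x2 square fits. *)
Lemma strip_border mu rho d a b : is_part mu -> is_part rho -> (0 < d)%N ->
  strip mu rho d a b -> border_strip mu rho d.
Proof.
move=> pm pr d0 s; have lt := strip_lt pm pr d0 s; have bs := strip_size pm pr d0 s.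
have /stripP[ab e h1 h2 h3] := s.
have le i : (nth 0 rho i <= nth 0 mu i)%N.
  case: (ltnP i a) => ia; first by rewrite h1.
  by case: (leqP i b) => ib; [apply: ltnW; rewrite lt ia | rewrite h3].
apply/and4P; split.
- apply/andP; split; last by apply/allP.
  case: (leqP (size rho) (size mu)) => // h; case/andP: pr => _ /allP /(_ _ (mem_nth 0%N h)) /=.
  by have := le (size mu); rewrite [nth 0%N mu _]nth_default //; lia.
- rewrite size_skew_cells; have := strip_cells bs ab le h1 h2 h3; rewrite e; lia.
- set S := skew_cells mu rho; set E := (fun x y : seq_sub S => adjc (ssval x) (ssval y)).
  have symE : connect_sym E by apply: sym_connect_sym => x y; exact: adjc_sym.
  have b0 : (b, nth 0%N rho b) \in S by rewrite mem_skew_cells leqnn lt ab leqnn.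
  suff base x : connect E x (SeqSub b0).
    by apply/forallP => x; apply/forallP => y; rewrite (connect_trans (base x)) // symE base.
  case: x => -[i j] xS.
  have [m im] : exists m, (b - i <= m)%N by exists (b - i)%N.
  have [n jn] : exists n, (j - nth 0 rho i <= n)%N by exists (j - nth 0 rho i)%N.
  elim: m n i j xS im jn => [|m IHm] n; elim: n => [|n IHn] i j xS im jn;
    have := xS; rewrite mem_skew_cells => ij;
    have := lt i; (have -> : (nth 0 rho i < nth 0 mu i)%N by lia); move=> /esym iab.
  + have ei : i = b by lia.
    move: xS ij jn; rewrite ei => xS ij jn; have ej : j = nth 0%N rho b by lia.
    move: xS; rewrite ej => xS; rewrite (_ : SeqSub xS = SeqSub b0) ?connect0 //.
    exact: val_inj.
  + case: (ltngtP j (nth 0%N rho i)) => [|jr|jr]; first by lia.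
      have yS : (i, j.-1) \in S by rewrite mem_skew_cells; lia.
      apply: connect_trans (IHn i j.-1 yS im _); last by lia.
      by apply: connect1; rewrite /E /adjc /= eqxx; apply/orP; left; apply/orP; left; lia.
    by apply: IHn => //; lia.
  (* The first cell of row i lies directly above the last cell of row i+1. *)
  + case: (ltngtP i b) => [ib| |ei]; [|lia|].
      have ej : j = nth 0%N rho i by lia.
      have yS : (i.+1, j) \in S.
        by rewrite mem_skew_cells h2 ?ej; [have := part_nth_mono pr (leqnSn i); lia | lia].
      apply: connect_trans (IHm (j - nth 0 rho i.+1)%N i.+1 j yS _ (leqnn _)); last by lia.
      by apply: connect1; rewrite /E /adjc /= !eqxx orbT /= orbT.
    by apply: (IHm 0%N); lia.
  + case: (ltngtP j (nth 0%N rho i)) => [|jr|jr]; first by lia.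
      have yS : (i, j.-1) \in S by rewrite mem_skew_cells; lia.
      apply: connect_trans (IHn i j.-1 yS im _); last by lia.
      by apply: connect1; rewrite /E /adjc /= eqxx; apply/orP; left; apply/orP; left; lia.
    by apply: IHn => //; lia.
- apply/hasPn => -[i j] /=; rewrite !mem_skew_cells => ij; apply/negP => /and3P[h4 h5 h6].
  have := lt i; have := lt i.+1.
  have -> : (nth 0 rho i.+1 < nth 0 mu i.+1)%N by lia.
  have -> : (nth 0 rho i < nth 0 mu i)%N by lia.
  have := h2 i; lia.
Qed.

(** Let a and b be the first and last nonempty rows. Connectedness makes consecutive rows share a
    column, and the absence of 2x2 squares makes them share just one. *)
Lemma border_strip_exists mu rho d : is_part mu -> is_part rho -> (0 < d)%N ->
  border_strip mu rho d -> exists a b, strip mu rho d a b.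
Proof.
move=> pm pr d0 /and4P[/andP[sz /allP sub] /eqP sd conn no2].
have le i : (nth 0 rho i <= nth 0 mu i)%N.
  case: (ltnP i (size rho)) => ir; last by rewrite nth_default.
  by apply: sub; rewrite mem_iota.
pose P i := (nth 0 rho i < nth 0 mu i)%N.
have exP : exists i, P i.
  have : (0 < size (skew_cells mu rho))%N by rewrite sd.
  case E : (skew_cells mu rho) => [|[i j] s] // _.
  have : (i, j) \in skew_cells mu rho by rewrite E mem_head.
  by rewrite mem_skew_cells => h; exists i; rewrite /P; lia.
have bdP i : P i -> (i <= size mu)%N.
  by rewrite /P; case: (leqP i (size mu)) => // h; rewrite [nth 0%N mu i]nth_default //; lia.
case: (ex_minnP exP) => a Pa mina; case: (ex_maxnP exP bdP) => b Pb maxb.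
have ab : (a <= b)%N by exact: mina.
have h1 i : (i < a)%N -> nth 0%N mu i = nth 0%N rho i.
  by move=> ia; apply/eqP; rewrite eqn_leq le andbT leqNgt; apply/negP => /mina; lia.
have h3 i : (b < i)%N -> nth 0%N mu i = nth 0%N rho i.
  by move=> ia; apply/eqP; rewrite eqn_leq le andbT leqNgt; apply/negP => /maxb; lia.
have h2 i : (a <= i < b)%N -> nth 0%N mu i.+1 = (nth 0 rho i).+1%N.
  move=> /andP[ai ib]; have mi := part_nth_mono pm (leqnSn i); have ri := part_nth_mono pr (leqnSn i).
  have low : (nth 0 rho i < nth 0 mu i.+1)%N.
    case: (ltnP (nth 0%N rho i) (nth 0%N mu i.+1)) => // gap.
    have aS : (a, nth 0%N rho a) \in skew_cells mu rho by rewrite mem_skew_cells leqnn.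
    have bS : (b, nth 0%N rho b) \in skew_cells mu rho by rewrite mem_skew_cells leqnn.
    have /forallP/(_ (SeqSub aS))/forallP/(_ (SeqSub bS)) := conn.
    set S := skew_cells mu rho in aS bS *; set E := (fun x y : seq_sub S => adjc (ssval x) (ssval y)).
    have symE : connect_sym E by apply: sym_connect_sym => x y; exact: adjc_sym.
    (* Rows i and i+1 share no column, so adjacency cannot leave the rows up to i. *)
    have cl : closed E [pred c : seq_sub S | ((ssval c).1 <= i)%N].
      apply: (intro_closed symE) => -[[i1 j1] S1] [[i2 j2] S2]; rewrite /E !inE /adjc /=.
      move: S1 S2; rewrite !mem_skew_cells => S1 S2 adj i1i; case: (leqP i2 i) => // ii2.
      have e1 : i1 = i by case/orP: adj => /andP[/eqP ? /orP[]/eqP ?]; lia.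
      have e2 : i2 = i.+1 by case/orP: adj => /andP[/eqP ? /orP[]/eqP ?]; lia.
      have e3 : j1 = j2 by case/orP: adj => /andP[/eqP ? /orP[]/eqP ?]; lia.
      by move: S1 S2; rewrite e1 e2 e3; lia.
    by move=> /(closed_connect cl); rewrite !inE /= ai leqNgt ib.
  apply/eqP; rewrite eqn_leq low andbT leqNgt; apply/negP => high.
  case/hasP: no2; exists (i, nth 0%N rho i); rewrite /= !mem_skew_cells; lia.
exists a, b; apply/stripP; split=> //.
have bs : (b < size mu)%N.
  by case: (ltnP b (size mu)) => // h; move: Pb; rewrite /P [nth 0%N mu b]nth_default.
by have := strip_cells bs ab le h1 h2 h3; rewrite -size_skew_cells sd; lia.
Qed.

Lemma strip_skew_ht mu rho d a b : is_part mu -> is_part rho -> (0 < d)%N ->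
  strip mu rho d a b -> skew_ht mu rho = (b - a)%N.
Proof.
move=> pm pr d0 s; have bs := strip_size pm pr d0 s; have /stripP[ab _ _ _ _] := s.
rewrite /skew_ht (eq_count (strip_lt pm pr d0 s)) -size_filter.
rewrite (perm_size (_ : perm_eq _ (iota a (b.+1 - a)))); first by rewrite size_iota; lia.
apply: uniq_perm; rewrite ?filter_uniq ?iota_uniq // => i.
by rewrite mem_filter !mem_iota; lia.
Qed.

End Strips.

Section StripSum.
Variable m : nat.
Notation M := m.+1.
Notation vec := {ffun 'I_M -> int}.

(** [lift_perm a b 1] sends a to b and keeps the order of the other indices. It sorts the vector
    after entry a has dropped by d to position b; the entries passed over move up one place, which
    is the relation lam_(i+1) = al_i + 1. *)
Lemma vperm_lift_strip lam al (d : nat) (a b : 'I_M) :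
  is_part lam -> is_part al -> (size lam <= M)%N -> (size al <= M)%N -> (0 < d)%N ->
  (beta M lam - evec a d%:Z == vperm (beta M al) (lift_perm a b 1)) = strip lam al d a b.
Proof.
move=> pl pa sl sa d0; have bM := ltn_ord b; have aM := ltn_ord a.
apply/eqP/stripP => [e|[ab e h1 h2 h3]].
  have ea : (nth 0 lam a + (M - a.+1) = nth 0 al b + (M - b.+1) + d)%N.
    have := congr1 (fun f : vec => f a) e; rewrite !vE eqxx lift_perm_id; lia.
  have el (k : 'I_m) : (nth 0 lam (bump a k) + (M - (bump a k).+1) =
      nth 0 al (bump b k) + (M - (bump b k).+1))%N.
    have := congr1 (fun f : vec => f (lift a k)) e; rewrite !vE lift_perm_lift perm1.
    by rewrite eq_sym (negPf (neq_lift _ _)) subr0 => -[].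
  have ab : (a <= b)%N.
    rewrite leqNgt; apply/negP => ba.
    have bm : (b < m)%N by lia.
    have := el (Ordinal bm); rewrite /bump /= leqnn (_ : (a <= b)%N = false) /= ?add0n ?add1n; last by lia.
    have := part_nth_mono pa (leqnSn b); have := part_nth_mono pl (ltnW ba); lia.
  split=> //; first by lia.
  - move=> i ia; have im : (i < m)%N by lia.
    have e1 : (a <= i)%N = false by lia.
    have e2 : (b <= i)%N = false by lia.
    have := el (Ordinal im); rewrite /bump /= e1 e2 /= ?add0n; lia.
  - move=> i /andP[ai ib]; have im : (i < m)%N by lia.
    have e2 : (b <= i)%N = false by lia.
    have := el (Ordinal im); rewrite /bump /= ai e2 /= ?add0n ?add1n; lia.
  - move=> i bi; case: (ltnP i M) => iM; last by rewrite !nth_default //; lia.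
    have im : (i.-1 < m)%N by lia.
    have e1 : (a <= i.-1)%N by lia.
    have e2 : (b <= i.-1)%N by lia.
    have := el (Ordinal im); rewrite /bump /= e1 e2 /= ?add1n prednK; lia.
apply/ffunP => i; rewrite !vE; case: (unliftP a i) => [k ->|->]; last first.
  by rewrite eqxx lift_perm_id; lia.
rewrite eq_sym (negPf (neq_lift _ _)) subr0 lift_perm_lift perm1 /= /bump; congr Posz.
have km := ltn_ord k.
case: (leqP a k) => ak; case: (leqP b k) => bk /=; rewrite ?add0n ?add1n.
- by rewrite h3 //; lia.
- by have := h2 k; rewrite ak bk => /(_ isT) ->; rewrite addSnnS subnSK //; exact: leq_ltn_trans bk bM.
- by lia.
- by rewrite h1 //; lia.
Qed.

(** Away from a both sides come from strictly decreasing vectors, so s preserves order there and is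
    determined by s(a). *)
Lemma vperm_is_lift lam al (d : nat) (a : 'I_M) s : is_part lam -> is_part al ->
  beta M lam - evec a d%:Z = vperm (beta M al) s -> s = lift_perm a (s a) 1.
Proof.
move=> pl pa e.
have el (k : 'I_m) : beta M lam (lift a k) = beta M al (s (lift a k)).
  have := congr1 (fun f : vec => f (lift a k)) e; rewrite !vE.
  by rewrite eq_sym (negPf (neq_lift _ _)) subr0.
have ne (k : 'I_m) : s a != s (lift a k) by rewrite (inj_eq perm_inj) neq_lift.
pose f (k : 'I_m) := odflt k (unlift (s a) (s (lift a k))).
have fE k : lift (s a) (f k) = s (lift a k).
  by rewrite /f; case: unliftP (ne k) => [k' -> //|->]; rewrite eqxx.
have fid : f =1 id.
  apply: incr_ord_id => j k jk.
  have lt : (lift a j < lift a k)%N by rewrite ltnNge leq_bump2 -ltnNge.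
  have := beta_decr pl lt; rewrite !el -!fE.
  case: (ltngtP (f j) (f k)) => // [kj|/val_inj ->]; last by rewrite ltxx.
  have lt' : (lift (s a) (f k) < lift (s a) (f j))%N by rewrite ltnNge leq_bump2 -ltnNge.
  by move=> /lt_trans/(_ (beta_decr pa lt')); rewrite ltxx.
apply/permP => i; case: (unliftP a i) => [k ->|->]; last by rewrite lift_perm_id.
by rewrite lift_perm_lift perm1 -fE fid.
Qed.

(** A strip in rows a to b has a unique sorting permutation, of sign (-1)^(a+b), and height b - a of
    the same parity. *)
Lemma strip_sumE lam al (d : nat) : is_part lam -> is_part al ->
  (size lam <= M)%N -> (size al <= M)%N -> (0 < d)%N ->
  strip_sum M lam al d =
  if border_strip lam al d then (-1) ^+ skew_ht lam al else 0.
Proof.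
move=> pl pa sl sa d0.
have -> : strip_sum M lam al d =
    \sum_(a < M) \sum_(b < M) (if strip lam al d a b then (-1) ^+ (a + b) else 0).
  rewrite /strip_sum exchange_big; apply: eq_bigr => a _ /=.
  transitivity (\sum_s \sum_(b < M) (if s == lift_perm a b 1 then
     (if strip lam al d a b then (-1) ^+ (a + b) else 0) else 0 : rat)).
    apply: eq_bigr => s _; case: eqP => [e|ne].
      have es := vperm_is_lift pl pa e.
      rewrite (bigD1 (s a)) //= -es eqxx [X in _ + X]big1 ?addr0; last first.
        move=> b bs; case: eqP => // eb; case/eqP: bs.
        by rewrite eb lift_perm_id.
      rewrite -vperm_lift_strip // -es e eqxx es odd_lift_perm odd_perm1 addbF.
      by rewrite lift_perm_id signr_addb !signr_odd exprD.
    rewrite big1 // => b _; case: eqP => // es; case: ifP => //.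
    by rewrite -vperm_lift_strip // -es => /eqP.
  rewrite exchange_big; apply: eq_bigr => b _ /=.
  by rewrite (bigD1 (lift_perm a b 1)) //= eqxx big1 ?addr0 // => s /negPf ->.
case: ifP => [/(border_strip_exists pl pa d0)[a [b s]]|nb].
  have bM := leq_trans (strip_size pl pa d0 s) sl; have /stripP[ab _ _ _ _] := s.
  have aM := leq_ltn_trans ab bM.
  rewrite (bigD1 (Ordinal aM)) //= [X in _ + X]big1 ?addr0; last first.
    move=> a' ne; rewrite big1 // => b' _; case: ifP => // s'.
    by have [e _] := strip_uniq pl pa d0 s s'; case/eqP: ne; apply: val_inj.
  rewrite (bigD1 (Ordinal bM)) //= s [X in _ + X]big1 ?addr0; last first.
    move=> b' ne; case: ifP => // s'.
    by have [_ e] := strip_uniq pl pa d0 s s'; case/eqP: ne; apply: val_inj.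
  rewrite (strip_skew_ht pl pa d0 s) -signr_odd -[RHS]signr_odd; congr (_ ^+ _).
  by rewrite oddB // oddD addbC.
rewrite big1 // => a _; rewrite big1 // => b _; case: ifP => // s.
by rewrite (strip_border pl pa d0 s) in nb.
Qed.

End StripSum.

Lemma is_part_pad r lam : is_part lam -> (2 * sumn lam < r)%N -> is_part (pad r lam).
Proof.
by move=> pl h; rewrite /pad is_part_cons pl andbT; have := sumn_head lam; lia.
Qed.

(** The first row is too long to be joined to the second. So the strip lies in row 0 alone, forcing
    lam = al, or entirely below it, forcing |lam| = |al| + d; neither case depends on r. *)
Lemma strip_pad r r' lam al d a b : is_part lam -> is_part al ->
  (sumn lam + sumn al + d < r)%N -> (sumn lam + sumn al + d < r')%N ->
  strip (pad r lam) (pad (r - d) al) d a b -> strip (pad r' lam) (pad (r' - d) al) d a b.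
Proof.
move=> pl pa hr hr' /stripP[ab e h1 h2 h3]; rewrite /pad.
case: a ab e h1 h2 => [|a] ab e h1 h2.
  case: b ab e h2 h3 => [|b] ab e h2 h3; last first.
    have := h2 0%N isT; rewrite /= nth0; have := sumn_head lam; lia.
  have ela : lam = al by apply: part_eq => // i; apply: (h3 i.+1).
  by rewrite ela in hr hr' *; apply/stripP; split=> //= [|[|i] //]; lia.
have s0 : sumn lam = (sumn al + d)%N by have := h1 0%N isT; rewrite /=; lia.
case: b ab e h2 h3 => [|b] // ab e h2 h3.
apply/stripP; split => //.
- by case=> [|i] ia /=; [lia | apply: (h1 i.+1)].
- case=> [|i] // ia /=; exact: (h2 i.+1).
- case=> [|i] // ia /=; exact: (h3 i.+1).
Qed.

Lemma bstripE r d lam al : is_part lam -> is_part al -> (0 < d)%N ->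
  (2 * (sumn lam + sumn al + d) < r)%N ->
  bstrip d lam al = border_strip (pad r lam) (pad (r - d) al) d /\
  (bstrip d lam al -> bht d lam al = skew_ht (pad r lam) (pad (r - d) al)).
Proof.
move=> pl pa d0 hr; rewrite /bstrip /bht; set r0 := rbig d lam al.
have hr0 : (2 * (sumn lam + sumn al + d) < r0)%N by rewrite /r0 /rbig; lia.
have p1 r1 : (2 * (sumn lam + sumn al + d) < r1)%N -> is_part (pad r1 lam).
  by move=> h; apply: is_part_pad => //; lia.
have p2 r1 : (2 * (sumn lam + sumn al + d) < r1)%N -> is_part (pad (r1 - d) al).
  by move=> h; apply: is_part_pad => //; lia.
have tr r1 r2 a b : (2 * (sumn lam + sumn al + d) < r1)%N -> (2 * (sumn lam + sumn al + d) < r2)%N ->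
    strip (pad r1 lam) (pad (r1 - d) al) d a b -> strip (pad r2 lam) (pad (r2 - d) al) d a b.
  by move=> h1 h2; apply: strip_pad => //; lia.
split.
  apply/idP/idP.
    move=> /(border_strip_exists (p1 _ hr0) (p2 _ hr0) d0)[a [b s]].
    exact: (strip_border (p1 _ hr) (p2 _ hr) d0 (tr _ _ _ _ hr0 hr s)).
  move=> /(border_strip_exists (p1 _ hr) (p2 _ hr) d0)[a [b s]].
  exact: (strip_border (p1 _ hr0) (p2 _ hr0) d0 (tr _ _ _ _ hr hr0 s)).
move=> /(border_strip_exists (p1 _ hr0) (p2 _ hr0) d0)[a [b s]].
rewrite (strip_skew_ht (p1 _ hr0) (p2 _ hr0) d0 s).
by rewrite (strip_skew_ht (p1 _ hr) (p2 _ hr) d0 (tr _ _ _ _ hr0 hr s)).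
Qed.

(** * Kostka numbers *)

(** Shapes left after removing a horizontal strip, kept at the same length so that emptied rows
    persist as zeros. *)
Fixpoint hstrips (s : seq nat) : seq (seq nat) :=
  if s is a :: s' then
    [seq b :: t | b <- iota (head 0%N s') (a - head 0 s').+1, t <- hstrips s']
  else [:: [::]].

Lemma sorted_geq_nth (s : seq nat) i j : sorted geq s -> (i <= j)%N -> (nth 0 s j <= nth 0 s i)%N.
Proof.
move=> ss ij; case: (ltnP j (size s)) => js; last by rewrite nth_default.
by apply: (sorted_leq_nth geq_trans leqnn 0%N ss) => //; exact: leq_ltn_trans js.
Qed.

Lemma mem_hstrips sh k : sorted geq sh -> (k \in hstrips sh) <->
  size k = size sh /\ (forall i, nth 0 sh i.+1 <= nth 0 k i <= nth 0 sh i)%N.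
Proof.
elim: sh k => [|a s IH] k ss.
  rewrite inE; split=> [/eqP-> |[/size0nil -> //]]; by split=> // i; rewrite !nth_nil.
have sa : (head 0 s <= a)%N by case: s {IH} ss => //= b s /andP[].
have := IH _ (path_sorted ss) => {}IH; split.
  move/allpairsP => [[b t] [hb /IH[st ht] ->]]; split; first by rewrite /= st.
  move: hb; rewrite mem_iota => hb; case=> [|i] /=; last exact: ht.
  by move: hb; rewrite nth0 /= addnS ltnS subnKC.
case: k => [|b t] [sz ht] //; move: sz => [st]; apply/allpairsP; exists (b, t); split=> //.
  by rewrite mem_iota addnS ltnS subnKC //; have := ht 0%N; rewrite /= nth0.
by apply/IH; split=> // i; exact: (ht i.+1).
Qed.

Lemma uniq_hstrips sh : uniq (hstrips sh).
Proof.
elim: sh => // a s IH; apply: allpairs_uniq; rewrite ?iota_uniq //.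
by move=> [? ?] [? ?] _ _ /= [-> ->].
Qed.

Lemma hstrips_sorted sh k : sorted geq sh -> k \in hstrips sh -> sorted geq k.
Proof.
move=> ss /(mem_hstrips _ ss)[sk hk]; apply/(sortedP 0%N) => i ik /=.
by have := hk i; have := hk i.+1; lia.
Qed.

Lemma count_iota_prefix (P : pred nat) n : (forall i j, (i <= j)%N -> (j < n)%N -> P j -> P i) ->
  forall j, (j < n)%N -> P j = (j < count P (iota 0 n))%N.
Proof.
elim: n => // n IH h j; rewrite ltnS => jn.
have -> : iota 0 n.+1 = iota 0 n ++ [:: n] by rewrite -addn1 iotaD.
rewrite count_cat /= addn0.
have {}IH := IH (fun i j ij jn => h i j ij (ltnW jn)).
have cn := count_size P (iota 0 n); rewrite size_iota in cn.
case Pn : (P n) => /=.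
  have -> : count P (iota 0 n) = n.
    apply/eqP; rewrite -[X in _ == X](size_iota 0) -all_count; apply/allP => i.
    by rewrite mem_iota => /andP[_ ii]; apply: (h i n) => //; lia.
  by rewrite (h j n) // addn1 ltnS jn.
rewrite addn0; case: (ltngtP j n) jn => // [jn _|-> _]; first exact: IH.
by rewrite Pn ltnNge cn.
Qed.

Section Tableaux.
Implicit Types (sh ct : seq nat) (g : nat -> nat -> nat).

Definition weight sh g v : nat :=
  (\sum_(i < size sh) count (fun j => g i j == v) (iota 0 (nth 0 sh i)))%N.

(** Semistandard fillings as functions on all pairs, zero outside the shape: fillings of different
    shapes then share one type, unlike the finite functions in [ssyt_set]. *)
Definition tab sh ct g : Prop :=
  [/\ forall i j, (j < nth 0 sh i)%N = (0 < g i j)%N,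
      forall i j j', (j <= j')%N -> (j' < nth 0 sh i)%N -> (g i j <= g i j')%N,
      forall i i' j, (i < i')%N -> (j < nth 0 sh i')%N -> (g i j < g i' j)%N,
      forall i j, (g i j <= size ct)%N &
      forall v, (v < size ct)%N -> weight sh g v.+1 = nth 0%N ct v].

Definition ofun R C L (f : {ffun 'I_R * 'I_C -> 'I_L}) (i j : nat) : nat :=
  if insub i is Some i' then if insub j is Some j' then f (i', j') else 0%N else 0%N.

Definition mkfun R C L g : {ffun 'I_R * 'I_C -> 'I_L.+1} := [ffun x : 'I_R * 'I_C => inord (g x.1 x.2)].

Lemma ofunE R C L (f : {ffun 'I_R * 'I_C -> 'I_L}) (x : 'I_R * 'I_C) :
  ofun f x.1 x.2 = f x.
Proof. by rewrite /ofun !valK; case: x. Qed.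

Lemma ofun_out R C L (f : {ffun 'I_R * 'I_C -> 'I_L}) i j :
  ~~ ((i < R) && (j < C))%N -> ofun f i j = 0%N.
Proof.
rewrite /ofun; case: insubP => [i' iR _|//]; case: insubP => [j' jC _|//].
by rewrite iR jC.
Qed.

Lemma ofun_mkfun R C L g : (forall i j, g i j <= L)%N ->
  (forall i j, ~~ ((i < R) && (j < C))%N -> g i j = 0%N) ->
  forall i j, ofun (mkfun R C L g) i j = g i j.
Proof.
move=> gL g0 i j; case: (boolP ((i < R) && (j < C))%N) => h; last by rewrite ofun_out // g0.
by case/andP: h => iR jC; rewrite /ofun !insubT ffunE /= inordK // ltnS.
Qed.

Lemma ofun_inj R C L (f f' : {ffun 'I_R * 'I_C -> 'I_L}) :
  (forall i j, ofun f i j = ofun f' i j) -> f = f'.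
Proof. by move=> h; apply/ffunP => x; apply: val_inj; rewrite /= -!ofunE h. Qed.

Lemma ssytP sh ct (f : {ffun 'I_(size sh) * 'I_(head 0%N sh) -> 'I_(size ct).+1}) :
  sorted geq sh -> reflect (tab sh ct (ofun f)) (f \in ssyt_set sh ct).
Proof.
move=> ss.
have box i j : (j < nth 0 sh i)%N -> (i < size sh)%N && (j < head 0 sh)%N.
  move=> h; apply/andP; split; first by case: (ltnP i (size sh)) => // hh; rewrite nth_default in h.
  by rewrite -nth0; apply: leq_trans h (sorted_geq_nth ss (leq0n i)).
have wE v : #|[set x : cellT sh | (f x : nat) == v.+1]| =
    (\sum_(i < size sh) \sum_(j < head 0 sh) (ofun f i j == v.+1))%N.
  rewrite cardE -sum1_size big_enum_cond pair_big big_mkcond /=; apply: eq_bigr => x _.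
  by rewrite inE ofunE; case: eqP.
have wE' v : (forall i j, (j < nth 0 sh i)%N = (0 < ofun f i j)%N) ->
    #|[set x : cellT sh | (f x : nat) == v.+1]| = weight sh (ofun f) v.+1.
  move=> h0; rewrite wE; apply: eq_bigr => i _.
  have le : (nth 0 sh i <= head 0 sh)%N by rewrite -nth0 sorted_geq_nth.
  rewrite -(big_mkord predT (fun j => nat_of_bool (ofun f i j == v.+1))).
  rewrite (big_cat_nat (n := nth 0%N sh i)) //= [X in (_ + X)%N]big_nat_cond [X in (_ + X)%N]big1 ?addn0.
    by rewrite -sum1_count [RHS]big_mkcond /index_iota subn0.
  move=> j /andP[/andP[h _] _]; have := h0 i j; rewrite ltnNge h /=.
  by case: (ofun f i j).
rewrite inE; apply: (iffP and4P) => [[h0 h1 h2 h4]|[t0 t1 t2 t3 t4]].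
  have t0 i j : (j < nth 0 sh i)%N = (0 < ofun f i j)%N.
    case: (boolP ((i < size sh) && (j < head 0 sh))%N) => h.
      case/andP: h => hi hj; have /forallP/(_ (Ordinal hi, Ordinal hj))/eqP /= -> := h0.
      by rewrite -(ofunE f (Ordinal hi, Ordinal hj)).
    by rewrite ofun_out //; apply: contraNF h; exact: box.
  split=> //.
  - move=> i j j' jj' h; have /andP[hi hj'] := box _ _ h; have hj := leq_ltn_trans jj' hj'.
    have /forallP/(_ (Ordinal hi, Ordinal hj))/forallP/(_ (Ordinal hi, Ordinal hj')) := h1.
    by rewrite /= eqxx jj' h -!ofunE.
  - move=> i i' j ii' h; have /andP[hi' hj] := box _ _ h; have hi := ltn_trans ii' hi'.
    have /forallP/(_ (Ordinal hi, Ordinal hj))/forallP/(_ (Ordinal hi', Ordinal hj)) := h2.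
    by rewrite /= eqxx ii' h -!ofunE.
  - move=> i j; case: (boolP ((i < size sh) && (j < head 0 sh))%N) => h; last by rewrite ofun_out.
    case/andP: h => hi hj; rewrite -[i]/(val (Ordinal hi)) -[j]/(val (Ordinal hj)).
    by rewrite (ofunE f (Ordinal hi, Ordinal hj)) -ltnS ltn_ord.
  - move=> v hv; have /forallP/(_ (Ordinal hv))/eqP <- := h4.
    by rewrite wE'.
split.
- by apply/forallP => x; rewrite -ofunE -t0.
- apply/forallP => x; apply/forallP => y; apply/implyP => /andP[/andP[/eqP e le] h].
  by rewrite -!ofunE e; apply: t1.
- apply/forallP => x; apply/forallP => y; apply/implyP => /andP[/andP[/eqP e le] h].
  by rewrite -!ofunE e; apply: t2.
- by apply/forallP => v; rewrite wE' // t4.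
Qed.

Lemma tab_box sh ct g : sorted geq sh -> tab sh ct g ->
  forall i j, ~~ ((i < size sh) && (j < head 0 sh))%N -> g i j = 0%N.
Proof.
move=> ss [t0 _ _ _ _] i j; apply: contraNeq; rewrite -lt0n -t0 => h.
apply/andP; split; first by case: (ltnP i (size sh)) => // hh; rewrite nth_default in h.
by rewrite -nth0; apply: leq_trans h (sorted_geq_nth ss (leq0n i)).
Qed.

Lemma eq_tab sh ct g g' : (forall i j, g i j = g' i j) -> tab sh ct g -> tab sh ct g'.
Proof.
move=> e [t0 t1 t2 t3 t4]; split.
- by move=> i j; rewrite -e.
- by move=> i j j'; rewrite -!e; exact: t1.
- by move=> i i' j; rewrite -!e; exact: t2.
- by move=> i j; rewrite -e.
- move=> v hv; rewrite -t4 //; apply: eq_bigr => i _; apply: eq_count => j; by rewrite e.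
Qed.

Lemma mkfun_ssyt sh ct g : sorted geq sh -> tab sh ct g ->
  mkfun _ _ _ g \in ssyt_set sh ct.
Proof.
move=> ss t; apply/ssytP => //; apply: eq_tab (t) => i j; rewrite ofun_mkfun //.
  by case: t.
exact: tab_box t.
Qed.

Definition inner_shape sh m g : seq nat :=
  [seq count (fun j => g i j <= m)%N (iota 0 (nth 0%N sh i)) | i <- iota 0 (size sh)].

Definition inner_fill m g (i j : nat) : nat := if (g i j <= m)%N then g i j else 0%N.

Definition outer_fill sh k m g (i j : nat) : nat :=
  if (j < nth 0 k i)%N then g i j else if (j < nth 0 sh i)%N then m.+1 else 0%N.

Lemma nth_inner_shape sh m g i :
  nth 0%N (inner_shape sh m g) i = count (fun j => g i j <= m)%N (iota 0 (nth 0%N sh i)).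
Proof.
case: (ltnP i (size sh)) => h; first by rewrite (nth_map 0%N) ?size_iota // nth_iota.
by rewrite nth_default ?size_map ?size_iota // [nth 0%N sh i]nth_default.
Qed.

Lemma inner_shapeP sh ct n g : tab sh (rcons ct n) g ->
  forall i j, (j < nth 0 (inner_shape sh (size ct) g) i)%N =
              (j < nth 0 sh i)%N && (g i j <= size ct)%N.
Proof.
move=> [t0 t1 _ _ _] i j; rewrite nth_inner_shape; case: (ltnP j (nth 0%N sh i)) => h /=.
  rewrite -(@count_iota_prefix (fun j => g i j <= size ct)%N) // => a b ab bn.
  by apply: leq_trans; apply: t1.
apply/negbTE; rewrite -leqNgt; apply: leq_trans h; rewrite -{2}[nth 0%N sh i](size_iota 0).
exact: count_size.
Qed.

Lemma weight_split sh k g v : size k = size sh -> (forall i, nth 0 k i <= nth 0 sh i)%N ->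
  weight sh g v = (\sum_(i < size sh) (count (fun j => g i j == v) (iota 0 (nth 0 k i)) +
     count (fun j => g i j == v) (iota (nth 0 k i) (nth 0 sh i - nth 0 k i))))%N.
Proof.
move=> sk le; apply: eq_bigr => i _; rewrite -count_cat -{2}[nth 0%N k i]add0n.
by rewrite -iotaD subnKC.
Qed.

Lemma sumn_nthE (s : seq nat) : sumn s = (\sum_(i < size s) nth 0 s i)%N.
Proof. by rewrite sumnE (big_nth 0%N) big_mkord. Qed.

Lemma inner_tab sh ct n g : sorted geq sh -> tab sh (rcons ct n) g ->
  let k := inner_shape sh (size ct) g in
  [/\ k \in hstrips sh, (sumn k + n = sumn sh)%N & tab k ct (inner_fill (size ct) g)].
Proof.
move=> ss t k; have kP := inner_shapeP t; rewrite -/k in kP.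
have [t0 t1 t2 t3 t4] := t; rewrite size_rcons in t3 t4.
have sk : size k = size sh by rewrite size_map size_iota.
have ksh i : (nth 0 k i <= nth 0 sh i)%N.
  by case: (leqP (nth 0%N k i) (nth 0%N sh i)) => // h; have := kP i (nth 0%N sh i); rewrite h ltnn.
have up i j : (nth 0 k i <= j < nth 0 sh i)%N -> g i j = (size ct).+1.
  by have := kP i j; have := t3 i j; lia.
split.
- apply/mem_hstrips => //; split=> // i; rewrite ksh andbT.
  case: (leqP (nth 0%N sh i.+1) (nth 0%N k i)) => // h.
  have := kP i (nth 0%N k i); rewrite ltnn => /esym/negbT; rewrite negb_and -leqNgt.
  have := sorted_geq_nth ss (leqnSn i); have := t2 i i.+1 _ (ltnSn i) h; have := t3 i.+1 (nth 0%N k i); lia.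
- have := t4 (size ct) (ltnSn _); rewrite nth_rcons ltnn eqxx (weight_split _ _ sk ksh) => <-.
  rewrite !sumn_nthE sk -big_split; apply: eq_bigr => i _ /=.
  rewrite (@eq_in_count _ _ pred0) ?count_pred0; last first.
    by move=> j; rewrite mem_iota add0n => /= jk /=; have := kP i j; rewrite jk; lia.
  rewrite (@eq_in_count _ _ predT) ?count_predT ?size_iota ?add0n ?subnKC //.
  by move=> j; rewrite mem_iota => jk; rewrite up ?eqxx //; have := ksh i; lia.
split.
- by move=> i j; rewrite kP t0 /inner_fill; case: ifP; rewrite ?andbT ?andbF.
- move=> i j j' jj'; rewrite kP => /andP[h h']; rewrite /inner_fill h'.
  have := t1 i j j' jj' h; case: ifP => //; lia.
- move=> i i' j ii'; rewrite kP => /andP[h h']; rewrite /inner_fill h'.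
  have := t2 i i' j ii' h; case: ifP => //; lia.
- by move=> i j; rewrite /inner_fill; case: ifP.
- move=> v hv; have := t4 v (ltnW hv); rewrite nth_rcons hv (weight_split _ _ sk ksh) => <-.
  rewrite /weight sk; apply: eq_bigr => i _.
  rewrite [X in (_ + X)%N](@eq_in_count _ _ pred0) ?count_pred0 ?addn0; last first.
    by move=> j; rewrite mem_iota => jk /=; rewrite up; [lia | have := ksh i; lia].
  apply: eq_in_count => j; rewrite mem_iota add0n => /= jk; rewrite /inner_fill.
  by have := kP i j; rewrite jk => /esym/andP[_ ->].
Qed.

Lemma outer_tab sh k ct n g : sorted geq sh -> k \in hstrips sh -> (sumn k + n = sumn sh)%N ->
  tab k ct g -> tab sh (rcons ct n) (outer_fill sh k (size ct) g).
Proof.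
move=> ss /(mem_hstrips _ ss)[sk hk] sm [t0 t1 t2 t3 t4].
have ksh i : (nth 0 k i <= nth 0 sh i)%N by have := hk i; lia.
split.
- move=> i j; rewrite /outer_fill; case: ifP => h.
    by rewrite -t0 h; have := ksh i; lia.
  by case: ifP.
- move=> i j j' jj' h; rewrite /outer_fill h; case: (ltnP j' (nth 0%N k i)) => h'.
    by rewrite (leq_ltn_trans jj' h') t1.
  by case: ifP => _; [have := t3 i j; lia | case: ifP].
- move=> i i' j ii' h; have jk : (j < nth 0 k i)%N.
    by have := hk i; have := sorted_geq_nth ss ii'; lia.
  rewrite /outer_fill jk h; case: ifP => h'; first exact: t2.
  by rewrite ltnS.
- move=> i j; rewrite size_rcons /outer_fill; case: ifP => _; first by have := t3 i j; lia.
  by case: ifP.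
- move=> v; rewrite size_rcons ltnS leq_eqVlt => vm.
  rewrite (weight_split _ _ sk ksh) nth_rcons; case: (ltngtP v (size ct)) vm => // [vm _|vm _].
    rewrite -t4 // /weight sk; apply: eq_bigr => i _.
    rewrite [X in (_ + X)%N](@eq_in_count _ _ pred0) ?count_pred0 ?addn0; last first.
      move=> j; rewrite mem_iota => jk /=; rewrite /outer_fill ifF; last by lia.
      by rewrite ifT; [lia | have := ksh i; lia].
    apply: eq_in_count => j; rewrite mem_iota add0n => /= jk; by rewrite /outer_fill jk.
  have -> : n = (\sum_(i < size sh) (nth 0 sh i - nth 0 k i))%N.
    apply/eqP; rewrite -(eqn_add2l (sumn k)) sm !sumn_nthE sk -big_split; apply/eqP.
    by apply: eq_bigr => i _ /=; rewrite subnKC.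
  apply: eq_bigr => i _; rewrite (@eq_in_count _ _ pred0) ?count_pred0; last first.
    move=> j; rewrite mem_iota add0n => /= jk; rewrite /outer_fill jk.
    by have := t3 i j; lia.
  rewrite (@eq_in_count _ _ predT) ?count_predT ?size_iota ?add0n //.
  move=> j; rewrite mem_iota => jk; rewrite /outer_fill ifF; last by lia.
  by rewrite ifT ?vm ?eqxx //; have := ksh i; lia.
Qed.

(** The cells with the largest letter form a horizontal strip of n cells, and the others a tableau
    of the inner shape; [outer_fill] and [inner_fill] are the inverse bijections. *)
Lemma kostka_rcons sh ct n : sorted geq sh ->
  kostka sh (rcons ct n) =
  (\sum_(k <- hstrips sh | (sumn k + n == sumn sh)%N) kostka k ct)%N.
Proof.
move=> ss; rewrite /kostka.
pose A := ssyt_set sh (rcons ct n).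
pose kf (f : {ffun 'I_(size sh) * 'I_(head 0%N sh) -> 'I_(size (rcons ct n)).+1}) :=
  inner_shape sh (size ct) (ofun f).
have fib k : k \in hstrips sh -> (sumn k + n == sumn sh)%N ->
    #|ssyt_set k ct| = #|[set f in A | kf f == k]|.
  move=> kh /eqP sm; have sk := hstrips_sorted ss kh.
  have [_ hk] := (mem_hstrips _ ss).1 kh.
  pose Phi (f : {ffun 'I_(size k) * 'I_(head 0%N k) -> 'I_(size ct).+1}) :
     {ffun 'I_(size sh) * 'I_(head 0%N sh) -> 'I_(size (rcons ct n)).+1} :=
     mkfun _ _ _ (outer_fill sh k (size ct) (ofun f)).
  have PhiE f : f \in ssyt_set k ct -> forall i j, ofun (Phi f) i j = outer_fill sh k (size ct) (ofun f) i j.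
    move=> /(ssytP _ sk) tf; have to := outer_tab ss kh sm tf.
    by apply: ofun_mkfun; [case: to | exact: tab_box to].
  have inj : {in ssyt_set k ct &, injective Phi}.
    move=> f f' hf hf' e; apply: ofun_inj => i j.
    have /(ssytP _ sk)[t0 _ _ _ _] := hf; have /(ssytP _ sk)[t0' _ _ _ _] := hf'.
    case: (ltnP j (nth 0%N k i)) => h.
      by have := PhiE _ hf i j; rewrite e PhiE // /outer_fill h.
    have := t0 i j; have := t0' i j; rewrite ltnNge h /=.
    by case: (ofun f i j) => // ; case: (ofun f' i j).
  rewrite -(card_in_imset inj); apply: eq_card => f; rewrite [RHS]inE; apply/imsetP/andP.
    move=> [f' hf' ->]; have tf := ssytP _ sk hf'; have to := outer_tab ss kh sm tf; split.
      exact: mkfun_ssyt.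
    apply/eqP; apply: (@eq_from_nth _ 0%N).
      by rewrite size_map size_iota; case: ((mem_hstrips _ ss).1 kh).
    move=> i _; rewrite nth_inner_shape.
    have -> : nth 0%N k i = size (iota 0 (nth 0%N k i)) by rewrite size_iota.
    rewrite -(subnKC (_ : nth 0 k i <= nth 0 sh i)%N); last by have := hk i; lia.
    rewrite iotaD count_cat add0n.
    rewrite (@eq_in_count _ _ predT) ?count_predT; last first.
      move=> j; rewrite mem_iota add0n => /= jk; rewrite PhiE // /outer_fill jk.
      by case: tf => _ _ _ t3 _; rewrite t3.
    rewrite (@eq_in_count _ _ pred0) ?count_pred0 ?addn0 //.
    move=> j; rewrite mem_iota => jk; rewrite PhiE // /outer_fill ifF; last by lia.
    by rewrite ifT ?ltnn //; have := hk i; lia.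
  move=> [hf /eqP kk]; have tf := ssytP _ ss hf; have [_ _ ti] := inner_tab ss tf.
  rewrite -/(kf f) kk in ti.
  exists (mkfun _ _ _ (inner_fill (size ct) (ofun f))); first exact: mkfun_ssyt.
  apply: ofun_inj => i j; rewrite PhiE; last exact: mkfun_ssyt.
  have kP := inner_shapeP tf; rewrite -/(kf f) kk in kP.
  have [t0 _ _ t3' _] := tf.
  have t3 i' j' : (ofun f i' j' <= (size ct).+1)%N by rewrite -(size_rcons ct n).
  rewrite /outer_fill ofun_mkfun; first last.
  - exact: tab_box ti.
  - by case: ti.
  rewrite kP /inner_fill; have := t0 i j; have := t3 i j.
  by case: (leqP (ofun f i j) (size ct)) => h1; case: (ltnP j (nth 0%N sh i)) => h2 //=; lia.
transitivity (\sum_(f in A) \sum_(k <- hstrips sh | (sumn k + n == sumn sh)%N) (kf f == k))%N.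
  rewrite -sum1_card; apply: eq_bigr => f /(ssytP _ ss) tf.
  have [kh sm _] := inner_tab ss tf; rewrite -/(kf f) in kh sm.
  rewrite big_mkcond (bigD1_seq (kf f)) ?uniq_hstrips //= sm !eqxx big1 // => k ne.
  by rewrite [kf f == k]eq_sym (negPf ne) if_same.
rewrite exchange_big big_seq_cond [RHS]big_seq_cond; apply: eq_bigr => k /andP[kh sm].
rewrite fib // -sum1_card big_mkcond [RHS]big_mkcond; apply: eq_bigr => f _ /=.
by rewrite [in RHS]inE; case: (f \in A) => //=; case: eqP.
Qed.

Lemma kostka_nil sh : sorted geq sh -> kostka sh [::] = (sumn sh == 0)%N.
Proof.
move=> ss; rewrite /kostka; case: eqP => s0.
  have z i : nth 0%N sh i = 0%N.
    case: (ltnP i (size sh)) => il; last by rewrite nth_default.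
    by move/eqP: s0; rewrite sumn_nthE sum_nat_eq0 => /forallP/(_ (Ordinal il))/eqP.
  rewrite (_ : ssyt_set sh [::] = setT) ?cardsT ?card_ffun ?card_ord ?exp1n //.
  apply/setP => f; rewrite [RHS]inE; apply/ssytP => //.
  have o0 i j : ofun f i j = 0%N.
    case: (boolP ((i < size sh) && (j < head 0 sh))%N) => h; last by rewrite ofun_out.
    case/andP: h => hi hj; rewrite -[i]/(val (Ordinal hi)) -[j]/(val (Ordinal hj)).
    by rewrite (ofunE f (Ordinal hi, Ordinal hj)) [f _]ord1.
  by split=> // [i j|i j j' _|i i' j _|i j]; rewrite ?z ?o0.
apply: eq_card0 => f; apply/negP => /(ssytP _ ss)[t0 _ _ t3 _]; case: s0.
rewrite sumn_nthE big1 // => i _; have := t0 i 0%N; have := t3 i 0%N => /=.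
by case: (nth 0%N sh i) => //; lia.
Qed.

Fixpoint kst (sh rct : seq nat) : nat :=
  if rct is n :: rct' then
    (\sum_(k <- hstrips sh | (sumn k + n == sumn sh)%N) kst k rct')%N
  else (sumn sh == 0)%N.

Lemma kostkaE sh ct : sorted geq sh -> kostka sh ct = kst sh (rev ct).
Proof.
elim/last_ind: ct sh => [|ct n IH] sh ss; first by rewrite kostka_nil.
rewrite rev_rcons kostka_rcons //= big_seq_cond [RHS]big_seq_cond.
by apply: eq_bigr => k /andP[kh _]; apply: IH; exact: hstrips_sorted kh.
Qed.

End Tableaux.

(** * Bialternants *)

Section Alternants.
Variables (R : comRingType) (x : nat -> R).

Definition altf m (e : nat -> nat) : R := \det (\matrix_(i < m, j < m) x i ^+ e j).

Lemma det_multilinear_sum m L (G : 'I_m -> 'I_L -> R) :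
  \det (\matrix_(i < m, j < m) \sum_(t < L) G j t * x i ^+ t) =
  \sum_(f : {ffun 'I_m -> 'I_L}) (\prod_j G j (f j)) *
     \det (\matrix_(i < m, j < m) x i ^+ f j).
Proof.
have detE (A : 'M[R]_m) : \det A = \sum_(s : 'S_m) (-1) ^+ s * \prod_j A (s j) j.
  by rewrite -det_tr; apply: eq_bigr => s _; congr (_ * _); apply: eq_bigr => j _; rewrite mxE.
rewrite detE.
under eq_bigr => s _ do (under eq_bigr => j _ do rewrite mxE).
under eq_bigr => s _ do rewrite bigA_distr_bigA mulr_sumr.
rewrite exchange_big; apply: eq_bigr => f _ /=; rewrite detE mulr_sumr.
apply: eq_bigr => s _; rewrite mulrCA; congr (_ * _); rewrite -big_split.
by apply: eq_bigr => j _; rewrite mxE.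
Qed.

(** A geometric sum, padded with zero coefficients so that all columns have the common index range
    required by [det_multilinear_sum]. *)
Lemma subrXX_range (y z : R) (p q L : nat) : (p <= q)%N -> (q <= L)%N ->
  y ^+ q - z ^+ (q - p) * y ^+ p =
  (y - z) * \sum_(t < L) (if (p <= t < q)%N then z ^+ (q.-1 - t) else 0) * y ^+ t.
Proof.
move=> pq qL.
have -> : \sum_(t < L) (if (p <= t < q)%N then z ^+ (q.-1 - t) else 0) * y ^+ t =
    \sum_(p <= t < q) z ^+ (q.-1 - t) * y ^+ t.
  rewrite -(big_mkord predT (fun t => (if (p <= t < q)%N then z ^+ (q.-1 - t) else 0) * y ^+ t)).
  rewrite (big_cat_nat (n := p)) //=; last exact: leq_trans qL.
  rewrite (big_cat_nat (n := q) (m := p)) //= [X in X + _]big_nat_cond [X in X + _]big1; last first.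
    by move=> t /andP[/andP[_ tp] _]; rewrite ifF ?mul0r //; lia.
  rewrite [X in _ + (_ + X)]big_nat_cond [X in _ + (_ + X)]big1 ?addr0 ?add0r; last first.
    by move=> t /andP[/andP[qt _] _]; rewrite ifF ?mul0r //; lia.
  by apply: eq_big_nat => t h; rewrite h.
have -> : \sum_(p <= t < q) z ^+ (q.-1 - t) * y ^+ t = \sum_(t < q - p) z ^+ ((q - p).-1 - t) * y ^+ t * y ^+ p.
  rewrite -{1}[p]add0n big_addn big_mkord; apply: eq_bigr => t _.
  rewrite -mulrA -exprD; congr (z ^+ _ * _); lia.
rewrite -mulr_suml mulrA; rewrite (eq_bigr (fun t : 'I_(q - p) => y ^+ t * z ^+ ((q - p).-1 - t))); last first.
  by move=> t _; rewrite mulrC.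
rewrite (reindex_inj rev_ord_inj) /=.
rewrite (eq_bigr (fun i : 'I_(q - p) => y ^+ ((q - p).-1 - i) * z ^+ i)); last first.
  by move=> t _; have := ltn_ord t => h; congr (y ^+ _ * z ^+ _); lia.
by rewrite -subrXX mulrBl -exprD subnK.
Qed.

(* Subtracting from each column a multiple of the next one clears the last
   row, and every remaining entry becomes divisible by x_i - x_m. *)
Lemma altf_branch m (e : nat -> nat) L :
  (forall j, (j < m)%N -> (e j.+1 <= e j)%N) -> (forall j, (j <= m)%N -> (e j <= L)%N) ->
  altf m.+1 e = (\prod_(i < m) (x i - x m)) * x m ^+ e m *
   \sum_(f : {ffun 'I_m -> 'I_L})
     (\prod_(j < m) (if (e j.+1 <= f j < e j)%N then x m ^+ ((e j).-1 - f j) else 0)) *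
     \det (\matrix_(i < m, j < m) x i ^+ f j).
Proof.
move=> de eL; pose A := \matrix_(i < m.+1, j < m.+1) x i ^+ e j.
pose U := \matrix_(i < m.+1, j < m.+1)
  (if i == j then 1 else if (i : nat) == j.+1 then - x m ^+ (e j - e j.+1) else 0).
have dU : \det U = 1.
  rewrite det_trig; first by rewrite big1 // => i _; rewrite mxE eqxx.
  apply/is_trig_mxP => i j ij; rewrite mxE ifF; last by apply/eqP => h; rewrite h ltnn in ij.
  by rewrite ifF //; apply/eqP; lia.
have Bj (i : 'I_m.+1) (j : 'I_m) : (A *m U) i (lift ord_max j) =
    x i ^+ e j - x m ^+ (e j - e j.+1) * x i ^+ e j.+1.
  have jm := ltn_ord j.
  have ej : lift ord_max j = j :> nat by rewrite lift_max.
  have j1 : (j.+1 < m.+1)%N by [].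
  rewrite mxE (bigD1 (lift ord_max j)) //= (bigD1 (Ordinal j1)) /=; last first.
    by apply/eqP => /(congr1 (@nat_of_ord _)); rewrite lift_max /=; lia.
  rewrite big1 ?addr0 => [|k /andP[k1 k2]]; last first.
    rewrite [U _ _]mxE (negPf k1) ifF ?mulr0 //; rewrite ej; apply/eqP => h.
    by case/eqP: k2; apply: val_inj.
  rewrite !mxE eqxx mulr1 ej; congr (_ + _).
  rewrite ifF; last by apply/eqP => /(congr1 (@nat_of_ord _)); rewrite lift_max /=; lia.
  by rewrite eqxx mulrN mulrC.
have Bm (i : 'I_m.+1) : (A *m U) i ord_max = x i ^+ e m.
  rewrite mxE (bigD1 ord_max) //= big1 ?addr0; first by rewrite !mxE eqxx mulr1.
  move=> k km; rewrite [U _ _]mxE (negPf km) ifF ?mulr0 //=.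
  by apply/eqP; have := ltn_ord k; lia.
have -> : altf m.+1 e = \det (A *m U) by rewrite det_mulmx dU mulr1.
rewrite (expand_det_row _ ord_max) (bigD1 ord_max) //= [X in _ + X]big1 ?addr0; last first.
  move=> k km; have := unliftP ord_max k; case=> [j ->|ek]; last by rewrite ek eqxx in km.
  rewrite Bj /= -exprD subnK ?subrr ?mul0r //; exact: de.
rewrite Bm /cofactor -signr_odd addnn odd_double expr0 mul1r.
have -> : row' ord_max (col' ord_max (A *m U)) =
  diag_mx (\row_i (x (i : 'I_m) - x m)) *m (\matrix_(i < m, j < m) \sum_(t < L)
     (if (e j.+1 <= t < e j)%N then x m ^+ ((e j).-1 - t) else 0) * x i ^+ t).
  apply/matrixP => i j; rewrite mul_diag_mx [LHS]mxE [LHS]mxE Bj !mxE lift_max.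
  by apply: subrXX_range; [exact: de | apply: eL; apply: ltnW].
rewrite det_mulmx det_diag (det_multilinear_sum (fun j t =>
   if (e (j : 'I_m).+1 <= (t : 'I_L) < e j)%N then x m ^+ ((e j).-1 - t) else 0)).
rewrite mulrA; congr (_ * _); rewrite mulrC; congr (_ * _).
by apply: eq_bigr => i _; rewrite mxE.
Qed.

End Alternants.

(** The possible next rows below [sh] in a Gelfand-Tsetlin pattern. *)
Definition interl (sh : seq nat) : seq (seq nat) :=
  [seq take (size sh).-1 k | k <- hstrips sh & nth 0%N k (size sh).-1 == 0%N].

Lemma hstrips_rcons0 s : hstrips (rcons s 0%N) = map (rcons^~ 0%N) (hstrips s).
Proof.
elim: s => // a s IH.
have E l : [seq b :: t | b <- l, t <- hstrips (rcons s 0%N)] =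
    map (rcons^~ 0%N) [seq b :: t | b <- l, t <- hstrips s].
  elim: l => // b l IHl; rewrite allpairs_cons map_cat -IHl IH; congr (_ ++ _).
  by rewrite -!map_comp; apply: eq_map.
have hd : head 0%N (rcons s 0%N) = head 0%N s by case: (s).
by rewrite -[RHS](E (iota (head 0%N s) (a - head 0 s).+1)) -hd.
Qed.

Lemma sumn_rcons0 s : sumn (rcons s 0%N) = sumn s.
Proof. by rewrite sumn_rcons addn0. Qed.

Lemma kst_rcons0 s w : kst (rcons s 0%N) w = kst s w.
Proof.
elim: w s => [|n w IH] s /=; first by rewrite sumn_rcons0.
rewrite hstrips_rcons0 big_map sumn_rcons0; apply: eq_big => k; first by rewrite sumn_rcons0.
by rewrite IH.
Qed.

(** Columns increase strictly, so a tableau has at most as many rows as there are letters. *)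
Lemma kst_rows sh w : sorted geq sh -> (0 < nth 0 sh (size w))%N -> kst sh w = 0%N.
Proof.
elim: w sh => [|n w IH] sh ss /=.
  rewrite nth0; case: eqP => // s0; have := sumn_head sh; lia.
move=> h; rewrite big_seq_cond big1 // => k /andP[kh _].
have [_ hk] := (mem_hstrips _ ss).1 kh; apply: IH; first exact: hstrips_sorted kh.
by have := hk (size w); lia.
Qed.

Lemma hstrips_max sh k : sorted geq sh -> k \in hstrips sh -> sumn k = sumn sh -> k = sh.
Proof.
move=> ss /(mem_hstrips _ ss)[sk hk] e; apply: (@eq_from_nth _ 0%N) => // i ik.
have le j : (nth 0 k j <= nth 0 sh j)%N by have := hk j; lia.
apply/eqP; rewrite eqn_leq le /= leqNgt; apply/negP => lt.
have : (sumn k < sumn sh)%N; last by rewrite e ltnn.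
rewrite !sumn_nthE sk; rewrite sk in ik.
rewrite (bigD1 (Ordinal ik)) //= [X in (_ < X)%N](bigD1 (Ordinal ik)) //= -addSn leq_add //.
exact: leq_sum.
Qed.

Lemma mem_hstrips_refl sh : sorted geq sh -> sh \in hstrips sh.
Proof.
move=> ss; apply/(mem_hstrips _ ss); split=> // i; rewrite leqnn andbT.
exact: sorted_geq_nth.
Qed.

Lemma kst_0 sh w : sorted geq sh -> kst sh (0%N :: w) = kst sh w.
Proof.
move=> ss /=; rewrite big_mkcond (bigD1_seq sh) ?uniq_hstrips ?mem_hstrips_refl //=.
rewrite addn0 eqxx big_seq_cond big1 ?addn0 // => k /andP[kh ne].
by case: eqP => //; rewrite addn0 => /(hstrips_max ss kh) e; rewrite e eqxx in ne.
Qed.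

Lemma mem_interl sh t : sorted geq sh -> (0 < size sh)%N -> (t \in interl sh) <->
  size t = (size sh).-1 /\ (forall i, (i < size t)%N -> nth 0 sh i.+1 <= nth 0 t i <= nth 0 sh i)%N.
Proof.
move=> ss s0; split.
  move=> /mapP[k]; rewrite mem_filter => /andP[_ /(mem_hstrips _ ss)[sk hk]] ->.
  have st : size (take (size sh).-1 k) = (size sh).-1 by rewrite size_take sk; case: ifP; lia.
  by split=> // i; rewrite st => il; rewrite nth_take.
move=> [st ht]; apply/mapP; exists (rcons t 0%N); last by rewrite -st -cats1 take_size_cat.
rewrite mem_filter -st nth_rcons ltnn eqxx /=; apply/mem_hstrips => //; split.
  by rewrite size_rcons st prednK.
move=> i; rewrite nth_rcons; case: ltngtP => h; first exact: ht.
  by rewrite nth_default // -(prednK s0) ltnS -st ltnW.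
by rewrite nth_default // -(prednK s0) ltnS -st h.
Qed.

Lemma interl_sorted sh t : sorted geq sh -> (0 < size sh)%N -> t \in interl sh -> sorted geq t.
Proof.
move=> ss s0 /mapP[k]; rewrite mem_filter => /andP[_ kh] ->.
by apply: take_sorted; exact: hstrips_sorted kh.
Qed.

Lemma uniq_interl sh : sorted geq sh -> (0 < size sh)%N -> uniq (interl sh).
Proof.
move=> ss s0; rewrite map_inj_in_uniq ?filter_uniq ?uniq_hstrips // => k k'.
rewrite !mem_filter => /andP[/eqP z /(mem_hstrips _ ss)[sk _]] /andP[/eqP z' /(mem_hstrips _ ss)[sk' _]] e.
apply: (@eq_from_nth _ 0%N); rewrite ?sk' // => i; rewrite sk => il.
case: (ltngtP i (size sh).-1) => h; [|lia|by rewrite h z z'].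
by rewrite -(nth_take 0%N h k) -(nth_take 0%N h k') e.
Qed.

Lemma kst_interl sh n w : sorted geq sh -> size sh = (size w).+1 ->
  kst sh (n :: w) = (\sum_(t <- interl sh | (sumn t + n == sumn sh)%N) kst t w)%N.
Proof.
move=> ss sz; rewrite /= big_map big_filter_cond /= big_seq_cond [RHS]big_seq_cond sz /=.
rewrite (bigID (fun k => nth 0%N k (size w) == 0%N)) /= [X in (_ + X)%N]big1 ?addn0; last first.
  move=> k /andP[/andP[kh _] nz]; apply: kst_rows; first exact: hstrips_sorted kh.
  by rewrite lt0n.
have kE k : k \in hstrips sh -> nth 0%N k (size w) == 0%N -> k = rcons (take (size w) k) 0%N.
  move=> /(mem_hstrips _ ss)[sk _] /eqP z.
  by rewrite -[in rcons _ _]z -take_nth ?take_oversize // sk sz.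
apply: eq_big => [k|k /andP[/andP[kh _] z]]; last by rewrite [in LHS](kE k) // kst_rcons0.
case kh: (k \in hstrips sh) => //=; rewrite andbC; case z: (nth 0%N k (size w) == 0%N) => //=.
by rewrite [in LHS](kE k) // sumn_rcons0.
Qed.

(** Weights, largest letter first, of the Gelfand-Tsetlin patterns with top row [sh]. *)
Fixpoint gtw m (sh : seq nat) : seq (seq nat) :=
  if m is m'.+1 then [seq (sumn sh - sumn t)%N :: w | t <- interl sh, w <- gtw m' t]
  else [:: [::]].

Lemma sumn_interl sh t : sorted geq sh -> (0 < size sh)%N -> t \in interl sh -> (sumn t <= sumn sh)%N.
Proof.
move=> ss s0 /(mem_interl _ ss s0)[st ht]; rewrite !sumn_nthE st.
rewrite -(big_mkord predT (nth 0%N sh)) -[X in (_ <= \sum_(0 <= i < X) _)%N](prednK s0).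
rewrite big_nat_recr //= big_mkord; apply: leq_trans (leq_addr _ _).
apply: leq_sum => i _; by have := ht i; rewrite st ltn_ord => /(_ isT) /andP[].
Qed.

Lemma kst_gtw m sh w : sorted geq sh -> size sh = m -> size w = m -> kst sh w = count_mem w (gtw m sh).
Proof.
elim: m sh w => [|m IH] sh w ss; first by move=> /size0nil -> /size0nil ->.
case: w => // n w sm [sw]; have s0 : (0 < size sh)%N by rewrite sm.
rewrite kst_interl ?sm ?sw // count_flatten -map_comp [RHS]sumnE big_map big_seq_cond.
rewrite [RHS]big_seq_cond big_mkcond [RHS]big_mkcond; apply: eq_bigr => t _ /=.
rewrite andbT; case th: (t \in interl sh) => //=; have le := sumn_interl ss s0 th.
rewrite count_map /=; case: eqP => e.
  rewrite (IH t) //; first by apply: eq_count => w' /=; rewrite eqseq_cons -e addKn eqxx.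
    exact: interl_sorted th.
  by have [-> _] := (mem_interl _ ss s0).1 th; rewrite sm.
rewrite (eq_count (a2 := pred0)) ?count_pred0 // => w' /=; rewrite eqseq_cons.
by case: eqP => // e'; case: e; lia.
Qed.

Section SchurAlternant.
Variables (R : comRingType) (x : nat -> R).

Definition bexp m (sh : seq nat) (j : nat) : nat := (nth 0 sh j + (m - j.+1))%N.

Fixpoint wmon (w : seq nat) : R := if w is n :: w' then x (size w') ^+ n * wmon w' else 1.

(** For exponents sh + delta, the ranges e_(j+1) <= f_j < e_j of [altf_branch] describe exactly the
    vectors t + delta, in one variable less, with t interlacing [sh]. *)
Lemma altf_branch_shape m sh : sorted geq sh -> size sh = m.+1 ->
  altf x m.+1 (bexp m.+1 sh) = (\prod_(i < m) (x i - x m)) *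
    \sum_(t <- interl sh) x m ^+ (sumn sh - sumn t) * altf x m (bexp m t).
Proof.
move=> ss sz; have s0 : (0 < size sh)%N by rewrite sz.
have mono i : (nth 0 sh i.+1 <= nth 0 sh i)%N by exact: sorted_geq_nth.
pose L := (nth 0 sh 0 + m).+1%N.
have bL j : (j <= m)%N -> (bexp m.+1 sh j <= L)%N.
  by move=> jm; have := sorted_geq_nth ss (leq0n j); rewrite /bexp /L; lia.
rewrite (@altf_branch _ x m _ L) //; last by move=> j jm; rewrite /bexp; have := mono j; lia.
rewrite -mulrA; congr (_ * _); rewrite mulr_sumr.
pose P (f : {ffun 'I_m -> 'I_L}) := [forall j : 'I_m, (bexp m.+1 sh j.+1 <= f j < bexp m.+1 sh j)%N].
rewrite (bigID P) /= [X in _ + X]big1 ?addr0; last first.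
  move=> f; rewrite negb_forall => /existsP[j /negPf nj].
  by rewrite (bigD1 j) //= nj !mul0r mulr0.
pose ft (t : seq nat) : {ffun 'I_m -> 'I_L} := [ffun j : 'I_m => inord (bexp m t j)].
have ftE t j : t \in interl sh -> ft t j = bexp m t j :> nat.
  move=> /(mem_interl _ ss s0)[st ht]; rewrite ffunE inordK //.
  have := ht j; rewrite st sz ltn_ord => /(_ isT); rewrite /bexp /L.
  have := sorted_geq_nth ss (leq0n j); have := ltn_ord j; lia.
rewrite -big_filter.
rewrite (perm_big (map ft (interl sh))) /=; last first.
  apply: uniq_perm.
  - by rewrite filter_uniq ?index_enum_uniq.
  - rewrite map_inj_in_uniq ?uniq_interl // => t t' th th' e.
    have [st _] := (mem_interl _ ss s0).1 th; have [st' _] := (mem_interl _ ss s0).1 th'.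
    apply: (@eq_from_nth _ 0%N); rewrite ?st' // => i; rewrite st sz /= => im.
    have := congr1 (fun f : {ffun 'I_m -> 'I_L} => f (Ordinal im) : nat) e.
    by rewrite !ftE // /bexp /=; lia.
  move=> f; rewrite mem_filter mem_index_enum andbT; apply/forallP/mapP => [h|[t th ->] j]; last first.
    rewrite ftE //; have [st ht] := (mem_interl _ ss s0).1 th.
    have := ht j; rewrite st sz ltn_ord => /(_ isT); rewrite /bexp; have := ltn_ord j; lia.
  pose t := [seq ((f j : nat) - (m - (j : 'I_m).+1))%N | j <- enum 'I_m].
  have st : size t = m by rewrite size_map size_enum_ord.
  have nt (j : 'I_m) : nth 0%N t j = (f j - (m - j.+1))%N.
    by rewrite (nth_map j) ?size_enum_ord // nth_ord_enum.
  have th : t \in interl sh.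
    apply/mem_interl => //; split; first by rewrite st sz.
    move=> i; rewrite st => im; have := nt (Ordinal im); rewrite /= => ->.
    by have := h (Ordinal im); rewrite /bexp /=; lia.
  exists t => //; apply/ffunP => j; apply: val_inj; rewrite /= ftE // /bexp nt.
  by rewrite subnK //; have /andP[h1 _] := h j; apply: leq_trans h1; rewrite /bexp subSS leq_addl.
rewrite big_map big_seq [RHS]big_seq; apply: eq_bigr => t th.
have [st ht] := (mem_interl _ ss s0).1 th; rewrite sz /= in st.
rewrite mulrA; congr (_ * _); last first.
  congr (\det _); apply/matrixP => i j; rewrite !mxE; congr (_ ^+ _); exact: ftE.
rewrite (eq_bigr (fun j : 'I_m => x m ^+ (nth 0 sh j - nth 0 t j))); last first.
  move=> j _; have := ht j; rewrite st ltn_ord => /(_ isT) h; have jm := ltn_ord j.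
  rewrite ftE // ifT; last by rewrite /bexp; lia.
  by congr (_ ^+ _); rewrite /bexp subSS -(subnSK jm) addnS /= subnDr.
rewrite -expr_sum -exprD; congr (_ ^+ _).
rewrite !sumn_nthE sz st big_ord_recr /= {1}/bexp subnn addn0.
rewrite addnC -addnBAC ?leq_sum //; last first.
  by move=> j _; have := ht j; rewrite st ltn_ord => /(_ isT) /andP[].
congr (_ + _)%N; rewrite sumnB // => j _.
by have := ht j; rewrite st ltn_ord => /(_ isT) /andP[].
Qed.

Lemma sorted_nseq0 m : sorted geq (nseq m 0%N).
Proof. by elim: m => // n; case: n => [|n] //= ->. Qed.

Lemma interl_nseq0 m : interl (nseq m.+1 0%N) = [:: nseq m 0%N].
Proof.
have ss := sorted_nseq0 m.+1.
have u := @uniq_interl (nseq m.+1 0%N) ss isT.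
apply: perm_small_eq => //; apply: uniq_perm => // t; rewrite inE.
apply/idP/eqP => [/(mem_interl _ ss isT)[st ht]|->].
  rewrite size_nseq /= in st; apply: (@eq_from_nth _ 0%N); rewrite ?size_nseq // => i it.
  by have := ht i it; rewrite !nth_nseq !if_same; lia.
apply/(mem_interl _ ss isT); rewrite !size_nseq; split=> // i _.
by rewrite !nth_nseq !if_same.
Qed.

Lemma altf_delta m : altf x m.+1 (bexp m.+1 [::]) =
  (\prod_(i < m) (x i - x m)) * altf x m (bexp m [::]).
Proof.
have E n : altf x n (bexp n [::]) = altf x n (bexp n (nseq n 0%N)).
  congr (\det _); apply/matrixP => i j; rewrite !mxE /bexp nth_nil nth_nseq.
  by rewrite if_same.
rewrite !E altf_branch_shape ?size_nseq ?sorted_nseq0 // interl_nseq0 big_seq1.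
by rewrite !sumn_nseq expr0 mul1r.
Qed.

(** Bialternant formula. The alternants of [sh] and of delta branch with the same product of
    differences, so the remaining factor follows the branching of Gelfand-Tsetlin patterns. *)
Lemma altf_schur m sh : sorted geq sh -> size sh = m ->
  altf x m (bexp m sh) = altf x m (bexp m [::]) * \sum_(w <- gtw m sh) wmon w.
Proof.
elim: m sh => [|m IH] sh ss sz.
  by rewrite /= big_seq1 mulr1 /altf !det_mx00.
have s0 : (0 < size sh)%N by rewrite sz.
rewrite altf_branch_shape // altf_delta -mulrA; congr (_ * _).
rewrite big_allpairs_dep mulr_sumr big_seq [RHS]big_seq; apply: eq_bigr => t th.
have st : size t = m by have [-> _] := (mem_interl _ ss s0).1 th; rewrite sz.
rewrite IH //; last exact: interl_sorted th.
rewrite mulrCA; congr (_ * _); rewrite mulr_sumr big_seq [RHS]big_seq; apply: eq_bigr => w wh /=.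
congr (x _ ^+ _ * _); elim: (m) (t) w wh {IH sz st th} => [|m' IHm] t' w /=.
  by rewrite inE => /eqP ->.
by move=> /allpairsPdep[t'' [w' [_ /IHm + ->]]] /= => ->.
Qed.

End SchurAlternant.

(** * The inverse Kostka matrix *)

Section VectorLists.
Variable M : nat.
Notation vec := {ffun 'I_M -> int}.
Notation delta := (beta M [::]).
Implicit Types (a b : vec) (nu : seq nat).

Definition vlist b : seq int := [seq b i | i <- enum 'I_M].
Definition vecn nu : vec := [ffun i : 'I_M => (nth 0%N nu i)%:Z].

Lemma vecnE nu i : vecn nu i = (nth 0%N nu i)%:Z. Proof. by rewrite ffunE. Qed.

Lemma beta_vecn lam : beta M lam = vecn lam + delta.
Proof. by apply/ffunP => i; rewrite !vE vecnE nth_nil add0n. Qed.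

Lemma vlist_permP a b : reflect (exists s, a = vperm b s) (perm_eq (vlist a) (vlist b)).
Proof.
have sz c : size (vlist c) == M by rewrite size_map size_enum_ord.
have nv c (i : 'I_M) : nth 0 (vlist c) i = c i.
  by rewrite (nth_map i) ?size_enum_ord // nth_ord_enum.
apply: (iffP (@tuple_permP _ _ (vlist a) (Tuple (sz b)))) => -[s e]; exists s.
  apply/ffunP => i; rewrite ffunE -(nv a i) e (nth_map i) ?size_enum_ord // nth_ord_enum.
  by rewrite (tnth_nth 0) nv.
rewrite /=; apply: eq_map => i; rewrite (tnth_nth 0) nv e ffunE //.
Qed.

Definition stab b : nat := #|[set r | vperm b r == b]|.

Lemma stab_gt0 b : (0 < stab b)%N.
Proof. by apply/card_gt0P; exists 1%g; rewrite inE vperm1. Qed.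

Lemma card_vperm a b : #|[set r | a == vperm b r]| = (perm_eq (vlist a) (vlist b) * stab b)%N.
Proof.
case: vlist_permP => [[r0 ->]|na]; last first.
  rewrite mul0n; apply/eqP; rewrite cards_eq0; apply/eqP/setP => r; rewrite !inE.
  by apply/negP => /eqP e; apply: na; exists r.
rewrite mul1n /stab -!sum1dep_card (reindex_inj (mulgI r0)) /=; apply: eq_bigl => r.
by rewrite -vpermM (inj_eq (@vperm_inj _ r0)) eq_sym.
Qed.

(* Jacobi-Trudi coefficient of h_nu in s_lam. *)
Definition jt lam nu : rat :=
  \sum_s (-1) ^+ odd_perm s * (perm_eq (vlist (beta M lam - vperm delta s)) (vlist (vecn nu)))%:R.

(** Each rearrangement of nu comes from [stab] permutations r. The right side is the coefficient of
    the alternant of lam + delta when x^(r nu) times the alternant of delta, summed over r, is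
    straightened. *)
Lemma jt_stab lam nu :
  jt lam nu * (stab (vecn nu))%:R =
  \sum_r \sum_s (if vperm (vecn nu) r + delta == vperm (beta M lam) s then (-1) ^+ odd_perm s else 0).
Proof.
rewrite exchange_big (reindex_inj invg_inj) /= /jt mulr_suml; apply: eq_bigr => s _.
rewrite -mulrA -natrM -card_vperm -sum1dep_card (reindex_inj (mulgI s)) big_mkcond natr_sum mulr_sumr.
apply: eq_bigr => r _; rewrite odd_permV.
have -> : (vperm (vecn nu) r + delta == vperm (beta M lam) s^-1) =
    (beta M lam - vperm delta s == vperm (vecn nu) (s * r)%g).
  rewrite -(inj_eq (@vperm_inj _ s)) vpermD !vpermM mulgV vperm1 subr_eq eq_sym //.
by case: ifP => _; rewrite ?mulr1 ?mulr0.
Qed.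

End VectorLists.

Section AlternantVectors.
Variables (M : nat) (R : comRingType) (x : nat -> R).
Notation vec := {ffun 'I_M -> int}.
Notation delta := (beta M [::]).

Definition altv (b : vec) : R := \det (\matrix_(i < M, j < M) x i ^+ `|b j|%N).

Lemma altv_alternating : alternating altv.
Proof.
move=> b s; rewrite /altv.
have -> : \matrix_(i < M, j < M) x i ^+ `|vperm b s j|%N =
    col_perm s (\matrix_(i < M, j < M) x i ^+ `|b j|%N).
  by apply/matrixP => i j; rewrite !mxE vpermE.
rewrite col_permE det_mulmx det_perm odd_permV.
by case: (odd_perm s); rewrite ?expr1 ?mulrN1 ?expr0 ?mulr1.
Qed.

Lemma altv_injective b : altv b != 0 -> injective b.
Proof.
move=> h; apply/injectiveP; apply: contraNT h => /injectivePn[i [j ij e]].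
rewrite /altv -det_tr; apply/eqP; apply: (determinant_alternate ij) => k.
by rewrite !mxE e.
Qed.

Lemma altv_beta lam : altv (beta M lam) = altf x M (bexp M lam).
Proof. by congr (\det _); apply/matrixP => i j; rewrite !mxE vE. Qed.

(* Sum over all permutations rather than over the orbit of nu, so that every
   monomial is counted as many times as nu has stabilizing permutations. *)
Definition msym (nu : seq nat) : R := \sum_(s : 'S_M) \prod_(i < M) x i ^+ nth 0%N nu (s i).

(** [msym] is invariant under permuting the variables, so in each term u of the determinant r may be
    replaced by u r, which aligns the exponents. *)
Lemma msym_altv nu : msym nu * altv delta = \sum_r altv (vperm (vecn M nu) r + delta).
Proof.
have ex r (j : 'I_M) : `|((vperm (vecn M nu) r + delta)%R : vec) j|%N = (nth 0 nu (r j) + (M - j.+1))%N.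
  by rewrite !vE vecnE nth_nil.
rewrite mulrC /altv /determinant mulr_suml.
transitivity (\sum_(u : 'S_M) \sum_(r : 'S_M) (-1) ^+ u *
    \prod_(i < M) x i ^+ (nth 0%N nu (r (u i)) + (M - (u i).+1))).
  apply: eq_bigr => u _; rewrite /msym (reindex_inj (mulgI u)) mulr_sumr.
  apply: eq_bigr => r _; rewrite -mulrA; congr (_ * _); rewrite mulrC -big_split.
  by apply: eq_bigr => i _; rewrite mxE permM vE nth_nil add0n exprD.
rewrite exchange_big; apply: eq_bigr => r _; apply: eq_bigr => u _; congr (_ * _).
by apply: eq_bigr => i _; rewrite mxE ex.
Qed.

End AlternantVectors.

Definition padz M (l : seq nat) : seq nat := l ++ nseq (M - size l) 0%N.

Lemma nth_padz M l i : nth 0%N (padz M l) i = nth 0%N l i.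
Proof. by rewrite nth_cat; case: ltnP => // h; rewrite nth_nseq if_same nth_default. Qed.

Lemma size_padz M l : (size l <= M)%N -> size (padz M l) = M.
Proof. by move=> h; rewrite size_cat size_nseq subnKC. Qed.

Lemma sumn_padz M l : sumn (padz M l) = sumn l.
Proof. by rewrite sumn_cat sumn_nseq mul0n addn0. Qed.

Lemma sorted_padz M l : is_part l -> sorted geq (padz M l).
Proof.
move=> pl; apply/(sortedP 0%N) => i _; rewrite !nth_padz /=.
exact: part_nth_mono.
Qed.

Lemma vlist_vecn M l : (size l <= M)%N -> vlist (vecn M l) = map Posz (padz M l).
Proof.
move=> szl; have sv : size (vlist (vecn M l)) = M by rewrite size_map size_enum_ord.
apply: (@eq_from_nth _ 0); rewrite sv ?size_map ?size_padz // => i iM.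
rewrite (nth_map (Ordinal iM)) ?size_enum_ord // (nth_map 0%N) ?size_padz //.
by rewrite -[i in nth _ (enum _) i]/(val (Ordinal iM)) nth_ord_enum vecnE nth_padz.
Qed.

Lemma kst_padz M lam mu : is_part lam -> kst (padz M lam) (rev (padz M mu)) = kostka lam mu.
Proof.
move=> pl; have /andP[ss _] := pl; rewrite kostkaE // /padz rev_cat rev_nseq.
transitivity (kst lam (nseq (M - size mu) 0%N ++ rev mu)).
  elim: (M - size lam)%N => [|k IH]; first by rewrite cats0.
  by rewrite -[k.+1]addn1 nseqD catA cats1 kst_rcons0.
by elim: (M - size mu)%N => // k IH; rewrite [nseq _ _ ++ _]/= kst_0.
Qed.

Lemma gtw_size m sh w : w \in gtw m sh -> size w = m.
Proof.
elim: m sh w => [|m IH] sh w; first by rewrite inE => /eqP ->.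
by move=> /allpairsPdep[t [w' [_ /IH + ->]]] /= => ->.
Qed.

Lemma gtw_sumn m sh w : sorted geq sh -> size sh = m -> w \in gtw m sh -> sumn w = sumn sh.
Proof.
elim: m sh w => [|m IH] sh w ss; first by move=> /size0nil ->; rewrite inE => /eqP ->.
move=> sz; have s0 : (0 < size sh)%N by rewrite sz.
move=> /allpairsPdep[t [w' [th wh ->]]] /=.
have st : size t = m by have [-> _] := (mem_interl _ ss s0).1 th; rewrite sz.
by rewrite (IH t w') ?(interl_sorted ss s0 th) // subnK // (sumn_interl ss s0 th).
Qed.

Section Kronecker.
Variables (N M : nat).
Hypothesis NM : (N <= M)%N.
Notation vec := {ffun 'I_M -> int}.
Notation delta := (beta M [::]).

(* Kronecker substitution: exponents of the monomials below are at most N,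
   hence are read off as the base-(N+2) digits of a single exponent. *)
Let B := N.+2.
Let x (i : nat) : {poly rat} := 'X^(B ^ i).
Definition kcode (l : seq nat) : nat := (\sum_(i < M) nth 0 l i * B ^ i)%N.

Lemma wmon_kcode w : size w = M -> wmon x w = 'X^(kcode (rev w)).
Proof.
move=> sw; rewrite /kcode -sw; elim: w {sw} => [|n w IH] /=; first by rewrite big_ord0.
rewrite big_ord_recr /= IH /x -exprM -exprD; congr ('X^_).
rewrite addnC mulnC; congr (_ + _)%N.
  apply: eq_bigr => i _; rewrite rev_cons nth_rcons size_rev ltn_ord //.
by rewrite rev_cons nth_rcons size_rev ltnn eqxx.
Qed.

Lemma kcode_inj l l' : (forall i, nth 0 l i <= N)%N -> (forall i, nth 0 l' i <= N)%N ->
  kcode l = kcode l' -> forall i, (i < M)%N -> nth 0%N l i = nth 0%N l' i.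
Proof. by move=> h h' /big_digits_inj; apply=> i; rewrite ltnS leqW. Qed.

Lemma nth_le_sumn l i : (nth 0 l i <= sumn l)%N.
Proof.
case: (ltnP i (size l)) => h; last by rewrite nth_default.
by rewrite sumn_nthE (bigD1 (Ordinal h)) //= leq_addr.
Qed.

(** The code of mu singles out x^mu in the Schur polynomial. [gtw] lists weights from the largest
    letter, hence the reversals. *)
Lemma coef_schur lam mu : lam \in parts N -> mu \in parts N ->
  (\sum_(w <- gtw M (padz M lam)) wmon x w)`_(kcode mu) = (kostka lam mu)%:R.
Proof.
rewrite !mem_parts => /andP[pl /eqP sl] /andP[pm /eqP sm].
have szl : (size lam <= M)%N by rewrite (leq_trans (part_size pl)) // sl.
have szm : (size mu <= M)%N by rewrite (leq_trans (part_size pm)) // sm.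
rewrite -(kst_padz M _ pl) (@kst_gtw M) ?sorted_padz ?size_padz ?size_rev ?size_padz //.
rewrite coef_sum -sum1_count natr_sum big_seq [RHS]big_mkcond [RHS]big_seq.
apply: eq_bigr => w wh; have sw := gtw_size wh.
rewrite wmon_kcode // coefXn.
have sumw := gtw_sumn (sorted_padz M pl) (size_padz szl) wh; rewrite sumn_padz sl in sumw.
have -> : (kcode mu == kcode (rev w)) = (w == rev (padz M mu)); last by rewrite /=; case: (w == _).
apply/eqP/eqP => [e|->]; last first.
  by rewrite revK; apply: eq_bigr => i _; rewrite nth_padz.
have e' := kcode_inj _ _ e; apply: (can_inj revK); rewrite revK.
apply: (@eq_from_nth _ 0%N); rewrite size_rev ?size_padz // => i; rewrite sw => iM.
rewrite nth_padz e' // => j; first by rewrite -sm nth_le_sumn.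
by rewrite -sumw -sumn_rev nth_le_sumn.
Qed.

Lemma vperm_vecn_part lam mu s : is_part lam -> is_part mu -> (size lam <= M)%N -> (size mu <= M)%N ->
  vecn M lam = vperm (vecn M mu) s -> lam = mu.
Proof.
move=> pl pm sl sm e; have p : perm_eq (vlist (vecn M lam)) (vlist (vecn M mu)).
  by apply/vlist_permP; exists s.
rewrite !vlist_vecn // in p; have {}p : perm_eq (padz M lam) (padz M mu).
  by apply: perm_map_inj p => ? ? [].
have e' : padz M lam = padz M mu by apply: (sorted_eq geq_trans geq_anti); rewrite ?sorted_padz.
by apply: part_eq => // i; rewrite -(nth_padz M lam) e' nth_padz.
Qed.

Lemma coef_msym nu mu : nu \in parts N -> mu \in parts N ->
  (msym M x nu)`_(kcode mu) = ((mu == nu) * stab (vecn M nu))%:R.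
Proof.
rewrite !mem_parts => /andP[pn /eqP sn] /andP[pm /eqP sm].
have szn : (size nu <= M)%N by rewrite (leq_trans (part_size pn)) // sn.
have szm : (size mu <= M)%N by rewrite (leq_trans (part_size pm)) // sm.
have -> : ((mu == nu) * stab (vecn M nu) = #|[set r | vecn M mu == vperm (vecn M nu) r]|)%N.
  rewrite card_vperm; congr (_ * _)%N; congr (nat_of_bool _).
  apply/eqP/vlist_permP => [->|[s]]; first by exists 1%g; rewrite vperm1.
  exact: vperm_vecn_part.
rewrite /msym coef_sum -sum1dep_card natr_sum [RHS]big_mkcond; apply: eq_bigr => s _.
have -> : \prod_(i < M) x i ^+ nth 0%N nu (s i) =
    'X^(kcode [seq nth 0%N nu (s i) | i <- enum 'I_M]).
  rewrite /kcode expr_sum; apply: eq_bigr => i _.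
  by rewrite /x -exprM mulnC (nth_map i) ?size_enum_ord // nth_ord_enum.
rewrite coefXn.
set l := map _ _; have nl (i : 'I_M) : nth 0%N l i = nth 0%N nu (s i).
  by rewrite (nth_map i) ?size_enum_ord // nth_ord_enum.
have -> : (kcode mu == kcode l) = (vecn M mu == vperm (vecn M nu) s); last by case: eqP.
apply/eqP/eqP => e.
  apply/ffunP => i; rewrite vpermE !vecnE; congr Posz; rewrite -nl.
  apply: (kcode_inj _ _ e) => // j; first by rewrite -sm nth_le_sumn.
  case: (ltnP j M) => jM; last by rewrite nth_default // size_map size_enum_ord.
  by rewrite (nl (Ordinal jM)) -sn nth_le_sumn.
apply: eq_bigr => i _; rewrite nl; congr (_ * _)%N.
by have := congr1 (fun f : vec => f i) e; rewrite vpermE !vecnE => -[].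
Qed.

Lemma altv_delta_neq0 : altv x delta != 0 :> {poly rat}.
Proof.
rewrite altv_beta; elim: M => [|m IH]; first by rewrite /altf det_mx00 oner_neq0.
rewrite altf_delta mulf_neq0 //; apply/prodf_neq0 => i _; rewrite subr_eq0.
apply/eqP => /(congr1 (fun p : {poly rat} => size p)); rewrite !size_polyXn => -[] /eqP.
by rewrite eqn_exp2l //; have := ltn_ord i => h /eqP e; rewrite e ltnn in h.
Qed.

(** Multiply by the alternant of delta, straighten, rewrite the alternants by [altf_schur], and
    cancel the nonzero factor. *)
Lemma msym_schur nu : nu \in parts N ->
  msym M x nu = \sum_(lam <- parts N)
    (jt M lam nu * (stab (vecn M nu))%:R) *: \sum_(w <- gtw M (padz M lam)) wmon x w.
Proof.
rewrite mem_parts => /andP[pn /eqP sn].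
have szn : (size nu <= M)%N by rewrite (leq_trans (part_size pn)) // sn.
apply: (mulIf altv_delta_neq0); rewrite msym_altv mulr_suml.
transitivity (\sum_r \sum_(lam <- parts N) \sum_s
  (if vperm (vecn M nu) r + delta == vperm (beta M lam) s then (-1) ^+ odd_perm s else 0 : rat) *:
     altv x (beta M lam)).
  apply: eq_bigr => r _; rewrite (@straighten _ _ (altv x) _ N) //.
  - apply: eq_bigr => lam _; apply: eq_bigr => s _; case: ifP => _; rewrite ?scale0r //.
    by case: (odd_perm s); rewrite ?expr1 ?mulrN1z ?scaleN1r ?expr0 ?mulr1z ?scale1r.
  - exact: altv_alternating.
  - exact: altv_injective.
  - by move=> _ i; rewrite !vE vecnE.
  - have := vsum_beta szn; rewrite beta_vecn sn => e.
    by rewrite vsumD vsum_perm; move: e; rewrite vsumD; lia.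
rewrite exchange_big big_seq [RHS]big_seq; apply: eq_bigr => lam; rewrite mem_parts => /andP[pl /eqP sl].
have szl : (size lam <= M)%N by rewrite (leq_trans (part_size pl)) // sl.
rewrite jt_stab -scalerAl scaler_suml; apply: eq_bigr => r _.
rewrite scaler_suml; apply: eq_bigr => s _; congr (_ *: _).
have -> : altv x (beta M lam) = altf x M (bexp M (padz M lam)).
  by rewrite altv_beta; congr (\det _); apply/matrixP => i j; rewrite !mxE /bexp nth_padz.
by rewrite altf_schur ?sorted_padz ?size_padz // mulrC altv_beta.
Qed.

(** Compare the coefficients of x^mu in [msym_schur] and cancel the order of the stabilizer. *)
Lemma kostka_jt mu nu : mu \in parts N -> nu \in parts N ->
  \sum_(lam <- parts N) (kostka lam mu)%:R * jt M lam nu = (mu == nu)%:R.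
Proof.
move=> hm hn; have s0 : (stab (vecn M nu))%:R != 0 :> rat by rewrite pnatr_eq0 -lt0n stab_gt0.
apply: (mulIf s0); rewrite -natrM -coef_msym // msym_schur // coef_sum mulr_suml.
rewrite big_seq [RHS]big_seq; apply: eq_bigr => lam hl.
by rewrite coefZ coef_schur // [RHS]mulrC mulrA.
Qed.

Lemma invkostka_jt lam nu : lam \in parts N -> nu \in parts N ->
  invkostka N lam nu = jt M lam nu.
Proof.
move=> hl hn.
pose J : 'M[rat]_(size (parts N)) := \matrix_(i, j) jt M (nth [::] (parts N) i) (nth [::] (parts N) j).
have KJ : kostka_mx N *m J = 1%:M.
  apply/matrixP => i k; rewrite !mxE.
  have := kostka_jt (mem_nth [::] (ltn_ord i)) (mem_nth [::] (ltn_ord k)).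
  rewrite nth_uniq ?uniq_parts // => <-; rewrite (big_nth [::]) big_mkord.
  by apply: eq_bigr => j _; rewrite !mxE.
have iK : invmx (kostka_mx N) = J.
  have [uK _] := mulmx1_unit KJ.
  by rewrite -[LHS]mulmx1 -KJ mulmxA mulVmx // mul1mx.
have il : (index lam (parts N) < size (parts N))%N by rewrite index_mem.
have ik : (index nu (parts N) < size (parts N))%N by rewrite index_mem.
rewrite /invkostka /mxentry iK; case: insubP => [i _ ei|]; last by rewrite il.
case: insubP => [j _ ej|]; last by rewrite ik.
by rewrite mxE ei ej !nth_index.
Qed.

End Kronecker.

(** * Irreducible characters *)

Lemma perm_padz M l : size l = M ->
  perm_eq l (padz M (sort geq [seq x <- l | (0 < x)%N])).
Proof.
move=> sl; rewrite perm_sym; set p := [seq x <- l | _].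
have pz : perm_eq (p ++ [seq x <- l | ~~ (0 < x)%N]) l by rewrite /p perm_filterC.
apply: perm_trans (pz); apply: perm_cat; first by rewrite perm_sort.
have -> : [seq x <- l | ~~ (0 < x)%N] = nseq (size [seq x <- l | ~~ (0 < x)%N]) 0%N.
  by apply/all_pred1P/allP => v; rewrite mem_filter; case: v.
rewrite size_sort -sl -(perm_size pz) size_cat addKn //.
Qed.

Lemma perm_padz_part M l p : size l = M -> is_part p -> (size p <= M)%N ->
  perm_eq l (padz M p) = (sort geq [seq x <- l | (0 < x)%N] == p).
Proof.
move=> sl /andP[sp pp] szp; apply/idP/eqP => [e|<-]; last exact: perm_padz.
apply: (sorted_eq geq_trans geq_anti) => //; first exact: (sort_sorted geq_total).
rewrite perm_sort; have := perm_filter (fun x => 0 < x)%N e; rewrite filter_cat.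
by rewrite (all_filterP pp) filter_nseq /= cats0.
Qed.

Section TailPlacement.
Variable m : nat.
Notation M := m.+1.
Notation vec := {ffun 'I_M -> int}.
Definition tailkeys : seq 'I_M := map (lift ord0) (enum 'I_m).

Lemma uniq_tailkeys : uniq tailkeys.
Proof. by rewrite map_inj_uniq ?enum_uniq //; exact: lift_inj. Qed.

Lemma mem_tailkeys i : (i \in tailkeys) = (i != ord0).
Proof.
apply/mapP/idP => [[j _ ->]|]; first by rewrite eq_sym neq_lift.
by case: (unliftP ord0 i) => [j ->|->]; rewrite ?eqxx // => _; exists j; rewrite ?mem_enum.
Qed.

Lemma sum_tail (V : nmodType) (F : 'I_M -> V) : \sum_i F i = F ord0 + \sum_(i <- tailkeys) F i.
Proof. by rewrite big_ord_recl /tailkeys big_map big_enum. Qed.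

(** Coordinate 0 collects the unplaced parts; the total sum determines it, so only the other
    coordinates act as boxes. *)
Lemma pcoef_nplace rho (a : vec) : all (ltn 0) rho -> vsum a = (sumn rho)%:Z ->
  (forall i, i != ord0 -> 0 <= a i) ->
  pcoef rho a = nplace tailkeys rho (fun i => `|a i|%N).
Proof.
elim: rho a => [|d rho IH] a /=.
  move=> _ v0 apos; congr (nat_of_bool _); apply/eqP/allP => [-> i _|h].
    by rewrite ffunE.
  have z i : i != ord0 -> a i = 0.
    by rewrite -mem_tailkeys => /h /= /eqP/eqP; rewrite absz_eq0 => /eqP.
  apply/ffunP => i; rewrite [RHS]ffunE; case: (eqVneq i ord0) => [->|/z //].
  move: v0; rewrite /vsum sum_tail big_seq big1 ?addr0 // => j.
  by rewrite mem_tailkeys => /z.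
move=> /andP[d0 pr] vs apos.
rewrite [LHS](_ : _ = pcoef rho (a - evec ord0 d%:Z)%R +
    \sum_(i <- tailkeys) pcoef rho (a - evec i d%:Z)%R)%N; last exact: sum_tail.
congr (_ + _)%N.
  rewrite IH //.
  - by apply: eq_nplace => i; rewrite mem_tailkeys => /negPf i0; rewrite !vE i0 subr0.
  - by rewrite vsumD vsumN vsum_evec vs; lia.
  - by move=> i i0; rewrite !vE (negPf i0) subr0 apos.
rewrite [RHS]big_mkcond big_seq [RHS]big_seq; apply: eq_bigr => i; rewrite mem_tailkeys => i0.
have ai := apos _ i0; case: ifP => di; last first.
  by apply: (@pcoef_neg _ _ _ i) => //; rewrite !vE eqxx; lia.
rewrite IH //.
- apply: eq_nplace => j; rewrite mem_tailkeys => j0; rewrite !vE; have := apos _ j0.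
  by case: eqP => [->|_]; rewrite ?mul1n ?mul0n ?subr0 ?subn0 //; lia.
- by rewrite vsumD vsumN vsum_evec vs; lia.
- by move=> j j0; rewrite !vE; case: eqP => [->|_]; [lia | rewrite subr0 apos].
Qed.

Lemma vlist_tail (a : vec) : (forall i, 0 <= a i) ->
  vlist a = map Posz (`|a ord0|%N :: [seq `|a i|%N | i <- tailkeys]).
Proof.
move=> a0; rewrite /vlist enum_ordSl /= gez0_abs //; congr (_ :: _).
by rewrite -/tailkeys -map_comp; apply: eq_map => i /=; rewrite gez0_abs.
Qed.

Lemma npart_pos (l rho : seq nat) : all (ltn 0) rho ->
  npart (sort geq [seq x <- l | (0 < x)%N]) rho = npart l rho.
Proof.
move=> pr; rewrite (@npart_perm _ [seq x <- l | (0 < x)%N]) ?perm_sort //.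
have e : l = map (nth 0%N l) (iota 0 (size l)) by rewrite -[LHS](mkseq_nth 0%N).
rewrite {1}e filter_map npart_map ?filter_uniq ?iota_uniq // nplace_filter //.
by move=> i _ /=; case: (nth 0%N l i).
Qed.

Notation delta := (beta M [::]).

(** For fixed s at most one mu contributes, the sorted positive tail of the vector, and [npart] sees
    only this tail. Replacing N by |rho| alters coordinate 0 alone. *)
Lemma sum_orbit_npart lam rho (N : nat) (s : {perm 'I_M}) : is_part lam -> all (ltn 0) rho ->
  (2 * sumn lam < N)%N -> (N <= sumn rho)%N -> (sumn rho <= M)%N ->
  (\sum_(mu <- parts_upto (sumn lam))
     perm_eq (vlist (beta M (pad N lam) - vperm delta s)%R) (vlist (vecn M (pad N mu))) * npart mu rho
   = pcoef rho (beta M (pad (sumn rho) lam) - vperm delta s)%R)%N.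
Proof.
move=> pl pr hN Nn nM; set a := beta M (pad N lam) - vperm delta s.
set a' := beta M (pad (sumn rho) lam) - vperm delta s.
have szpad r : (2 * sumn lam < r)%N -> (r <= M)%N -> (size (pad r lam) <= M)%N /\ sumn (pad r lam) = r.
  move=> h1 h2; have sp : sumn (pad r lam) = r by rewrite /=; lia.
  by split=> //; have := part_size (is_part_pad pl h1); lia.
have vsa r : (2 * sumn lam < r)%N -> (r <= M)%N -> vsum (beta M (pad r lam) - vperm delta s) = r%:Z.
  move=> h1 h2; have [sz sm] := szpad r h1 h2.
  by rewrite vsumD vsumN vsum_perm [vsum (beta M (pad _ _))]vsum_beta // sm addrK.
have va : vsum a = N%:Z by apply: vsa => //; lia.
have va' : vsum a' = (sumn rho)%:Z by apply: vsa => //; lia.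
have eaa i : i != ord0 -> a' i = a i.
  by move=> i0; rewrite !vE; case: i i0 => [[|i] hi].
(* Coordinate 0 of delta is its largest, so at least N - |lam| > |lam| remains here. The tail then
   sums to at most |lam|, and sorting keeps coordinate 0 in front. *)
have a0 : (N - sumn lam)%:Z <= a ord0.
  by rewrite !vE /= nth_nil; lia.
(* A negative coordinate must lie in the tail, common to [a] and [a'], and makes both sides 0. *)
case: (boolP [forall i, 0 <= a i]) => [/forallP apos|]; last first.
  rewrite negb_forall => /existsP[i]; rewrite -ltNge => ai.
  have i0 : i != ord0 by apply/eqP => e; move: ai a0; rewrite e; lia.
  rewrite (@pcoef_neg _ _ _ i) ?eaa // big1 // => mu _.
  case: vlist_permP => // -[r e]; move: ai; rewrite e vpermE vecnE; lia.
pose T := [seq `|a i|%N | i <- tailkeys]; pose mu0 := sort geq [seq x <- T | (0 < x)%N].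
have sT : ((\sum_(i <- tailkeys) a i) = (sumn T)%:Z).
  rewrite sumnE [in RHS]big_map (big_morph Posz PoszD (erefl _)); apply: eq_bigr => i _.
  by rewrite gez0_abs.
have sumT : (`|a ord0| + sumn T = N)%N.
  have e : vsum a = a ord0 + \sum_(i <- tailkeys) a i := sum_tail a.
  by move: va; rewrite e sT; have := apos ord0; lia.
have smu0 : sumn mu0 = sumn T.
  rewrite /mu0 (sumn_perm (permEl (perm_sort _ _))) !sumnE big_filter [RHS](bigID (fun x => 0 < x)%N) /=.
  by rewrite [X in (_ + X)%N]big1 ?addn0 // => x; case: x.
have le0 : (sumn mu0 <= sumn lam)%N by rewrite smu0; have := apos ord0; lia.
have pmu0 : is_part mu0.
  by rewrite /is_part (sort_sorted geq_total) all_sort filter_all.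
have g0 : `|a ord0|%N = (N - sumn mu0)%N by rewrite smu0; lia.
have srt : sort geq [seq x <- `|a ord0|%N :: T | (0 < x)%N] = pad N mu0.
  apply: (sorted_eq geq_trans geq_anti).
  - exact: (sort_sorted geq_total).
  - by have /andP[] : is_part (pad N mu0) by apply: is_part_pad => //; lia.
  - rewrite perm_sort /= ifT; last by rewrite g0; lia.
    by rewrite g0 perm_cons perm_sym perm_sort.
have key mu : mu \in parts_upto (sumn lam) ->
    perm_eq (vlist a) (vlist (vecn M (pad N mu))) = (mu == mu0).
  rewrite mem_parts_upto => /andP[pm sm].
  have pp : is_part (pad N mu) by apply: is_part_pad => //; lia.
  have szp : (size (pad N mu) <= M)%N.
    by rewrite (leq_trans (part_size pp)) //= subnK; lia.
  rewrite vlist_tail // vlist_vecn //.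
  have -> : perm_eq (map Posz (`|a ord0|%N :: T)) (map Posz (padz M (pad N mu))) =
      perm_eq (`|a ord0|%N :: T) (padz M (pad N mu)).
    by apply/idP/idP => [|h]; [apply: perm_map_inj => ? ? [] | apply: perm_map].
  rewrite perm_padz_part ?srt //; last by rewrite /= size_map size_map size_enum_ord.
  by apply/eqP/eqP => [[_ ->]|->].
rewrite big_seq (eq_bigr (fun mu => (mu == mu0) * npart mu rho)%N); last first.
  by move=> mu hm; rewrite key.
rewrite -big_seq (bigD1_seq mu0) ?uniq_parts_upto ?mem_parts_upto ?pmu0 //= eqxx mul1n.
rewrite big1 ?addn0 => [|mu /negPf ->]; last by rewrite mul0n.
rewrite npart_pos // npart_map ?uniq_tailkeys // pcoef_nplace //.
  by apply: eq_nplace => i; rewrite mem_tailkeys => i0; rewrite eaa.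
by move=> i i0; rewrite eaa.
Qed.

(** Each inverse Kostka entry is a signed sum over s; once this sum is outermost, the inner sum over
    mu is the coefficient occurring in [chi]. *)
Lemma ev_stil rho lam : all (ltn 0) rho -> is_part lam ->
  (2 * sumn lam < sumn rho)%N -> (sumn rho <= M)%N ->
  ev rho (stil lam) = chi rho (beta M (pad (sumn rho) lam)).
Proof.
move=> pr pl h1 h2; rewrite /stil; set N := (2 * sumn lam).+1.
have NM : (N <= M)%N by rewrite /N; lia.
have padN mu : is_part mu -> (sumn mu <= sumn lam)%N -> pad N mu \in parts N.
  move=> pm sm; rewrite mem_parts is_part_pad //=; first by rewrite /N; lia.
  by rewrite /N; lia.
rewrite rmorph_sum /=.
transitivity (\sum_(mu <- parts_upto (sumn lam)) \sum_(s : {perm 'I_M}) (-1) ^+ odd_perm s *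
   ((perm_eq (vlist (beta M (pad N lam) - vperm delta s)%R) (vlist (vecn M (pad N mu))) * npart mu rho)%N%:R : rat)).
  rewrite big_seq [RHS]big_seq; apply: eq_bigr => mu; rewrite mem_parts_upto => /andP[pm sm].
  rewrite evZ ev_htil // (invkostka_jt NM) ?padN // /jt mulr_suml.
  by apply: eq_bigr => s _; rewrite natrM mulrA.
rewrite exchange_big; apply: eq_bigr => s _; rewrite -mulr_sumr -natr_sum.
by rewrite sum_orbit_npart // /N; lia.
Qed.

End TailPlacement.

(** * The Murnaghan-Nakayama rule *)

Lemma psum_at_divisors rho k : (0 < k)%N ->
  psum_at rho k = (\sum_(d <- divisors k) d * count_mem d rho)%N.
Proof.
move=> k0; elim: rho => [|r rho IH].
  by rewrite /psum_at big_nil big1 // => d _; rewrite muln0.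
rewrite psum_at_cons IH /=.
under [RHS]eq_bigr do rewrite mulnDr.
rewrite big_split /=; congr (_ + _)%N; case: ifP => rk.
  rewrite (bigD1_seq r) ?divisors_uniq -?dvdn_divisors //= eqxx muln1 big1 ?addn0 // => d.
  by rewrite eq_sym => /negPf ->; rewrite muln0.
rewrite big_seq big1 // => d; rewrite -dvdn_divisors // => dk.
by case: eqP => [e|_]; rewrite ?muln0 // e dk in rk *.
Qed.

Lemma leq_sumn_nth (s t : seq nat) : (forall i, nth 0 s i <= nth 0 t i)%N -> (sumn s <= sumn t)%N.
Proof.
elim: s t => // a s IH [|b t] h /=.
  have := h 0%N; rewrite /= leqn0 => /eqP ->; have := IH [::].
  by rewrite /= => -> // i; have := h i.+1; rewrite /= !nth_nil.
by apply: leq_add; [exact: (h 0%N) | apply: IH => i; exact: (h i.+1)].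
Qed.

Lemma sum_parts_pad (V : nmodType) (Phi : seq nat -> V) (n B : nat) : (2 * B < n)%N ->
  (forall nu, nu \in parts n -> (B < sumn (behead nu))%N -> Phi nu = 0) ->
  \sum_(nu <- parts n) Phi nu = \sum_(mu <- parts_upto B) Phi (pad n mu).
Proof.
move=> hn h; rewrite (bigID (fun nu => sumn (behead nu) <= B)%N) /=.
rewrite [X in _ + X]big_seq_cond [X in _ + X]big1 ?addr0; last first.
  by move=> nu /andP[nn]; rewrite -ltnNge; exact: h.
rewrite -big_filter -[RHS](big_map (pad n) predT Phi); apply: perm_big; apply: uniq_perm.
- by rewrite filter_uniq ?uniq_parts.
- by rewrite map_inj_uniq ?uniq_parts_upto // => ? ? [].
move=> nu; rewrite mem_filter mem_parts; apply/and3P/mapP => [[sb pn /eqP sn]|[mu]].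
  case: nu sb pn sn => [|a nu] /=; first by lia.
  rewrite is_part_cons => sb /and3P[_ _ pn] sn; exists nu; first by rewrite mem_parts_upto pn.
  by rewrite /pad -sn addnK.
rewrite mem_parts_upto => /andP[pm sm] ->; split=> //; first by apply: is_part_pad => //; lia.
by rewrite /= subnK //; lia.
Qed.

Lemma border_strip_sub mu rho d : border_strip mu rho d -> forall i, (nth 0 rho i <= nth 0 mu i)%N.
Proof.
move=> /and4P[/andP[_ /allP h] _ _ _] i.
by case: (ltnP i (size rho)) => ir; [apply: h; rewrite mem_iota | rewrite nth_default].
Qed.

(** Splitting off a d-cycle of [rho] removes a strip from lam; [chi_up] then absorbs d m_d by adding
    a strip and restoring [rho]. Without d-cycles both sides vanish. *)
Lemma chi_mult_strips m rho lam (d : nat) : all (ltn 0) rho -> is_part lam -> (0 < d)%N ->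
  (d <= sumn rho)%N -> sumn lam = sumn rho -> (sumn rho <= m.+1)%N ->
  (d * count_mem d rho)%:R * chi rho (beta m.+1 lam) =
  \sum_(al <- parts (sumn rho - d)) strip_sum m.+1 lam al d *
    \sum_(nu <- parts (sumn rho)) strip_sum m.+1 nu al d * chi rho (beta m.+1 nu).
Proof.
move=> pr pl d0 dn sl nM.
have szl : (size lam <= m.+1)%N by have := part_size pl; lia.
transitivity (\sum_(al <- parts (sumn rho - d)) strip_sum m.+1 lam al d *
    ((d * count_mem d rho)%:R * chi (rem d rho) (beta m.+1 al))).
  case dr: (d \in rho); last first.
    rewrite (count_memPn _) ?dr // muln0 mul0r big1 // => al _; by rewrite mul0r mulr0.
  have prr : all (ltn 0) (rem d rho) by apply/allP => r /mem_rem; apply/allP.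
  rewrite (chi_rem _ dr) chi_cons (@sum_down _ _ _ _ (sumn rho - d)) //; try lia.
  by rewrite mulr_sumr; apply: eq_bigr => al _; rewrite mulrCA.
rewrite big_seq [RHS]big_seq; apply: eq_bigr => al; rewrite mem_parts => /andP[pa /eqP sa].
congr (_ * _); rewrite -chi_up //; last by move=> i; exact: beta_ge0.
by apply: sum_up => //; [have := part_size pa; lia | lia].
Qed.

(* The sums over nu and alpha (partitions) are finitely supported; they are
   stated as: for all sufficiently large size bounds B, truncating both sums
   to partitions of size <= B gives p_k * s~_lambda. *)
Theorem theorem19 (k : nat) (lam : seq nat) :
  (0 < k)%N -> is_part lam ->
  exists B0 : nat, forall B : nat, (B0 <= B)%N ->
    psum k * stil lam =
    \sum_(nu <- parts_upto B) mn_coef B k lam nu *: stil nu.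
Proof.
(* Nonzero terms have |al| <= |lam| and |nu| <= |al| + d <= |lam| + k, so this bound truncates
   nothing. *)
move=> k0 pl; exists (sumn lam + k)%N => B hB.
apply/eqP; rewrite -subr_eq0; apply/eqP.
(* Then n > 2(|mu| + |al| + d) for all mu, al of size at most B and all d dividing k, as [bstripE]
   requires. *)
apply: (@ev_separates _ (4 * B + 2 * k).+1) => rho pr hn.
set n := sumn rho in hn.
have evs nu : is_part nu -> (sumn nu <= B)%N ->
    ev rho (stil nu) = chi rho (beta n.+1 (pad n nu)).
  move=> pn sn; have h1 : (2 * sumn nu < n)%N by lia.
  exact: (ev_stil pr pn h1 (leqnSn n)).
rewrite rmorphB rmorphM /= ev_psum //; apply/eqP; rewrite subr_eq0; apply/eqP.
rewrite [X in _ * X = _]evs //; last by lia.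
rewrite psum_at_divisors // natr_sum mulr_suml rmorph_sum /=.
transitivity (\sum_(nu <- parts_upto B) \sum_(d <- divisors k)
   \sum_(al <- parts_upto B | bstrip d lam al && bstrip d nu al)
      (-1) ^+ (bht d lam al + bht d nu al) * chi rho (beta n.+1 (pad n nu))); last first.
  rewrite big_seq [RHS]big_seq; apply: eq_bigr => nu; rewrite mem_parts_upto => /andP[pn sn].
  rewrite evZ evs //.
  by rewrite /mn_coef mulr_suml; apply: eq_bigr => d _; rewrite mulr_suml.
rewrite exchange_big big_seq [RHS]big_seq; apply: eq_bigr => d /=.
rewrite -dvdn_divisors // => dk; have d0 := dvdn_gt0 k0 dk; have dlek := dvdn_leq k0 dk.
have pL : is_part (pad n lam) by apply: is_part_pad => //; lia.
have sL : sumn (pad n lam) = n by rewrite /= subnK //; lia.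
have E mu al : is_part mu -> is_part al -> (sumn mu <= B)%N -> (sumn al <= B)%N ->
    strip_sum n.+1 (pad n mu) (pad (n - d) al) d =
    if bstrip d mu al then (-1) ^+ bht d mu al else 0.
  move=> pm pa sm sa; have [|e1 e2] := @bstripE n d mu al pm pa d0; first by lia.
  have p1 : is_part (pad n mu) by apply: is_part_pad => //; lia.
  have p2 : is_part (pad (n - d) al) by apply: is_part_pad => //; lia.
  rewrite strip_sumE // -?e1.
  - by case: ifP => // /e2 ->.
  - by have := part_size p1; rewrite /= subnK; lia.
  - by have := part_size p2; rewrite /= subnK; lia.
rewrite (@chi_mult_strips n) //; last by lia.
rewrite -/n (@sum_parts_pad _ _ (n - d) B); [|by lia|]; last first.
  move=> al; rewrite mem_parts => /andP[pa /eqP sa] sB; rewrite strip_sumE //; first last.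
  - by have := part_size pa; lia.
  - by have := part_size pL; lia.
  case: ifP => [bs|_]; last by rewrite mul0r.
  (* Containment of the padded shapes bounds the rows below the first by lam. *)
  have le : (sumn (behead al) <= sumn lam)%N.
    by apply: leq_sumn_nth => i; rewrite nth_behead; exact: (border_strip_sub bs i.+1).
  by lia.
rewrite [RHS](exchange_big_dep predT) //= big_seq [RHS]big_seq; apply: eq_bigr => al.
rewrite mem_parts_upto => /andP[pa sa]; rewrite E //; last by lia.
case: ifP => bl; last by rewrite mul0r big1 // => nu; rewrite bl.
rewrite [RHS](eq_bigl (fun nu => bstrip d nu al)) //.
have sal : (sumn al <= sumn lam)%N.
  have [|e1 _] := @bstripE n d lam al pl pa d0; first by lia.
  apply: leq_sumn_nth => i; rewrite e1 in bl.
  exact: (border_strip_sub bl i.+1).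
have p2 : is_part (pad (n - d) al) by apply: is_part_pad => //; lia.
have s2 : sumn (pad (n - d) al) = (n - d)%N by rewrite /= subnK //; lia.
rewrite (@sum_parts_pad _ _ n B); [|by lia|]; last first.
  move=> nu; rewrite mem_parts => /andP[pn /eqP sn] sB; rewrite strip_sumE //; first last.
  - by have := part_size p2; lia.
  - by have := part_size pn; lia.
  case: ifP => [bs|_]; last by rewrite mul0r.
  (* The first row of nu has at least n - d - |al| cells, which leaves at most |al| + d <= B below
     it. *)
  have := border_strip_sub bs 0; rewrite /= nth0; case: nu sn sB {pn bs} => [|a nu] /=; lia.
rewrite mulr_sumr big_seq [RHS]big_seq_cond [RHS]big_mkcondr; apply: eq_bigr => nu.
rewrite mem_parts_upto => /andP[pn sn]; rewrite E //.
by case: ifP => _; rewrite ?mul0r ?mulr0 // exprD mulrA.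
Qed.
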